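(* Let $(X,\mathcal B,m,T)$ be a log-lower bounded (LLB), conservative, ergodic, measure preserving transformation of a $\sigma$-finite measure space. Let $\mathcal F_{\Pi}:=\mathcal P_T\cap\mathcal F_{\log,T}$. Then: (i) $\mathcal F_{\Pi}$ is a ring of sets, and for every $F\in\mathcal F_{\Pi}$ one has $\mathcal F_{\Pi}\cap F=\mathcal P_F$, where $\mathcal F_\Pi\cap F:=\{A\in\mathcal F_\Pi: A\subseteq F\}$. (ii) If $\mathcal F_{\Pi}\neq\emptyset$, then $\sigma(\mathcal F_{\Pi})$ is the maximal factor of zero entropy of $T$; that is, $\sigma(\mathcal F_\Pi)$ is a factor with $\underline h(T,\sigma(\mathcal F_\Pi))=0$, and every factor $\mathcal C\subseteq\mathcal B$ with $\underline h(T,\mathcal C)=0$ satisfies $\mathcal C\subseteq\sigma(\mathcal F_\Pi)$ mod $m$.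
   Context: All sets, partitions and $\sigma$-algebras are considered modulo $m$-null sets. For $A\in\mathcal B$ with $0<m(A)<\infty$, the first return time is $\varphi_A(x):=\min\{n\ge1: T^nx\in A\}$ ($x\in A$) and the induced transformation is $T_Ax:=T^{\varphi_A(x)}x$, which is an ergodic probability preserving transformation of $A$ with the normalized measure $m_A:=m(\cdot\cap A)/m(A)$. $\mathcal F_{\log,T}:=\{A\in\mathcal B: 0<m(A)<\infty,\ \int_A\log\varphi_A\,dm<\infty\}$. $T$ is log-lower bounded (LLB) if $\mathcal F_{\log,T}\ne\emptyset$. A set $A\in\mathcal B$ with $m(A)<\infty$ is $T$-predictable if $A\in\sigma(\{T^{-n}A:n\ge1\})$; $\mathcal P_T$ is the collection of $T$-predictable sets. For $F$ with $0<m(F)<\infty$, $\mathcal P_F:=\{A\in\mathcal B,\ A\subseteq F: A\in\sigma(\{T_F^{-k}A:k\ge1\})\}$ (the predictable sets of $T_F$, generated as $\sigma$-algebra of subsets of $F$). In the assertions that $\mathcal F_\Pi$ is a ring and that $\mathcal F_\Pi\cap F=\mathcal P_F$, null sets are regarded as belonging to $\mathcal F_\Pi$. A factor of $T$ is a $T$-invariant sub-$\sigma$-algebra $\mathcal C\subseteq\mathcal B$ ($T^{-1}\mathcal C\subseteq\mathcal C$) on which $m$ is $\sigma$-finite. The Krengel entropy of $T$ with respect to a factor $\mathcal C$ is $\underline h(T,\mathcal C):=m(A)\,h(T_A,\mathcal C\cap A)$ for any $A\in\mathcal C$ with $0<m(A)<\infty$ (the value does not depend on $A$), where $\mathcal C\cap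 A=\{C\cap A:C\in\mathcal C\}$ and $h(T_A,\mathcal C\cap A)$ is the usual (Kolmogorov–Sinai) entropy of the probability preserving transformation $T_A$ restricted to the invariant $\sigma$-algebra $\mathcal C\cap A$. *)

(* Defs.v *)
From HB Require Import structures.
From mathcomp Require Import all_boot all_order all_algebra.
From mathcomp Require Import all_classical all_reals all_analysis.

Set Implicit Arguments.
Unset Strict Implicit.
Unset Printing Implicit Defensive.
Import Order.TTheory GRing.Theory Num.Theory.
Import numFieldNormedType.Exports.
Local Open Scope classical_set_scope.
Local Open Scope ring_scope.

Section infinite_ergodic_theory.
Context (d : measure_display) (X : measurableType d) (R : realType).
Implicit Types (m : set X -> \bar R) (T S : X -> X) (A F : set X).
Implicit Types (C D G : set (set X)).

Definition measure_preserving m T : Prop :=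
  measurable_fun [set: X] T /\
  forall A, measurable A -> m (T @^-1` A) = m A.

(* Every wandering set is null. *)
Definition conservative m T : Prop :=
  forall W, measurable W ->
    trivIset [set: nat] (fun n => iter n T @^-1` W) -> m W = 0%E.

Definition ergodic m T : Prop :=
  forall A, measurable A -> m ((T @^-1` A) `+` A) = 0%E ->
    m A = 0%E \/ m (~` A) = 0%E.

(* The measurable sets equal modulo m to a member of G. Collections of sets
   are only meant modulo m-null sets, so "A belongs to G" is rendered by
   "A belongs to mod_null m G". *)
Definition mod_null m G : set (set X) :=
  [set A | measurable A /\ exists2 B, G B & m (A `+` B) = 0%E].

Definition null_sets m : set (set X) :=
  [set N | measurable N /\ m N = 0%E].

(* The junk value 0 at the points of A that never return to A occurs only on
   a null set when T is conservative and measure preserving. *)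
Definition return_time T A (x : X) : nat :=
  xget 0%N [set n | [/\ (0 < n)%N, A (iter n T x) &
    forall k, (0 < k)%N -> A (iter k T x) -> (n <= k)%N]].

Definition induced_map T A (x : X) : X := iter (return_time T A x) T x.

(* The normalized measure m_A. *)
Definition induced_measure m A (B : set X) : R :=
  fine (m (B `&` A)) / fine (m A).

Definition Flog m T : set (set X) :=
  [set A | [/\ measurable A, (0 < m A < +oo)%E &
    (\int[m]_(x in A) (ln (return_time T A x)%:R)%:E < +oo)%E]].

Definition log_lower_bounded m T : Prop := Flog m T !=set0.

Definition predictable m T : set (set X) :=
  [set A | [/\ measurable A, (m A < +oo)%E &
    mod_null m <<s [set iter n T @^-1` A | n in [set n | (0 < n)%N]] >> A]].

(* The predictable sets of T_F, as a collection of subsets of F. *)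
Definition induced_predictable m T F : set (set X) :=
  [set A | [/\ measurable A, A `<=` F &
    mod_null m
      <<s F, [set F `&` (iter k (induced_map T F) @^-1` A)
             | k in [set k | (0 < k)%N]] >> A]].

Definition FPi m T : set (set X) := predictable m T `&` Flog m T.

Definition FPi0 m T : set (set X) := FPi m T `|` null_sets m.

Definition dyn_factor m T C : Prop :=
  [/\ sigma_algebra [set: X] C,
      C `<=` measurable,
      (forall A, C A -> mod_null m C (T @^-1` A)) &
      exists2 E : (set X)^nat, \bigcup_n E n = [set: X] &
        forall n, C (E n) /\ (m (E n) < +oo)%E].

(* Kolmogorov-Sinai entropy of a transformation S of the space A preserving
   the probability mu and the sigma-algebra D of subsets of A. *)

Definition partition_of A D (k : nat) (P : 'I_k -> set X) : Prop :=
  [/\ forall i, D (P i), trivIset [set: 'I_k] P &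
      \bigcup_(i in [set: 'I_k]) P i = A].

(* The join of the S^{-j} P for j < n; its cells, some possibly empty, are
   indexed by the words of length n over 'I_k. *)
Definition iterated_join S A (k : nat) (P : 'I_k -> set X) (n : nat)
    (w : {ffun 'I_n -> 'I_k}) : set X :=
  A `&` \bigcap_(j in [set: 'I_n]) (iter j S @^-1` P (w j)).

Definition partition_entropy (mu : set X -> R) (I : finType)
    (P : I -> set X) : R :=
  - \sum_(i : I) mu (P i) * ln (mu (P i)).

Definition entropy_wrt (mu : set X -> R) S A (k : nat) (P : 'I_k -> set X)
    : R :=
  limn (fun n => partition_entropy mu (iterated_join S A P (n := n)) / n%:R).

Definition ks_entropy (mu : set X -> R) S A D : \bar R :=
  ereal_sup [set h | exists (k : nat) (P : 'I_k -> set X),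
    partition_of A D P /\ h = (entropy_wrt mu S A P)%:E].

(* The value does not depend on A in C with 0 < m A < +oo, so an arbitrary
   such A is picked; one exists if C is a factor and m is not zero. *)
Definition krengel_entropy m T C : \bar R :=
  let A := xget set0 [set A | C A /\ (0 < m A < +oo)%E] in
  (m A * ks_entropy (induced_measure m A) (induced_map T A) A (strace C A))%E.

End infinite_ergodic_theory.

(* Main.v *)
Require Import Defs.
From HB Require Import structures.
From mathcomp Require Import all_boot all_order all_algebra.
From mathcomp Require Import all_classical all_reals all_analysis.
From mathcomp Require Import measurable_realfun ring lra zify.
Import Order.TTheory GRing.Theory Num.Theory.
Import numFieldNormedType.Exports.
Local Open Scope classical_set_scope.
Local Open Scope ring_scope.

(** For a set [A] with [0 < m A < +oo], [Pi_on m T A] is the Pinsker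
    sigma-algebra of the induced map [T_A]: the sets of zero entropy, which are
    also the sets predictable for [T_A] ([PiP]). [A] is called a set of zero
    entropy ([zero_entropy_set]) if all the levels of its return time lie in
    [Pi_on m T A]; such a base sees the whole dynamics of [T] through a system
    whose timing carries no entropy. The theorem is the comparison of these
    bases with the predictable sets that have a log-integrable return time.

    A set of zero entropy is predictable ([zero_entropy_predictable]): in a
    system of zero entropy the past is a function of the future, so the point of
    return to [A] determines the time elapsed since the preceding visit.

    Log-integrability is used for the converse, through one principle
    ([relative_predictable]): a countable partition of finite entropy that is
    determined by its own future and by sets of zero entropy consists of sets of
    zero entropy. Given a predictable [F] with log-integrable return time and a
    set [A], the partition is the excursion of a point of [A `&` F]: the string
    of its return times to [F] until the next visit to [A `&` F]. By the
    inequalities of Kraft and Gibbs the entropy of the excursion is bounded in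
    terms of the integral of the sum of the costs of the return times in the
    string, a cost being of the order of the logarithm; by Kac's argument that
    integral is at most the integral over [F] of the cost of one return time,
    hence finite ([excursion_entropy]). Since [F] is predictable, from the end of an excursion
    and its duration one reads it backwards ([excursion_future_determines]).
    With [A = F] this shows that [F] is a set of zero entropy
    ([predictable_zero_entropy]), and with a set [A] of zero entropy it shows that
    [F] belongs to [Pi_on m T A] ([predictable_Pi]).

    For a base [E] of zero entropy let [ZE m T E] be the collection of the sets
    all of whose preimages under [T] belong to [Pi_on m T E]. It is an invariant
    sigma-algebra, and it does not change when [E] is replaced by a set of finite
    positive measure that belongs to it ([ZE_change]). With [predictable_Pi] this
    gives [ZE m T A = ZE m T F] for every [A] of zero entropy and every [F] in
    [FPi m T] ([ZE_FPi]). So [FPi0 m T] consists of the sets of finite measure in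
    [ZE m T F] whose return time is log-integrable ([FPi0P]); it is a ring because
    log-integrability passes to finite unions and to measurable subsets. Its
    members inside [F] are all of [Pi_on m T F] inside [F], and it generates
    [ZE m T F], because almost every point of a set lies in one of its
    intersections with the preimages of [F]. Finally, if a factor [C] has zero entropy and [A] in [C] has
    finite positive measure, then [C] lies in [Pi_on m T A]; in particular [A] is a set of zero entropy,
    and [C] is contained in [ZE m T A = ZE m T F] ([factor_ZE]). *)

Set Implicit Arguments.
Unset Strict Implicit.
Unset Printing Implicit Defensive.

(** * Logarithmic inequalities for finite sums *)

Section finite_sums.
Context (R : realType).
Implicit Types x y : R.

Lemma ln_le_subr1 x : 0 < x -> ln x <= x - 1.
Proof.
move=> x0; have -> : x = 1 + (x - 1) by ring.
apply: le_trans (le_ln1Dx _) _; lra.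
Qed.

Lemma xlnx_le x y : 0 <= x -> x <= y -> x * ln (x / y) <= 0.
Proof.
move=> x0 xy; case: (ltgtP x 0) x0 => // [x1|->] _; last by rewrite mul0r.
rewrite pmulr_rle0//; apply: ln_le0.
by rewrite ler_pdivrMr ?mul1r//; apply: lt_le_trans xy.
Qed.

(** The log-sum inequality: each term lies above the tangent of [t * ln t] at the
    common ratio of the two sums. *)
Lemma log_sum (K : finType) (P : pred K) (a b : K -> R) :
  (forall k, P k -> 0 <= a k) -> (forall k, P k -> a k <= b k) ->
  (\sum_(k | P k) a k) * ln ((\sum_(k | P k) a k) / (\sum_(k | P k) b k)) <=
  \sum_(k | P k) a k * ln (a k / b k).
Proof.
move=> a0 ab; set A := \sum_(k | P k) a k; set B := \sum_(k | P k) b k.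
have A0 : 0 <= A by exact: sumr_ge0.
have AB : A <= B by exact: ler_sum.
case: (ltgtP A 0) A0 => // [A1 _|A1 _]; last first.
  rewrite A1 mul0r big1// => k Pk; suff -> : a k = 0 by rewrite mul0r.
  apply/eqP; rewrite eq_le a0// andbT -A1 /A (bigD1 k)//= lerDl.
  by apply: sumr_ge0 => i /andP[/a0].
have B1 : 0 < B by apply: lt_le_trans AB.
have H k : P k -> a k * ln (A / B) <= a k * ln (a k / b k) + (A / B * b k - a k).
  move=> Pk; case: (ltgtP (a k) 0) (a0 _ Pk) => // [ak|->] _; last first.
    rewrite !mul0r add0r subr0 mulr_ge0 ?divr_ge0 ?(ltW A1) ?(ltW B1)//.
    by apply: le_trans (ab _ Pk); apply: a0.
  have bk : 0 < b k by apply: lt_le_trans (ab _ Pk).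
  have -> : ln (A / B) = ln (a k / b k) + ln (A / B * b k / a k).
    rewrite -lnM ?posrE ?divr_gt0 ?mulr_gt0 ?invr_gt0//; congr ln; field.
    by rewrite !gt_eqF.
  rewrite mulrDr lerD2l.
  have q0 : 0 < A / B * b k / a k by rewrite divr_gt0 ?mulr_gt0 ?invr_gt0.
  have -> : A / B * b k - a k = a k * (A / B * b k / a k - 1).
    by field; rewrite !gt_eqF.
  by rewrite ler_wpM2l ?(ltW ak) ?ln_le_subr1.
rewrite mulr_suml; apply: le_trans (ler_sum _ H) _.
rewrite big_split/= sumrB -mulr_sumr -/B -/A divfK ?subrr ?addr0//.
by rewrite gt_eqF.
Qed.

End finite_sums.

(** * Conditional entropy of finite-valued functions *)

Section conditional_entropy.
Context (d : measure_display) (X : measurableType d) (R : realType).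
Variable mu : {measure set X -> \bar R}.
Hypothesis mufin : (mu [set: X] < +oo)%E.
Implicit Types (I J K : finType) (A B : set X).

Definition fmu A : R := fine (mu A).

Lemma fmuE A : measurable A -> (mu A = (fmu A)%:E)%E.
Proof.
move=> mA; rewrite /fmu fineK// ge0_fin_numE//.
by apply: le_lt_trans mufin; apply: le_measure; rewrite ?inE.
Qed.

Lemma fmu_ge0 A : 0 <= fmu A. Proof. exact: fine_ge0. Qed.

Lemma fmuU A B : measurable A -> measurable B -> [disjoint A & B] ->
  fmu (A `|` B) = fmu A + fmu B.
Proof.
move=> mA mB /disj_set2P AB; apply: EFin_inj.
rewrite EFinD -!fmuE//; last exact: measurableU.
exact: measureU.
Qed.

Lemma le_fmu A B : measurable A -> measurable B -> A `<=` B -> fmu A <= fmu B.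
Proof.
move=> mA mB AB; rewrite -lee_fin -!fmuE//.
by apply: le_measure; rewrite ?inE.
Qed.

Definition measurable_fibers I (f : X -> I) := forall i, measurable (f @^-1` [set i]).

Lemma fmu_part I (f : X -> I) A : measurable_fibers f -> measurable A ->
  fmu A = \sum_i fmu (f @^-1` [set i] `&` A).
Proof.
move=> mfI mA; apply: EFin_inj; rewrite -fmuE// -sumEFin.
rewrite (eq_bigr (fun i => mu (f @^-1` [set i] `&` A))); last first.
  by move=> i _; rewrite -fmuE//; exact: measurableI.
rewrite (@bigfs _ _ _ _ _ xpredT) ?index_enum_uniq//; last first.
  by move=> i _; rewrite mem_index_enum.
rewrite -measure_fin_bigcup//.
- congr (mu _); apply/seteqP; split => x; first by move=> Ax; exists (f x).
  by case=> i _ [].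
- by move=> i j _ _ [x [[<- _] [<- _]]].
- by move=> i _; apply: measurableI.
Qed.

Lemma fmu_part_cond I J (f : X -> I) (u : I -> J) j A : measurable_fibers f -> measurable A ->
  fmu ((u \o f) @^-1` [set j] `&` A) =
  \sum_(i | u i == j) fmu (f @^-1` [set i] `&` A).
Proof.
move=> mfI mA.
have mB : measurable ((u \o f) @^-1` [set j] `&` A).
  apply: measurableI => //.
  have -> : (u \o f) @^-1` [set j] = \bigcup_(i in [set i | u i = j]) f @^-1` [set i].
    by apply/seteqP; split => x /=; [move=> <-; exists (f x)|case=> i /= <- <-].
  by apply: fin_bigcup_measurable => //; exact: finite_finset.
rewrite (fmu_part mfI mB) [RHS]big_mkcond/=; apply: eq_bigr => i _.
case: eqP => [uj|uj].
  congr fmu; apply/seteqP; split => x /=; first by case=> [? []].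
  by case=> fx Ax; rewrite fx.
suff -> : f @^-1` [set i] `&` ((u \o f) @^-1` [set j] `&` A) = set0.
  by rewrite /fmu measure0.
by apply/seteqP; split => // x /= [fx [ux _]]; apply: uj; rewrite -fx.
Qed.

(** The conditional entropy of [f] given [g], for a finite measure that is not
    normalised. The conventions [ln 0 = 0] and [x / 0 = 0] make the cells of
    measure zero contribute nothing. *)
Definition cond_entropy I J (f : X -> I) (g : X -> J) : R :=
  - \sum_(j : J) \sum_(i : I) fmu (f @^-1` [set i] `&` g @^-1` [set j]) *
      ln (fmu (f @^-1` [set i] `&` g @^-1` [set j]) / fmu (g @^-1` [set j])).

Lemma le_fmuIr A B : measurable A -> measurable B -> fmu (A `&` B) <= fmu B.
Proof. by move=> mA mB; apply: le_fmu => //; exact: measurableI. Qed.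

Lemma le_fmuIl A B : measurable A -> measurable B -> fmu (A `&` B) <= fmu A.
Proof. by move=> mA mB; rewrite setIC; exact: le_fmuIr. Qed.

Lemma cond_entropy_ge0 I J (f : X -> I) (g : X -> J) : measurable_fibers f -> measurable_fibers g -> 0 <= cond_entropy f g.
Proof.
move=> mfI mg; rewrite oppr_ge0; apply: sumr_le0 => j _; apply: sumr_le0 => i _.
by apply: xlnx_le; rewrite ?fmu_ge0 ?le_fmuIr.
Qed.

(** Merging cells of the condition merges terms of the log-sum inequality. *)
Lemma cond_entropy_comp_r I J J' (f : X -> I) (g : X -> J) (u : J -> J') :
  measurable_fibers f -> measurable_fibers g -> cond_entropy f g <= cond_entropy f (u \o g).
Proof.
move=> mfI mg; rewrite lerN2 exchange_big [leRHS]exchange_big/=.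
apply: ler_sum => i _; rewrite [leRHS](partition_big u xpredT)//=.
apply: ler_sum => j _; rewrite setIC fmu_part_cond//.
rewrite -[(u \o g) @^-1` [set j]]setIT fmu_part_cond//.
under [leRHS]eq_bigr do rewrite setIC.
under [X in _ / X]eq_bigr do rewrite setIT.
apply: log_sum => j' _; first exact: fmu_ge0.
exact: le_fmuIl.
Qed.

Lemma cond_entropy_comp_l I I' J (f : X -> I) (g : X -> J) (u : I -> I') :
  measurable_fibers f -> measurable_fibers g -> cond_entropy (u \o f) g <= cond_entropy f g.
Proof.
move=> mfI mg; rewrite lerN2; apply: ler_sum => j _.
rewrite [leLHS](partition_big u xpredT)//=; apply: ler_sum => i' _.
rewrite fmu_part_cond// mulr_suml; apply: ler_sum => i /eqP ui.
set a := fmu _; set b := fmu _; set s := \sum_(k | _) _.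
have a0 : 0 <= a by exact: fmu_ge0.
case: (ltgtP a 0) a0 => // [a1|->] _; last by rewrite !mul0r.
have ab : a <= b by exact: le_fmuIr.
have b0 : 0 < b by apply: lt_le_trans ab.
have as_ : a <= s.
  rewrite /s (bigD1 i) ?ui//= lerDl; apply: sumr_ge0 => *; exact: fmu_ge0.
have s0 : 0 < s by apply: lt_le_trans as_.
by rewrite ler_pM2l// ler_ln ?posrE ?divr_gt0// ler_pM2r ?invr_gt0.
Qed.

Definition determines I J (g : X -> J) (f : X -> I) := forall x y, g x = g y -> f x = f y.

Lemma facP I J (g : X -> J) (f : X -> I) : determines g f -> exists u, f = u \o g.
Proof.
move=> gf; exists (fun j => f (xget point (g @^-1` [set j]))).
by apply/funext => x /=; apply: gf; rewrite [RHS](@xgetPex _ point (g @^-1` [set g x]))//; exists x.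
Qed.

Lemma cond_entropy_fac_r I J J' (f : X -> I) (g : X -> J) (g' : X -> J') :
  measurable_fibers f -> measurable_fibers g -> determines g g' -> cond_entropy f g <= cond_entropy f g'.
Proof. by move=> mfI mg /facP[u ->]; exact: cond_entropy_comp_r. Qed.

Lemma cond_entropy_fac_l I I' J (f : X -> I) (f' : X -> I') (g : X -> J) :
  measurable_fibers f -> measurable_fibers g -> determines f f' -> cond_entropy f' g <= cond_entropy f g.
Proof. by move=> mfI mg /facP[u ->]; exact: cond_entropy_comp_l. Qed.

Definition fpair I J (f : X -> I) (g : X -> J) : X -> I * J := fun x => (f x, g x).

Lemma fp_fiber I J (f : X -> I) (g : X -> J) i j :
  fpair f g @^-1` [set (i, j)] = f @^-1` [set i] `&` g @^-1` [set j].
Proof. by apply/seteqP; split => x /=; [case=> -> ->|case=> <- <-]. Qed.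

Lemma mf_fp I J (f : X -> I) (g : X -> J) : measurable_fibers f -> measurable_fibers g -> measurable_fibers (fpair f g).
Proof. by move=> mfI mg [i j]; rewrite fp_fiber; exact: measurableI. Qed.

Lemma cond_entropy_chain I J K (f : X -> I) (g : X -> J) (h : X -> K) :
  measurable_fibers f -> measurable_fibers g -> measurable_fibers h -> cond_entropy (fpair f g) h = cond_entropy g h + cond_entropy f (fpair g h).
Proof.
move=> mfI mg mh; rewrite /cond_entropy -opprD; congr (- _).
rewrite [X in _ = _ + X](_ : _ = \sum_k \sum_j \sum_i
  fmu (f @^-1` [set i] `&` (g @^-1` [set j] `&` h @^-1` [set k])) *
  ln (fmu (f @^-1` [set i] `&` (g @^-1` [set j] `&` h @^-1` [set k])) /
      fmu (g @^-1` [set j] `&` h @^-1` [set k]))); last first.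
  rewrite [RHS]exchange_big [RHS]pair_big/=; apply: eq_bigr => -[j k] _ /=.
  by apply: eq_bigr => i _; rewrite fp_fiber.
rewrite -big_split/=; apply: eq_bigr => k _.
pose F i j := fmu (fpair f g @^-1` [set (i, j)] `&` h @^-1` [set k]) *
  ln (fmu (fpair f g @^-1` [set (i, j)] `&` h @^-1` [set k]) /
      fmu (h @^-1` [set k])).
rewrite (eq_bigr (fun p => F p.1 p.2)); last by case.
rewrite -(pair_big xpredT xpredT F)/= /F.
rewrite exchange_big/= -big_split/=; apply: eq_bigr => j _.
have mgh : measurable (g @^-1` [set j] `&` h @^-1` [set k]) by exact: measurableI.
rewrite {1}(fmu_part mfI mgh) mulr_suml -big_split/=; apply: eq_bigr => i _.
rewrite fp_fiber -setIA.
set a := fmu (_ `&` (_ `&` _)); set b := fmu (_ `&` _); set c := fmu _.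
have a0 : 0 <= a by exact: fmu_ge0.
have ab : a <= b by exact: le_fmuIr.
have bc : b <= c by exact: le_fmuIr.
case: (ltgtP a 0) a0 => // [a1|->] _; last by rewrite !mul0r addr0.
have b0 : 0 < b by apply: lt_le_trans ab.
have c0 : 0 < c by apply: lt_le_trans bc.
rewrite -mulrDr -lnM ?posrE ?divr_gt0//; congr (_ * ln _); field.
by rewrite !gt_eqF.
Qed.

Lemma cond_entropy_fac0 I J (f : X -> I) (g : X -> J) : determines g f -> cond_entropy f g = 0.
Proof.
move=> /facP[u ->]; rewrite /cond_entropy big1 ?oppr0// => j _; apply: big1 => i _.
have [uj|uj] := eqVneq (u j) i.
  have -> : (u \o g) @^-1` [set i] `&` g @^-1` [set j] = g @^-1` [set j].
    by apply/seteqP; split => x /=; [case|move=> gx; rewrite gx].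
  have [->|a0] := eqVneq (fmu (g @^-1` [set j])) 0; first by rewrite mul0r.
  by rewrite divff// ln1 mulr0.
suff -> : (u \o g) @^-1` [set i] `&` g @^-1` [set j] = set0.
  by rewrite /fmu measure0 mul0r.
apply/seteqP; split => // x /= [ug gx]; move/eqP: uj; apply.
by rewrite -ug gx.
Qed.

Lemma fac_fp1 I J (f : X -> I) (g : X -> J) : determines (fpair f g) f.
Proof. by move=> x y []. Qed.

Lemma fac_fp2 I J (f : X -> I) (g : X -> J) : determines (fpair f g) g.
Proof. by move=> x y []. Qed.

Lemma cond_entropy_subadd I J K (f : X -> I) (g : X -> J) (h : X -> K) :
  measurable_fibers f -> measurable_fibers g -> measurable_fibers h -> cond_entropy (fpair f g) h <= cond_entropy f h + cond_entropy g h.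
Proof.
move=> mfI mg mh; rewrite cond_entropy_chain// addrC lerD2r.
by apply: cond_entropy_fac_r; [|exact: mf_fp|exact: fac_fp2].
Qed.

Lemma cond_entropy_triangle I J K (f : X -> I) (g : X -> J) (h : X -> K) :
  measurable_fibers f -> measurable_fibers g -> measurable_fibers h -> cond_entropy f h <= cond_entropy g h + cond_entropy f g.
Proof.
move=> mfI mg mh; apply: (@le_trans _ _ (cond_entropy (fpair f g) h)).
  by apply: cond_entropy_fac_l; [exact: mf_fp| |exact: fac_fp1].
rewrite cond_entropy_chain// lerD2l.
by apply: cond_entropy_fac_r; [|exact: mf_fp|exact: fac_fp1].
Qed.

End conditional_entropy.

(** * Sigma-algebras containing the null sets *)

Section null_complete.
Context (d : measure_display) (X : measurableType d) (R : realType).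
Implicit Types (A B : set X) (G K : set (set X)).

Definition is_sigma0 (mu : set X -> \bar R) G : Prop :=
  [/\ sigma_algebra [set: X] G, G `<=` measurable & null_sets mu `<=` G].

(** With the null sets among the generators, belonging to a sigma-algebra modulo
    null sets becomes plain membership; see [mod_nullP]. *)
Definition sigma0 (mu : set X -> \bar R) G : set (set X) :=
  <<s G `|` null_sets mu >>.

Section closure.
Variables (G : set (set X)) (saG : sigma_algebra [set: X] G).

Lemma sa0 : G set0. Proof. by case: saG. Qed.

Lemma saC A : G A -> G (~` A).
Proof. by case: saG => _ + _ => /[apply]; rewrite setTD. Qed.

Lemma saT : G [set: X]. Proof. by rewrite -setC0; apply/saC/sa0. Qed.

Lemma sa_bigcup (F : (set X)^nat) : (forall n, G (F n)) -> G (\bigcup_n F n).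
Proof. by case: saG => _ _; exact. Qed.

Lemma sa_bigcup_cond (P : set nat) (F : (set X)^nat) :
  (forall n, P n -> G (F n)) -> G (\bigcup_(n in P) F n).
Proof.
move=> PF; rewrite bigcup_mkcond; apply: sa_bigcup => n.
by case: ifPn => [/set_mem/PF//|_]; exact: sa0.
Qed.

Lemma sa_bigcap_cond (P : set nat) (F : (set X)^nat) :
  (forall n, P n -> G (F n)) -> G (\bigcap_(n in P) F n).
Proof.
move=> PF; rewrite -[X in G X]setCK setC_bigcap; apply: saC.
by apply: sa_bigcup_cond => n /PF/saC.
Qed.

Lemma saU A B : G A -> G B -> G (A `|` B).
Proof.
move=> GA GB; rewrite -bigcup2E; apply: sa_bigcup => -[|[|n]]//=.
exact: sa0.
Qed.

Lemma saI A B : G A -> G B -> G (A `&` B).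
Proof.
by move=> GA GB; rewrite -[X in G X]setCK setCI; apply/saC/saU; exact: saC.
Qed.

Lemma saD A B : G A -> G B -> G (A `\` B).
Proof. by move=> GA GB; rewrite setDE; apply: saI => //; exact: saC. Qed.

Lemma sa_imply (P : Prop) A : G A -> G [set x | P /\ A x].
Proof.
move=> GA; have [p|np] := pselect P.
  have -> : [set x | P /\ A x] = A by apply/seteqP; split => x //= -[].
  by [].
have -> : [set x | P /\ A x] = set0 by apply/seteqP; split => x //= -[].
exact: sa0.
Qed.

End closure.

Lemma sa_preimage (f : X -> X) G : sigma_algebra [set: X] G ->
  sigma_algebra [set: X] [set A | G (f @^-1` A)].
Proof.
move=> saG; split => /=; first by rewrite preimage_set0; exact: sa0.
  by move=> A GA; rewrite setTD preimage_setC; exact: saC.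
by move=> F GF; rewrite preimage_bigcup; exact: sa_bigcup.
Qed.

Lemma sa_measurable : sigma_algebra [set: X] (@measurable d X).
Proof.
split; [exact: measurable0|by move=> A mA; exact: measurableD|].
exact: bigcupT_measurable.
Qed.

Section null_generated.
Variable mu : set X -> \bar R.

Lemma cg_sub G K : is_sigma0 mu K -> G `<=` K -> sigma0 mu G `<=` K.
Proof.
move=> [sK _ nK] GK; apply: smallest_sub => // A [/GK//|]; exact: nK.
Qed.

Lemma sub_cg G : G `<=` sigma0 mu G.
Proof. by move=> A GA; apply: sub_gen_smallest; left. Qed.

Lemma csub_cg G : G `<=` measurable -> is_sigma0 mu (sigma0 mu G).
Proof.
move=> Gm; split; first exact: smallest_sigma_algebra.
  by apply: smallest_sub => [|A [/Gm//|[]//]]; exact: sa_measurable.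
by move=> A nA; apply: sub_gen_smallest; right.
Qed.

Lemma cg_mono G K : G `<=` K -> sigma0 mu G `<=` sigma0 mu K.
Proof.
by move=> GK; apply: sub_sigma_algebra2 => A [/GK ?|?]; [left|right].
Qed.

End null_generated.

Section measure.
Variable mu : {measure set X -> \bar R}.

Lemma null_bigcup (F : (set X)^nat) : (forall n, measurable (F n)) ->
  (forall n, mu (F n) = 0%E) -> mu (\bigcup_n F n) = 0%E.
Proof.
move=> mF F0; apply/negligibleP; first exact: bigcupT_measurable.
apply: negligible_bigcup => n; apply/negligibleP; first exact: mF.
exact: F0.
Qed.

Lemma null_setsP N A : measurable A -> measurable N -> A `<=` N -> mu N = 0%E ->
  null_sets mu A.
Proof.
move=> mA mN AN N0; split => //; apply/eqP.
by rewrite eq_le measure_ge0 andbT -N0; apply: le_measure; rewrite ?inE.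
Qed.

Lemma csub_eq G A B : is_sigma0 mu G -> G B -> measurable A -> mu (A `+` B) = 0%E ->
  G A.
Proof.
move=> [sG Gm nG] GB mA AB; have mB := Gm _ GB.
have mAB : measurable (A `+` B) by apply: measurableU; exact: measurableD.
have -> : A = (B `\` (B `\` A)) `|` (A `\` B).
  apply/seteqP; split => x.
    by move=> Ax; have [Bx|nBx] := pselect (B x); [left; split => // -[]|right].
  case=> [[Bx nx]|[]//]; apply: contrapT => nAx; exact: nx.
apply: (saU sG); [apply: (saD sG) => //; apply: nG|apply: nG].
- by apply: (null_setsP _ mAB) => // [|x]; [exact: measurableD|right].
- by apply: (null_setsP _ mAB) => // [|x]; [exact: measurableD|left].
Qed.

(** The working form of the previous lemma: entropy_step identity of sets need only be
    checked at the points of a set of full measure. *)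
Lemma csub_good G A B W : is_sigma0 mu G -> G B -> measurable A -> measurable W ->
  mu (~` W) = 0%E -> (forall x, W x -> A x <-> B x) -> G A.
Proof.
move=> cG GB mA mW W0 AB; apply: (csub_eq cG GB mA).
have mB : measurable B by case: cG => _ + _; exact.
have mAB : measurable (A `+` B) by apply: measurableU; exact: measurableD.
suff [] : null_sets mu (A `+` B) by [].
apply: (null_setsP mAB _ _ W0); first exact: measurableC.
by move=> x [] [h1 h2] /AB h; apply/h2/h.
Qed.

(** The sets that agree with a member of [<<s G>>] up to a null set already form a
    sigma-algebra. *)
Lemma mod_nullP G : G `<=` measurable -> mod_null mu <<s G >> = sigma0 mu G.
Proof.
move=> Gm; have cG := csub_cg mu Gm.
apply/seteqP; split => A.
  move=> [mA [B GB AB]]; apply: (csub_eq cG _ mA AB).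
  by move: B GB {AB}; apply: sub_sigma_algebra2 => B; left.
have mG B : <<s G >> B -> measurable B.
  by move: B; apply: smallest_sub => //; exact: sa_measurable.
have sG := smallest_sigma_algebra [set: X] G.
have mY A' B : measurable A' -> measurable B -> measurable (A' `+` B).
  by move=> *; apply: measurableU; exact: measurableD.
move: A; apply: smallest_sub; last first.
  move=> A [GA|[mA A0]]; split => //; first exact: Gm.
    by exists A; [exact: sub_gen_smallest|rewrite setYK measure0].
  by exists set0; [exact: (sa0 sG)|rewrite setY0].
split => /=.
- by split => //; exists set0; [exact: (sa0 sG)|rewrite setYK measure0].
- move=> A [mA [B GB AB]]; rewrite setTD; split; first exact: measurableC.
  exists (~` B); first exact: (saC sG).
  rewrite (_ : _ `+` _ = A `+` B)//; apply/seteqP; split => x /=.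
    by case=> -[a b]; [right|left]; split => //; exact: contrapT.
  by case=> -[a b]; [right|left]; split => //; tauto.
- move=> F FG; split; first by apply: bigcupT_measurable => n; case: (FG n).
  have /choice[B BP] n : exists B, <<s G >> B /\ mu (F n `+` B) = 0%E.
    by case: (FG n) => _ [B ? ?]; exists B.
  exists (\bigcup_n B n); first by apply: (sa_bigcup sG) => n; case: (BP n).
  have mFB n : measurable (F n `+` B n).
    by apply: mY; [case: (FG n)|apply: mG; case: (BP n)].
  have [] // : null_sets mu (\bigcup_n F n `+` \bigcup_n B n).
  have mU : measurable (\bigcup_n (F n `+` B n)) by exact: bigcupT_measurable.
  apply: (null_setsP _ mU).
  + apply: mY; first by apply: bigcupT_measurable => n; case: (FG n).
    by apply: bigcupT_measurable => n; apply: mG; case: (BP n).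
  + move=> x [] [[n _ h1] h2]; exists n => //.
      by left; split => // h; apply: h2; exists n.
    by right; split => // h; apply: h2; exists n.
  + by apply: null_bigcup => // n; case: (BP n).
Qed.

End measure.
End null_complete.

(** * Approximation in entropy and in measure *)

Section approximation.
Context (d : measure_display) (X : measurableType d) (R : realType).
Variable mu : {measure set X -> \bar R}.
Hypothesis mufin : (mu [set: X] < +oo)%E.
Implicit Types (I J : finType) (A B P Q : set X) (G : set (set X)).

Local Notation fmu := (fmu mu).
Local Notation cond_entropy := (cond_entropy mu).

Definition ind P (x : X) : bool := x \in P.

Lemma ind_true P : ind P @^-1` [set true] = P.
Proof. by apply/seteqP; split => x; rewrite /ind /=; [exact: set_mem|exact: mem_set]. Qed.

Lemma ind_false P : ind P @^-1` [set false] = ~` P.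
Proof.
apply/seteqP; split => x; rewrite /ind /=.
  by move=> /negbT/negP h /mem_set.
by move=> h; apply/negbTE/negP => /set_mem.
Qed.

Lemma mf_ind P : measurable P -> measurable_fibers (ind P).
Proof.
by move=> mP [|]; rewrite ?ind_true ?ind_false//; exact: measurableC.
Qed.

Lemma fmu_split A B : measurable A -> measurable B ->
  fmu A = fmu (A `&` B) + fmu (A `\` B).
Proof.
move=> mA mB; rewrite -fmuU//.
- by rewrite setUIDK.
- exact: measurableI.
- exact: measurableD.
- by apply/disj_set2P/seteqP; split => // x [[_ ?] [_]].
Qed.

Lemma measurableY A B : measurable A -> measurable B -> measurable (A `+` B).
Proof. by move=> *; apply: measurableU; exact: measurableD. Qed.

Lemma fmu_setY A B : measurable A -> measurable B ->
  fmu (A `+` B) = fmu (A `\` B) + fmu (B `\` A).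
Proof.
move=> mA mB; rewrite fmuU//; try exact: measurableD.
by apply/disj_set2P/seteqP; split => // x [[? ?] []].
Qed.

Let M := fmu [set: X].

(** The entropy of a two-set partition of a set of measure [a + b] is small with
    [b]: the first term is at most [b], and [ln q <= 2 * sqrt q] bounds the second
    one, with [q = (a + b) / b]. *)
Lemma binary_entropy_le (a b m : R) : 0 <= a -> 0 <= b -> a + b <= m ->
  - (a * ln (a / (a + b)) + b * ln (b / (a + b))) <= b + 2 * Num.sqrt (m * b).
Proof.
move=> a0 b0 abm; rewrite opprD; apply: lerD.
  case: (ltgtP a 0) a0 => // [a1|->] _; last by rewrite !mul0r oppr0.
  have ab : 0 < a + b by lra.
  rewrite -mulrN -lnV ?posrE ?divr_gt0// invf_div.
  apply: (@le_trans _ _ (a * ((a + b) / a - 1))).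
    by rewrite ler_pM2l// ln_le_subr1// divr_gt0.
  by rewrite mulrBr mulrC divfK ?gt_eqF// mulr1; lra.
case: (ltgtP b 0) b0 => // [b1|->] _; last first.
  by rewrite !mul0r oppr0 mulr_ge0// sqrtr_ge0.
have ab : 0 < a + b by lra.
rewrite -mulrN -lnV ?posrE ?divr_gt0// invf_div.
set q := (a + b) / b; have q0 : 0 < q by rewrite divr_gt0.
have s0 : 0 < Num.sqrt q by rewrite sqrtr_gt0.
have -> : ln q = 2 * ln (Num.sqrt q).
  by rewrite -[q in LHS](sqr_sqrtr (ltW q0)) expr2 lnM ?posrE// mulr2n mulrDl mul1r.
rewrite mulrCA ler_pM2l//.
apply: (@le_trans _ _ (b * Num.sqrt q)).
  by rewrite ler_pM2l//; apply: le_trans (ln_le_subr1 s0) _; lra.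
rewrite -[X in X * _](ger0_norm (ltW b1)) -sqrtr_sqr -sqrtrM ?sqr_ge0//.
rewrite ler_wsqrtr// expr2 -mulrA /q (mulrC b (_ / b)) divfK ?gt_eqF//.
by rewrite mulrC ler_wpM2r// ltW.
Qed.

Lemma cond_entropy_ind_le P Q : measurable P -> measurable Q ->
  cond_entropy (ind P) (ind Q) <=
  fmu (P `+` Q) + 4 * Num.sqrt (M * fmu (P `+` Q)).
Proof.
move=> mP mQ; rewrite /(cond_entropy _ _) !big_bool/= !ind_true !ind_false.
set a := fmu (P `&` Q); set b := fmu (~` P `&` Q); set c := fmu (P `&` ~` Q).
set e := fmu (~` P `&` ~` Q).
have mnP := measurableC mP; have mnQ := measurableC mQ.
have Qab : fmu Q = a + b.
  by rewrite (fmu_split mQ mP) /a /b setIC setDE [X in _ + fmu X]setIC.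
have Qec : fmu (~` Q) = e + c.
  by rewrite (fmu_split mnQ mnP) /e /c setIC setDE setCK [X in _ + fmu X]setIC.
have -> : fmu (P `+` Q) = c + b.
  by rewrite fmu_setY// /c /b !setDE [X in _ + fmu X]setIC.
have M1 : (a + b) + (e + c) = M.
  by rewrite -Qab -Qec /M -fmuU ?setUv//; apply/disj_set2P; exact: setICr.
rewrite Qab Qec.
have c0 : 0 <= c by exact: fmu_ge0.
have b0 : 0 <= b by exact: fmu_ge0.
have a0 : 0 <= a by exact: fmu_ge0.
have e0 : 0 <= e by exact: fmu_ge0.
have M0 : 0 <= M by exact: fmu_ge0.
have abM : a + b <= M by rewrite -M1; lra.
have ecM : e + c <= M by rewrite -M1; lra.
have h1 := binary_entropy_le a0 b0 abM.
have h2 := binary_entropy_le e0 c0 ecM.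
have h3 : Num.sqrt (M * b) <= Num.sqrt (M * (c + b)).
  by rewrite ler_wsqrtr// ler_wpM2l//; lra.
have h4 : Num.sqrt (M * c) <= Num.sqrt (M * (c + b)).
  by rewrite ler_wsqrtr// ler_wpM2l//; lra.
lra.
Qed.

Lemma cond_entropy_ind_close (e : R) : 0 < e -> exists2 r : R, 0 < r &
  forall P Q, measurable P -> measurable Q -> fmu (P `+` Q) < r ->
  cond_entropy (ind P) (ind Q) < e.
Proof.
move=> e0; have M0 : 0 <= M by exact: fmu_ge0.
pose t := (e / 8) ^+ 2 / (M + 1).
have t0 : 0 < t by rewrite divr_gt0 ?exprn_gt0 ?divr_gt0//; lra.
exists (Num.min (e / 2) t); first by rewrite lt_min t0 andbT; lra.
move=> P Q mP mQ; rewrite lt_min => /andP[h1 h2].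
apply: le_lt_trans (cond_entropy_ind_le mP mQ) _.
have h3 : Num.sqrt (M * fmu (P `+` Q)) <= e / 8.
  rewrite -[leRHS]ger0_norm; last lra.
  rewrite -sqrtr_sqr ler_wsqrtr//.
  apply: (@le_trans _ _ ((M + 1) * t)); last by rewrite mulrC divfK// gt_eqF//; lra.
  by rewrite ler_pM ?fmu_ge0//; lra.
lra.
Qed.

(** The smaller of two cells of a set of measure [b] has at most half of its
    measure, hence an information of at least [1/2], since [ln t <= t - 1]. *)
Lemma majority_le (a b : R) : 0 <= a -> a <= b ->
  (if b <= 2 * a then b - a else a) <=
  - (2 * (a * ln (a / b) + (b - a) * ln ((b - a) / b))).
Proof.
move=> a0 ab.
have H x : 0 <= x -> 2 * x <= b -> x <= - (2 * (x * ln (x / b))).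
  move=> x0 xb; case: (ltgtP x 0) x0 => // [x1|->] _; last by rewrite mul0r mulr0 oppr0.
  have b1 : 0 < b by lra.
  have := ln_le_subr1 (divr_gt0 x1 b1).
  have : x / b <= 1 / 2 by rewrite ler_pdivrMr//; lra.
  nra.
have h1 := xlnx_le a0 ab.
have h2 : (b - a) * ln ((b - a) / b) <= 0 by apply: xlnx_le; lra.
case: ifPn => [h|]; first by have := H (b - a); lra.
by rewrite -ltNge => h; have := H a; lra.
Qed.

(** A set of small entropy given [g] is close to a union of fibres of [g]: on
    each fibre, [P] is replaced by its majority value. *)
Lemma majority J (g : X -> J) P : measurable_fibers g -> measurable P ->
  exists r : pred J, fmu (P `+` (g @^-1` [set j | r j])) <= 2 * cond_entropy (ind P) g.
Proof.
move=> mg mP.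
exists (fun j => fmu (g @^-1` [set j]) <= 2 * fmu (P `&` g @^-1` [set j])).
set r := fun j => _.
have mR : measurable (g @^-1` [set j | r j]).
  have -> : g @^-1` [set j | r j] = \bigcup_(j in [set j | r j]) g @^-1` [set j].
    by apply/seteqP; split => x /=; [exists (g x)|case=> j /= + ->].
  by apply: fin_bigcup_measurable => //; exact: finite_finset.
rewrite (fmu_part mufin mg (measurableY mP mR)) /(cond_entropy _ _) mulrN mulr_sumr -sumrN.
apply: ler_sum => j _; rewrite big_bool/= ind_true ind_false.
have mj := mg j.
have e1 : fmu (~` P `&` g @^-1` [set j]) =
          fmu (g @^-1` [set j]) - fmu (P `&` g @^-1` [set j]).
  by have := fmu_split mj mP; rewrite setIC setDE [X in _ + fmu X]setIC; lra.
rewrite e1; have := @majority_le (fmu (P `&` g @^-1` [set j])) (fmu (g @^-1` [set j])).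
move=> /(_ (fmu_ge0 _ _) (le_fmuIr mufin mP mj)); apply: le_trans.
case: ifPn => h.
  rewrite -e1; apply: le_fmu => //; [|by apply: measurableI => //; exact: measurableC|].
    by apply: measurableI => //; exact: measurableY.
  by move=> x /= [gx [[Px []]|[]//]]; rewrite /r /= gx.
apply: le_fmu => //; [|exact: measurableI|].
  by apply: measurableI => //; exact: measurableY.
move=> x /= [gx [[Px _]|[]]]; first by [].
by rewrite /r /= gx => hh; rewrite hh in h.
Qed.

Lemma fmu_small (F : (set X)^nat) (e : R) : (forall n, measurable (F n)) ->
  (forall n, F n.+1 `<=` F n) -> \bigcap_n F n = set0 -> 0 < e ->
  exists n, fmu (F n) < e.
Proof.
move=> mF dF F0 e0.
have : (mu \o F) x @[x --> \oo] --> mu (\bigcap_n F n).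
  apply: nonincreasing_cvg_mu => //.
  - by rewrite (fmuE mufin)// ltry.
  - by rewrite F0.
  - by apply/nonincreasing_seqP => n; apply/subsetPset/dF.
rewrite F0 measure0 => cv.
have /fine_cvgP[_] : (mu \o F) x @[x --> \oo] --> 0%:E by exact: cv.
move=> /cvgrPdist_lt/(_ _ e0)[N _ /(_ N (leqnn _))] /=.
rewrite sub0r normrN => h; exists N; exact: le_lt_trans (ler_norm _) h.
Qed.

Lemma fmu_bigcup_small (F : (set X)^nat) (e : R) : (forall n, measurable (F n)) ->
  0 < e -> exists n, fmu (\bigcup_n F n `+` \big[setU/set0]_(i < n) F i) < e.
Proof.
move=> mF e0.
have mU n : measurable (\big[setU/set0]_(i < n) F i).
  exact: bigsetU_measurable.
have sub n : \big[setU/set0]_(i < n) F i `<=` \bigcup_n F n.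
  by rewrite -bigcup_mkord => x [i _ Fi]; exists i.
have [n hn] : exists n, fmu (\bigcup_n F n `\` \big[setU/set0]_(i < n) F i) < e.
  apply: fmu_small => //.
  - by move=> n; apply: measurableD => //; exact: bigcupT_measurable.
  - by move=> n x [Ux nx]; split => // h; apply: nx; rewrite big_ord_recr/=; left.
  - apply/seteqP; split => // x h; have [[i _ Fi] _] := h 0%N I.
    by have [_] := h i.+1 I; apply; rewrite big_ord_recr/=; right.
exists n; rewrite (_ : _ `+` _ = \bigcup_n F n `\` \big[setU/set0]_(i < n) F i)//.
by rewrite setY_def (_ : _ `\` \bigcup_n F n = set0) ?setU0//; rewrite setD_eq0; exact: sub.
Qed.

(** By the Borel-Cantelli lemma, [P] agrees almost everywhere with the limit
    superior of approximations with summable errors. *)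
Lemma csub_closed G P : is_sigma0 mu G -> measurable P ->
  (forall e : R, 0 < e -> exists2 Q, G Q & fmu (P `+` Q) < e) -> G P.
Proof.
move=> cG mP H; have [sG Gm _] := cG.
have /choice[Q HQ] n : exists Q, G Q /\ fmu (P `+` Q) < 1 / (2 ^ n.+1)%:R.
  by have [|Q ? ?] := H (1 / (2 ^ n.+1)%:R); rewrite ?divr_gt0 ?ltr0n ?expn_gt0//; exists Q.
have GQ n : G (Q n) by case: (HQ n).
have mQ n : measurable (Q n) by exact: Gm.
have mY n : measurable (P `+` Q n) by exact: measurableY.
have GL : G (lim_sup_set Q).
  by apply: (sa_bigcap_cond sG) => n _; exact: (sa_bigcup_cond sG).
apply: (csub_eq cG GL) => //.
have L0 : mu (lim_sup_set (fun n => P `+` Q n)) = 0%E.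
  apply: lim_sup_set_cvg0 => //.
  apply: le_lt_trans (ltry 1%R).
  apply: le_trans (@epsilon_trick0 _ 1 xpredT ler01).
  apply: lee_nneseries => [n _ _|n _]; first exact: measure_ge0.
  by rewrite (fmuE mufin)// lee_fin; case: (HQ n) => _ /ltW.
have [] // : null_sets mu (P `+` lim_sup_set Q).
apply: (null_setsP _ _ _ L0).
- by apply: measurableY => //; exact: Gm.
- by apply: bigcapT_measurable => n; apply: bigcup_measurable => k _; exact: mY.
move=> x [[Px nL]|[Lx nP]] n _.
  have [k nk h] : exists2 k, (n <= k)%N & ~ Q k x.
    apply: contrapT => hh; apply: nL => k _; exists (maxn n k); first exact: leq_maxr.
    by apply: contrapT => hq; apply: hh; exists (maxn n k) => //; exact: leq_maxl.
  by exists k => //; left.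
by have [k nk h] := Lx n I; exists k => //; right.
Qed.

(** A countable union is a limit of finite ones, so for a collection that is closed
    in measure finite unions suffice. *)
Lemma csub_lim G : G `<=` measurable -> null_sets mu `<=` G ->
  (forall A, G A -> G (~` A)) -> (forall A B, G A -> G B -> G (A `|` B)) ->
  (forall P, measurable P ->
     (forall e : R, 0 < e -> exists2 Q, G Q & fmu (P `+` Q) < e) -> G P) ->
  is_sigma0 mu G.
Proof.
move=> Gm nG GC GU GL.
have G0 : G set0 by apply: nG; split.
split => //; split => //.
  by move=> A /GC; rewrite setTD.
move=> F GF; apply: GL; first by apply: bigcupT_measurable => n; exact: Gm.
move=> e e0; have [n hn] := fmu_bigcup_small (fun n => Gm _ (GF n)) e0.
exists (\big[setU/set0]_(i < n) F i) => //.
by elim/big_ind : _ => // A B; exact: GU.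
Qed.

(** * Finite lists of sets as finite partitions *)

(** A finite list of sets is handled as the partition that it generates. *)
Definition inds (s : seq (set X)) (x : X) : {ffun 'I_(size s) -> bool} :=
  [ffun i : 'I_(size s) => ind (nth set0 s i) x].

Definition alls G (s : seq (set X)) :=
  forall i, (i < size s)%N -> G (nth set0 s i).

Lemma alls_cons G P s : alls G (P :: s) <-> G P /\ alls G s.
Proof.
split => [h|[GP h] [|i]//]; last exact: h.
by split => [|i si]; [exact: (h 0%N)|exact: (h i.+1)].
Qed.

Lemma alls_cat G s t : alls G s -> alls G t -> alls G (s ++ t).
Proof.
move=> hs ht i; rewrite size_cat nth_cat; case: (ltnP i (size s)) => [si _|si it]; first exact: hs.
by apply: ht; rewrite ltn_subLR.
Qed.

Lemma fac_indsP I (f : X -> I) s :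
  determines f (inds s) <-> forall i, (i < size s)%N -> determines f (ind (nth set0 s i)).
Proof.
split => [h i si x y /h /ffunP/(_ (Ordinal si))|h x y fxy]; first by rewrite !ffunE.
by apply/ffunP => i; rewrite !ffunE; exact: (h i).
Qed.

Lemma fac_refl I (f : X -> I) : determines f f. Proof. by []. Qed.

Lemma fac_inds_nth s i : (i < size s)%N -> determines (inds s) (ind (nth set0 s i)).
Proof. by move=> si; move: i si; apply/fac_indsP/fac_refl. Qed.

Lemma fac_inds_catl s t : determines (inds (s ++ t)) (inds s).
Proof.
apply/fac_indsP => i si.
have := @fac_inds_nth (s ++ t) i; rewrite nth_cat si; apply.
by rewrite size_cat; exact: ltn_addr.
Qed.

Lemma fac_inds_catr s t : determines (inds (s ++ t)) (inds t).
Proof.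
apply/fac_indsP => i si.
have := @fac_inds_nth (s ++ t) (size s + i)%N; rewrite nth_cat.
have -> : (size s + i < size s)%N = false by rewrite ltnNge leq_addr.
by rewrite addKn; apply; rewrite size_cat ltn_add2l.
Qed.

Lemma fac_inds_cons P s : determines (fpair (ind P) (inds s)) (inds (P :: s)).
Proof.
apply/fac_indsP => -[_|i si]; first exact: fac_fp1.
by move=> x y [_ xy]; exact: (@fac_inds_nth s i si x y xy).
Qed.

Lemma mf_fac I J (g : X -> J) (f : X -> I) : measurable_fibers g -> determines g f -> measurable_fibers f.
Proof.
move=> mg /facP[u ->] i.
have -> : (u \o g) @^-1` [set i] = \bigcup_(j in [set j | u j = i]) g @^-1` [set j].
  by apply/seteqP; split => x /=; [exists (g x)|case=> j /= <- <-].
by apply: fin_bigcup_measurable => //; exact: finite_finset.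
Qed.

Lemma mf_inds s : alls measurable s -> measurable_fibers (inds s).
Proof.
elim: s => [_|P s IH /alls_cons[mP /IH ms]].
  move=> w; have -> : inds [::] @^-1` [set w] = [set: X]; last exact: measurableT.
  by apply/seteqP; split => // x _; apply/ffunP => -[].
apply: mf_fac (@fac_inds_cons P s); apply: mf_fp => //; exact: mf_ind.
Qed.

Lemma alls_sub G G' s : G `<=` G' -> alls G s -> alls G' s.
Proof. by move=> GG h i si; apply/GG/h. Qed.

Lemma cond_entropy_ind_catl P s t : measurable P -> alls measurable s -> alls measurable t ->
  cond_entropy (ind P) (inds (s ++ t)) <= cond_entropy (ind P) (inds s).
Proof.
move=> mP ms mt; apply: cond_entropy_fac_r => //; first exact: mf_ind.
  by apply: mf_inds; exact: alls_cat.
exact: fac_inds_catl.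
Qed.

Lemma cond_entropy_ind_catr P s t : measurable P -> alls measurable s -> alls measurable t ->
  cond_entropy (ind P) (inds (s ++ t)) <= cond_entropy (ind P) (inds t).
Proof.
move=> mP ms mt; apply: cond_entropy_fac_r => //; first exact: mf_ind.
  by apply: mf_inds; exact: alls_cat.
exact: fac_inds_catr.
Qed.

Lemma fac_indC P : determines (ind P) (ind (~` P)).
Proof. by move=> x y; rewrite /ind !in_setC => ->. Qed.

Lemma fac_indU P Q : determines (fpair (ind P) (ind Q)) (ind (P `|` Q)).
Proof. by move=> x y; rewrite /fpair /ind !in_setU => -[-> ->]. Qed.

(** A set of the sigma-algebra generated by [G] is determined, up to a small
    conditional entropy, by finitely many members of [G]. *)
Lemma cg_entropy G P : G `<=` measurable -> sigma0 mu G P ->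
  forall e : R, 0 < e -> exists2 s, alls G s & cond_entropy (ind P) (inds s) < e.
Proof.
move=> Gm.
pose K := [set P | measurable P /\ forall e : R, 0 < e ->
  exists2 s, alls G s & cond_entropy (ind P) (inds s) < e].
suff cK : is_sigma0 mu K.
  move=> /(cg_sub cK) h; suff [] : K P by []. apply: h => A GA.
  split; first exact: Gm.
  move=> e e0; exists [:: A]; first by apply/alls_cons; split.
  by rewrite (cond_entropy_fac0 mu (@fac_inds_nth [:: A] 0%N isT)).
have msG s : alls G s -> alls measurable s by exact: alls_sub.
apply: csub_lim => [A []//|A [mA A0]|A [mA KA]|A B [mA KA] [mB KB]|A mA KA].
- split => // e e0; have [r r0 hr] := cond_entropy_ind_close e0.
  exists [::] => //; have m0 : measurable_fibers (inds [::]) by exact: mf_inds.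
  have f0 : determines (inds [::]) (ind (set0 : set X)).
    by move=> x y _; rewrite /ind !in_set0.
  apply: le_lt_trans (cond_entropy_fac_r mufin (mf_ind mA) m0 f0) (hr _ _ mA _ _) => //.
  by rewrite setY0 /(fmu _) A0.
- split; first exact: measurableC.
  move=> e /KA[s Gs h]; exists s => //; apply: le_lt_trans h.
  by apply: cond_entropy_fac_l => //; [exact: mf_ind|exact/mf_inds/msG|exact: fac_indC].
- split; first exact: measurableU.
  move=> e e0; have e2 : 0 < e / 2 by lra.
  have [s Gs hs] := KA _ e2; have [t Gt ht] := KB _ e2.
  exists (s ++ t); first exact: alls_cat.
  have := cond_entropy_ind_catl mA (msG _ Gs) (msG _ Gt).
  have := cond_entropy_ind_catr mB (msG _ Gs) (msG _ Gt).
  have mst : measurable_fibers (inds (s ++ t)) := mf_inds (alls_cat (msG _ Gs) (msG _ Gt)).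
  have := cond_entropy_fac_l mufin (mf_fp (mf_ind mA) (mf_ind mB)) mst (@fac_indU A B).
  have := cond_entropy_subadd mufin (mf_ind mA) (mf_ind mB) mst.
  lra.
- split => // e e0; have e2 : 0 < e / 2 by lra.
  have [r r0 hr] := cond_entropy_ind_close e2.
  have [Q [mQ KQ] hQ] := KA _ r0; have [s Gs hs] := KQ _ e2; exists s => //.
  have := cond_entropy_triangle mufin (mf_ind mA) (mf_ind mQ) (mf_inds (msG _ Gs)).
  by have := hr _ _ mA mQ hQ; lra.
Qed.

Lemma cg_entropy_list G t : G `<=` measurable -> alls (sigma0 mu G) t ->
  forall e : R, 0 < e -> exists2 s, alls G s & cond_entropy (inds t) (inds s) < e.
Proof.
move=> Gm; have [_ mcg _] := csub_cg mu Gm; elim: t => [_ e e0|P t IH].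
  by exists [::] => //; rewrite cond_entropy_fac0.
move=> /alls_cons[GP Gt] e e0; have e2 : 0 < e / 2 by lra.
have [s Gs hs] := cg_entropy Gm GP e2; have [s' Gs' hs'] := IH Gt _ e2.
have ms := alls_sub Gm Gs; have ms' := alls_sub Gm Gs'.
have mt : measurable_fibers (inds t) by apply/mf_inds/(alls_sub mcg).
have mP : measurable_fibers (ind P) by apply/mf_ind/mcg.
exists (s ++ s'); first exact: alls_cat.
have mss : measurable_fibers (inds (s ++ s')) := mf_inds (alls_cat ms ms').
have := cond_entropy_ind_catl (mcg _ GP) ms ms'.
have := cond_entropy_fac_r mufin mt mss (@fac_inds_catr s s').
have := cond_entropy_fac_l mufin (mf_fp mP mt) mss (@fac_inds_cons P t).
have := cond_entropy_subadd mufin mP mt mss.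
lra.
Qed.

End approximation.

(** * Entropy rates and the Pinsker sigma-algebra *)

Section pinsker.
Context (d : measure_display) (X : measurableType d) (R : realType).
Implicit Types (S : X -> X) (G : set (set X)).

(** The Pinsker sigma-algebra, defined by predictability; [PiP] identifies it with
    the sets that generate a process of zero entropy. *)
Definition Pi (mu : set X -> \bar R) S : set (set X) :=
  [set P | measurable P /\ sigma0 mu [set iter k S @^-1` P | k in [set k | (0 < k)%N]] P].

Variable mu : {measure set X -> \bar R}.
Hypothesis mufin : (mu [set: X] < +oo)%E.
Variable S : X -> X.
Hypothesis Smp : measure_preserving mu S.
Implicit Types (I J : finType) (A B P Q : set X).

Local Notation fmu := (fmu mu).
Local Notation cond_entropy := (cond_entropy mu).
Local Notation M := (fmu [set: X]).

Lemma mp_measurable A : measurable A -> measurable (S @^-1` A).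
Proof. by case: Smp => mS _ mA; rewrite -(setTI (_ @^-1` _)); exact: mS. Qed.

Lemma iter_preimage (f : X -> X) k A :
  iter k.+1 f @^-1` A = f @^-1` (iter k f @^-1` A).
Proof. by apply/funext => x; rewrite /preimage /= -iterS iterSr. Qed.

Lemma mp_iter_measurable k A : measurable A -> measurable (iter k S @^-1` A).
Proof.
by elim: k A => [//|k IH] A mA; rewrite iter_preimage; exact/mp_measurable/IH.
Qed.

Lemma mp_iter_mu k A : measurable A -> mu (iter k S @^-1` A) = mu A.
Proof.
case: Smp => _ pS mA; elim: k => [//|k IH].
by rewrite iter_preimage pS//; exact: mp_iter_measurable.
Qed.

Lemma mf_S I (f : X -> I) : measurable_fibers f -> measurable_fibers (f \o S).
Proof. by move=> mfI i; exact: (mp_measurable (mfI i)). Qed.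

Lemma cond_entropy_S I J (f : X -> I) (g : X -> J) : measurable_fibers f -> measurable_fibers g ->
  cond_entropy (f \o S) (g \o S) = cond_entropy f g.
Proof.
case: Smp => _ pS mfI mg; congr (- _); apply: eq_bigr => j _.
have h : fmu ((g \o S) @^-1` [set j]) = fmu (g @^-1` [set j]).
  by congr fine; exact: pS.
apply: eq_bigr => i _; rewrite h.
suff -> : fmu ((f \o S) @^-1` [set i] `&` (g \o S) @^-1` [set j]) =
  fmu (f @^-1` [set i] `&` g @^-1` [set j]) by [].
by congr fine; apply: (pS (f @^-1` [set i] `&` g @^-1` [set j])); exact: measurableI.
Qed.

Definition itinerary I (f : X -> I) n (x : X) : {ffun 'I_n -> I} :=
  [ffun k : 'I_n => f (iter k S x)].

Lemma fac_nmP I J (f : X -> I) n (g : X -> J) :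
  determines g (itinerary f n) <-> forall k, (k < n)%N -> determines g (f \o iter k S).
Proof.
split=> [h k kn x y /h /ffunP/(_ (Ordinal kn))|h x y gxy]; first by rewrite !ffunE.
by apply/ffunP => k; rewrite !ffunE; exact: (h k).
Qed.

Lemma fac_nm_nth I (f : X -> I) n k : (k < n)%N -> determines (itinerary f n) (f \o iter k S).
Proof. by move: k; apply/fac_nmP. Qed.

Lemma fac_comp I J (f : X -> I) (g : X -> J) (h : X -> X) :
  determines f g -> determines (f \o h) (g \o h).
Proof. by move=> fg x y /fg. Qed.

Lemma fac_fp I J (K : finType) (f : X -> I) (g : X -> J) (h : X -> K) :
  determines h f -> determines h g -> determines h (fpair f g).
Proof. by move=> hf hg x y hxy; rewrite /fpair (hf _ _ hxy) (hg _ _ hxy). Qed.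

Lemma fac_nmS1 I (f : X -> I) n : determines (fpair f (itinerary f n \o S)) (itinerary f n.+1).
Proof.
apply/fac_nmP => -[_|k kn]; first exact: fac_fp1.
move=> x y [_ /(@fac_nm_nth _ f n k kn)] /=; by rewrite -!iterSr.
Qed.

Lemma fac_nmS2 I (f : X -> I) n : determines (itinerary f n.+1) (fpair f (itinerary f n \o S)).
Proof.
apply: fac_fp; first exact: (@fac_nm_nth _ f n.+1 0%N).
move=> x y h; apply/ffunP => k; rewrite !ffunE -!iterSr.
by apply: (@fac_nm_nth _ f n.+1 k.+1 _ x y h); rewrite ltnS.
Qed.

Lemma fac_nm I J (f : X -> I) (g : X -> J) n : determines f g -> determines (itinerary f n) (itinerary g n).
Proof. by move=> fg; apply/fac_nmP => k kn x y /(fac_nm_nth kn) /fg. Qed.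

Lemma fac_nm_le I (f : X -> I) n m : (n <= m)%N -> determines (itinerary f m) (itinerary f n).
Proof. by move=> le_nm; apply/fac_nmP => k kn; apply/fac_nm_nth/(leq_trans kn). Qed.

Lemma mf_nm I (f : X -> I) n : measurable_fibers f -> measurable_fibers (itinerary f n).
Proof.
move=> mfI; elim: n => [|n IH].
  move=> w; have -> : itinerary f 0 @^-1` [set w] = [set: X]; last exact: measurableT.
  by apply/seteqP; split => // x _; apply/ffunP => -[].
apply: (mf_fac _ (@fac_nmS1 _ f n)); apply: mf_fp => //; exact: mf_S.
Qed.

Definition entropy I (f : X -> I) := cond_entropy f (fun=> tt).

Lemma mf_tt : measurable_fibers (fun _ : X => tt).
Proof.
move=> []; rewrite (_ : _ @^-1` _ = [set: X]); first exact: measurableT.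
by apply/seteqP; split.
Qed.

Lemma entropy_ge0 I (f : X -> I) : measurable_fibers f -> 0 <= entropy f.
Proof. by move=> mfI; apply: cond_entropy_ge0 => //; exact: mf_tt. Qed.

Lemma cond_entropy_eqr I J J' (f : X -> I) (g : X -> J) (g' : X -> J') :
  measurable_fibers f -> measurable_fibers g -> measurable_fibers g' -> determines g g' -> determines g' g -> cond_entropy f g = cond_entropy f g'.
Proof.
move=> mfI mg mg' h h'; apply/eqP; rewrite eq_le.
by rewrite (cond_entropy_fac_r mufin mfI mg h) (cond_entropy_fac_r mufin mfI mg' h').
Qed.

Lemma cond_entropy_eql I I' J (f : X -> I) (f' : X -> I') (g : X -> J) :
  measurable_fibers f -> measurable_fibers f' -> measurable_fibers g -> determines f f' -> determines f' f -> cond_entropy f g = cond_entropy f' g.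
Proof.
move=> mfI mf' mg h h'; apply/eqP; rewrite eq_le.
by rewrite (cond_entropy_fac_l mufin mf' mg h') (cond_entropy_fac_l mufin mfI mg h).
Qed.

Lemma entropy_chain I J (f : X -> I) (g : X -> J) : measurable_fibers f -> measurable_fibers g ->
  entropy (fpair f g) = entropy g + cond_entropy f g.
Proof.
move=> mfI mg; rewrite /entropy cond_entropy_chain//; last exact: mf_tt.
congr (_ + _); apply: (cond_entropy_eqr mfI (mf_fp mg mf_tt) mg); first exact: fac_fp1.
by apply: fac_fp.
Qed.

Lemma entropy_le_fac I J (f : X -> I) (g : X -> J) : measurable_fibers f -> determines f g -> entropy g <= entropy f.
Proof. by move=> mfI; apply: cond_entropy_fac_l => //; exact: mf_tt. Qed.

Lemma cond_entropy_le_entropy I J (f : X -> I) (g : X -> J) : measurable_fibers f -> measurable_fibers g -> cond_entropy f g <= entropy f.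
Proof. by move=> mfI mg; apply: cond_entropy_fac_r => // x y. Qed.

(** H(f | f o S, ..., f o S^n), which decreases to the entropy rate of [f] as [n]
    grows. *)
Definition entropy_step I (f : X -> I) n := cond_entropy f (itinerary f n \o S).

Lemma an_ge0 I (f : X -> I) n : measurable_fibers f -> 0 <= entropy_step f n.
Proof. by move=> mfI; apply: cond_entropy_ge0 => //; exact/mf_S/mf_nm. Qed.

Lemma an_anti I (f : X -> I) n m : measurable_fibers f -> (n <= m)%N -> entropy_step f m <= entropy_step f n.
Proof.
move=> mfI le_nm; apply: cond_entropy_fac_r => //; first exact/mf_S/mf_nm.
exact/fac_comp/fac_nm_le.
Qed.

Lemma entropy_nmS I (f : X -> I) n : measurable_fibers f -> entropy (itinerary f n.+1) = entropy (itinerary f n) + entropy_step f n.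
Proof.
move=> mfI; have mN := mf_nm (n := n) mfI; have mNS := mf_S mN.
rewrite /entropy (cond_entropy_eql (mf_nm (n := n.+1) mfI) (mf_fp mfI mNS) mf_tt (@fac_nmS2 _ _ _) (@fac_nmS1 _ _ _)).
rewrite -/(entropy _) entropy_chain//; congr (_ + _).
by rewrite /entropy -[RHS]cond_entropy_S//; exact: mf_tt.
Qed.

Lemma entropy_nm0 I (f : X -> I) : entropy (itinerary f 0) = 0.
Proof. by apply: cond_entropy_fac0 => x y _; apply/ffunP => -[]. Qed.

Definition zero_rate I (f : X -> I) := forall e : R, 0 < e -> exists n, entropy_step f n < e.

(** From the step [k] on every new symbol costs at most [entropy_step f k]. *)
Lemma entropy_nm_le I (f : X -> I) k n : measurable_fibers f ->
  entropy (itinerary f n) <= k%:R * entropy f + n%:R * entropy_step f k.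
Proof.
move=> mfI; elim: n => [|n IH].
  by rewrite entropy_nm0 mul0r addr0 mulr_ge0// entropy_ge0.
rewrite entropy_nmS//; have [kn|nk] := leqP k n.
  by have := an_anti mfI kn; rewrite -natr1; lra.
have h j : entropy (itinerary f j) <= j%:R * entropy f.
  elim: j => [|j IHj]; first by rewrite entropy_nm0 mul0r.
  rewrite entropy_nmS// -natr1 mulrDl mul1r; apply: lerD => //.
  by apply: cond_entropy_le_entropy => //; exact/mf_S/mf_nm.
have := h n; have := cond_entropy_le_entropy mfI (mf_S (mf_nm (n := n) mfI)); rewrite -/(entropy_step f n).
have : n.+1%:R * entropy f <= k%:R * entropy f by rewrite ler_wpM2r ?entropy_ge0// ler_nat.
have : 0 <= n.+1%:R * entropy_step f k by rewrite mulr_ge0// an_ge0.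
by rewrite -natr1; lra.
Qed.

Lemma zent_entropy I (f : X -> I) : measurable_fibers f -> zero_rate f ->
  forall e : R, 0 < e -> exists N, forall n, (N <= n)%N -> entropy (itinerary f n) <= e * n%:R.
Proof.
move=> mfI zf e e0; have e2 : 0 < e / 2 by lra.
have [k hk] := zf _ e2.
exists (Num.truncn (k%:R * entropy f / (e / 2))).+1 => n nN.
apply: (le_trans (entropy_nm_le k n mfI)).
have : k%:R * entropy f <= e / 2 * n%:R.
  rewrite [leRHS]mulrC -ler_pdivrMr//; apply: le_trans (ltW (truncnS_gt _)) _.
  by rewrite ler_nat.
have : n%:R * entropy_step f k <= n%:R * (e / 2) by rewrite ler_wpM2l// ltW.
lra.
Qed.

Lemma entropy_nm_ge I (f : X -> I) n : measurable_fibers f -> n%:R * entropy_step f n <= entropy (itinerary f n).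
Proof.
move=> mfI; suff h k : (k <= n)%N -> k%:R * entropy_step f n <= entropy (itinerary f k) by exact: h.
elim: k => [_|k IH kn]; first by rewrite entropy_nm0 mul0r.
rewrite entropy_nmS// -natr1 mulrDl mul1r; apply: lerD; first exact/IH/ltnW.
by apply: an_anti => //; exact: ltnW.
Qed.

Lemma entropy_zent I (f : X -> I) : measurable_fibers f ->
  (forall e : R, 0 < e -> exists n, (0 < n)%N /\ entropy (itinerary f n) <= e * n%:R) -> zero_rate f.
Proof.
move=> mfI h e e0; have e2 : 0 < e / 2 by lra.
have [n [n0 hn]] := h _ e2; exists n.
have n1 : 0 < n%:R :> R by rewrite ltr0n.
have := entropy_nm_ge n mfI; rewrite -(ltr_pM2l n1); nra.
Qed.

Lemma zent_fac I J (f : X -> I) (g : X -> J) : measurable_fibers f -> determines f g -> zero_rate f -> zero_rate g.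
Proof.
move=> mfI fg zf; apply: entropy_zent; first exact: mf_fac fg.
move=> e e0; have [N hN] := zent_entropy mfI zf e0; exists N.+1; split => //.
apply: le_trans (hN _ (leqnSn _)).
by apply: entropy_le_fac; [exact: mf_nm|exact: fac_nm].
Qed.

Lemma fac_nm_fp I J (f : X -> I) (g : X -> J) n :
  determines (fpair (itinerary f n) (itinerary g n)) (itinerary (fpair f g) n).
Proof.
apply/fac_nmP => k kn; apply: fac_fp.
  by move=> x y [/(fac_nm_nth kn)].
by move=> x y [_ /(fac_nm_nth kn)].
Qed.

Lemma zent_fp I J (f : X -> I) (g : X -> J) : measurable_fibers f -> measurable_fibers g ->
  zero_rate f -> zero_rate g -> zero_rate (fpair f g).
Proof.
move=> mfI mg zf zg; have mfg := mf_fp mfI mg; apply: entropy_zent => // e e0.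
have e2 : 0 < e / 2 by lra.
have [N hN] := zent_entropy mfI zf e2; have [N' hN'] := zent_entropy mg zg e2.
exists (maxn N N').+1; split => //; set n := _.+1.
have := hN n (leq_trans (leq_maxl _ _) (leqnSn _)).
have := hN' n (leq_trans (leq_maxr _ _) (leqnSn _)).
have mnf := mf_nm (n := n) mfI; have mng := mf_nm (n := n) mg.
have := cond_entropy_subadd mufin mnf mng mf_tt; rewrite -/(entropy _) -/(entropy _) -/(entropy _).
have := entropy_le_fac (mf_fp mnf mng) (@fac_nm_fp _ _ f g n).
lra.
Qed.

Lemma zent_inds s : alls measurable s ->
  (forall i, (i < size s)%N -> zero_rate (ind (nth set0 s i))) -> zero_rate (inds s).
Proof.
elim: s => [_ _ e e0|P s IH /alls_cons[mP ms] h].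
  by exists 0%N; rewrite /entropy_step cond_entropy_fac0// => x y _; apply/ffunP => -[].
have mfP := mf_ind mP; have mfs := mf_inds ms.
apply: zent_fac (@fac_inds_cons _ _ P s) _; first exact: mf_fp.
apply: zent_fp => //; first exact: (h 0%N).
by apply: IH => // i si; exact: (h i.+1).
Qed.

(** Given the future of [f], the present of [f] costs at most [e] once [g] is
    known; so an itinerary of [f] costs about [e] per step given that of [g],
    which itself costs arbitrarily little per step. *)
Lemma relative_rate I J (f : X -> I) (g : X -> J) k (e : R) : measurable_fibers f -> measurable_fibers g ->
  cond_entropy f (fpair (itinerary f k \o S) g) <= e -> zero_rate g -> 0 < e ->
  exists N, forall n, (N <= n)%N -> entropy (itinerary f n) <= 3 * e * n%:R.
Proof.
move=> mfI mg hk zg e0.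
pose b n := cond_entropy (itinerary f n) (itinerary g n).
have bS n : b n.+1 <= b n + cond_entropy f (fpair (itinerary f n \o S) g).
  have mn1 := mf_nm (n := n.+1) mg; have mfn := mf_nm (n := n) mfI.
  have mfnS := mf_S mfn; have mgn := mf_nm (n := n) mg; have mgnS := mf_S mgn.
  have h1 := cond_entropy_fac_l mufin (mf_fp mfI mfnS) mn1 (@fac_nmS1 _ f n).
  apply: (le_trans h1); rewrite cond_entropy_chain//; apply: lerD.
    rewrite /b -[leRHS]cond_entropy_S//; apply: cond_entropy_fac_r => //.
    by move=> x y /(@fac_nmS2 _ g n)/(@fac_fp2 _ _ _ _ _ _).
  apply: cond_entropy_fac_r => //; first exact: mf_fp.
  apply: fac_fp; first exact: fac_fp1.
  by move=> x y [_ /(@fac_nm_nth _ g n.+1 0%N isT)].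
have bn n : b n <= k%:R * entropy f + n%:R * e.
  have h j : b j <= j%:R * entropy f.
    elim: j => [|j IHj].
      by rewrite mul0r /b cond_entropy_fac0// => x y _; apply/ffunP => -[].
    apply: (le_trans (bS j)); rewrite -natr1 mulrDl mul1r; apply: lerD => //.
    by apply: cond_entropy_le_entropy => //; apply: mf_fp => //; exact/mf_S/mf_nm.
  elim: n => [|n IH].
    by apply: (le_trans (h _)); rewrite !mul0r addr0 mulr_ge0// entropy_ge0.
  have [kn|nk] := leqP k n.
    apply: (le_trans (bS n)); rewrite -natr1 mulrDl mul1r addrA; apply: lerD => //.
    apply: le_trans hk; apply: cond_entropy_fac_r => //.
      by apply: mf_fp => //; exact/mf_S/mf_nm.
    apply: fac_fp; last exact: fac_fp2.
    by move=> x y [/(@fac_nm_le _ f _ _ kn _ _) ? _].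
  apply: (le_trans (h _)); rewrite -[leLHS]addr0; apply: lerD.
    by rewrite ler_wpM2r ?entropy_ge0// ler_nat.
  by rewrite mulr_ge0// ltW.
have [N hN] := zent_entropy mg zg e0.
exists (maxn N (Num.truncn (k%:R * entropy f / e)).+1) => n; rewrite geq_max => /andP[h1 h2].
have mfn := mf_nm (n := n) mfI; have mgn := mf_nm (n := n) mg.
have := entropy_le_fac (mf_fp mfn mgn) (@fac_fp1 _ _ _ _ _ _).
rewrite entropy_chain// -/(b n).
have := hN _ h1; have := bn n.
have : k%:R * entropy f <= e * n%:R.
  rewrite [leRHS]mulrC -ler_pdivrMr//; apply: le_trans (ltW (truncnS_gt _)) _.
  by rewrite ler_nat.
lra.
Qed.

End pinsker.

Section pinsker_algebra.
Context (d : measure_display) (X : measurableType d) (R : realType).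
Variable mu : {measure set X -> \bar R}.
Hypothesis mufin : (mu [set: X] < +oo)%E.
Variable S : X -> X.
Hypothesis Smp : measure_preserving mu S.
Implicit Types (I J : finType) (A B P Q : set X).

Local Notation fmu := (fmu mu).
Local Notation cond_entropy := (cond_entropy mu).
Local Notation entropy := (entropy mu).
Local Notation itinerary := (itinerary S).
Local Notation zero_rate := (zero_rate mu S).
Local Notation Pi := (Pi mu S).

Let future P := [set iter k S @^-1` P | k in [set k | (0 < k)%N]].

Lemma future_measurable P : measurable P -> future P `<=` measurable.
Proof. by move=> mP _ [k _ <-]; exact: (mp_iter_measurable Smp). Qed.

(** Zero entropy is predictability: both say that the conditional entropy of
    [P] given finitely many of its future iterates tends to [0]. *)
Lemma PiP P : measurable P -> Pi P <-> zero_rate (ind P).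
Proof.
move=> mP; have mfut := future_measurable mP; split => [[_ fP] e e0|zP].
  have [s Gs hs] := cg_entropy mufin mfut fP e0.
  have [N hN] : exists N, determines (itinerary (ind P) N \o S) (inds s).
    elim: s Gs {hs} => [_|A s IH /alls_cons[[[//|k] _ <-] /IH[N hN]]].
      by exists 0%N => x y _; apply/ffunP => -[].
    exists (maxn N k.+1) => x y xy; apply: fac_inds_cons; rewrite /fpair; congr (_, _).
      have := @fac_nm_nth _ _ S _ (ind P) _ k (leq_maxr N k.+1) _ _ xy.
      by rewrite /= -!iterSr.
    by apply: hN; exact: (fac_nm_le (leq_maxl N k.+1) xy).
  exists N; apply: le_lt_trans hs; apply: cond_entropy_fac_r => //; first exact: mf_ind.
  exact/(mf_S Smp)/(mf_nm Smp)/mf_ind.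
split => //; have cG := csub_cg mu mfut; apply: (csub_closed mufin cG mP) => e e0.
have e4 : 0 < e / 4 by lra.
have [n hn] := zP _ e4; have mfP := mf_ind mP.
have mfN := mf_S Smp (mf_nm (n := n) Smp mfP).
have [r hr] := majority mufin mfN mP.
exists ((itinerary (ind P) n \o S) @^-1` [set j | r j]); last by move: hn; rewrite /entropy_step; lra.
have [sG _ _] := cG.
have Gw w : sigma0 mu (future P) ((itinerary (ind P) n \o S) @^-1` [set w]).
  rewrite (_ : _ @^-1` _ = \bigcap_(k in [set k | (k < n)%N])
     (ind P \o iter k.+1 S) @^-1` [set odflt true (omap w (insub k))]).
    apply: (sa_bigcap_cond sG) => k _.
    have Gk : sigma0 mu (future P) (iter k.+1 S @^-1` P) by apply: sub_cg; exists k.+1.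
    case: (odflt _ _); rewrite comp_preimage ?ind_true ?ind_false//.
    by rewrite preimage_setC; exact: (saC sG Gk).
  apply/seteqP; split => x /=.
    move=> <- k /= kn; rewrite insubT/= ffunE/= -iterSr//.
  move=> h; apply/ffunP => k; rewrite ffunE -iterSr.
  have := h k (ltn_ord k); rewrite valK /= => <-.
  by [].
have -> : (itinerary (ind P) n \o S) @^-1` [set j | r j] =
    \bigcup_(i in [set i | (i < #|{ffun 'I_n -> bool}|)%N])
      [set x | r (nth (itinerary (ind P) n point) (enum {ffun 'I_n -> bool}) i) /\
         ((itinerary (ind P) n \o S) @^-1` [set nth (itinerary (ind P) n point) (enum {ffun 'I_n -> bool}) i]) x].
  apply/seteqP; split => x /=.
    move=> rx; exists (index (itinerary (ind P) n (S x)) (enum {ffun 'I_n -> bool})) => /=.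
      by rewrite cardE index_mem mem_enum.
    by rewrite nth_index ?mem_enum.
  by case=> i /= _ [] + ->.
by apply: (sa_bigcup_cond sG) => i _; apply: (sa_imply sG); exact: Gw.
Qed.

Lemma Pi_measurable P : Pi P -> measurable P. Proof. by case. Qed.

(** A small entropy given a process of zero rate bounds the rate, by
    [relative_rate] with [k = 0]. *)
Lemma zent_limit I (f : X -> I) : measurable_fibers f ->
  (forall e : R, 0 < e -> exists J (g : X -> J), [/\ measurable_fibers g, zero_rate g & cond_entropy f g < e]) ->
  zero_rate f.
Proof.
move=> mfI H; apply: entropy_zent => // e e0; have e3 : 0 < e / 3 by lra.
have [J [g [mg zg hg]]] := H _ e3.
have hk : cond_entropy f (fpair (itinerary f 0 \o S) g) <= e / 3.
  apply/ltW; apply: le_lt_trans hg; apply: cond_entropy_fac_r => //; last exact: fac_fp2.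
  by apply: mf_fp => //; exact/(mf_S Smp)/(mf_nm Smp).
have [N hN] := relative_rate mufin Smp mfI mg hk zg e3.
by exists N.+1; split => //; apply: le_trans (hN _ (leqnSn _)) _; lra.
Qed.

Lemma csub_Pi : is_sigma0 mu Pi.
Proof.
have nP : null_sets mu `<=` Pi.
  move=> A [mA A0]; split => //; apply: sub_gen_smallest; by right.
apply: (csub_lim mufin) => //.
- by move=> A [].
- move=> A PA; have mA := Pi_measurable PA.
  apply/PiP; first exact: measurableC.
  apply: (zent_fac mufin Smp (mf_ind mA) (@fac_indC _ _ _)); exact/PiP.
- move=> A B PA PB; have mA := Pi_measurable PA; have mB := Pi_measurable PB.
  apply/PiP; first exact: measurableU.
  apply: (zent_fac mufin Smp (mf_fp (mf_ind mA) (mf_ind mB)) (@fac_indU _ _ _ _)).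
  exact: (zent_fp mufin Smp (mf_ind mA) (mf_ind mB) ((PiP mA).1 PA) ((PiP mB).1 PB)).
- move=> P mP H; apply/PiP => //; apply: zent_limit; first exact: mf_ind.
  move=> e e0; have [r r0 hr] := cond_entropy_ind_close mufin e0.
  have [Q PQ hQ] := H _ r0; have mQ := Pi_measurable PQ.
  exists bool, (ind Q); split; [exact: mf_ind|exact/PiP|exact: hr].
Qed.

Lemma Pi_future P k : Pi P -> Pi (iter k S @^-1` P).
Proof.
move=> PP; elim: k => [//|k IH]; rewrite iter_preimage.
move: (iter k S @^-1` P) IH => {PP}Q PQ; have mQ := Pi_measurable PQ.
have mSQ := mp_measurable Smp mQ.
apply/PiP => // e e0; have [n hn] := (PiP mQ).1 PQ e e0; exists n.
suff -> : entropy_step mu S (ind (S @^-1` Q)) n = entropy_step mu S (ind Q) n by [].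
have e1 : itinerary (ind (S @^-1` Q)) n = itinerary (ind Q) n \o S.
  by apply/funext => x; apply/ffunP => j; rewrite !ffunE /ind -iterSr.
rewrite /entropy_step e1; apply: (cond_entropy_S Smp (mf_ind mQ)).
exact/(mf_S Smp)/(mf_nm Smp)/mf_ind.
Qed.

(** Since the entropy rates of [P] and of its iterates agree, it suffices to
    approximate some iterate of [P]. *)
Lemma Pi_limit_future P : measurable P ->
  (forall e : R, 0 < e -> exists k Q, Pi Q /\ fmu (iter k S @^-1` P `+` Q) < e) ->
  Pi P.
Proof.
move=> mP H; have mfP := mf_ind mP; apply/PiP => //; apply: entropy_zent => // e e0.
have e3 : 0 < e / 3 by lra.
have [r r0 hr] := cond_entropy_ind_close mufin e3; have [k [Q [PQ hQ]]] := H _ r0.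
have mQ := Pi_measurable PQ; have mSP := mp_iter_measurable Smp k mP.
have hk : cond_entropy (ind (iter k S @^-1` P)) (fpair (itinerary (ind (iter k S @^-1` P)) 0 \o S) (ind Q)) <= e / 3.
  apply/ltW; apply: le_lt_trans (hr _ _ mSP mQ hQ).
  apply: cond_entropy_fac_r => //; [exact: mf_ind| |exact: fac_fp2].
  by apply: mf_fp; [exact/(mf_S Smp)/(mf_nm Smp)/mf_ind|exact: mf_ind].
have [N hN] := relative_rate mufin Smp (mf_ind mSP) (mf_ind mQ) hk ((PiP mQ).1 PQ) e3.
exists N.+1; split => //; have := hN _ (leqnSn _).
have -> : entropy (itinerary (ind (iter k S @^-1` P)) N.+1) = entropy (itinerary (ind P) N.+1); last lra.
have mN := mf_nm (n := N.+1) Smp mfP.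
have -> : itinerary (ind (iter k S @^-1` P)) N.+1 = itinerary (ind P) N.+1 \o iter k S.
  by apply/funext => x; apply/ffunP => j; rewrite !ffunE /= -iterD addnC iterD.
elim: k {mSP hk hN hQ} => [//|k <-].
have -> : itinerary (ind P) N.+1 \o iter k.+1 S = (itinerary (ind P) N.+1 \o iter k S) \o S.
  by apply/funext => x; rewrite /= -iterS iterSr.
have mNk : measurable_fibers (itinerary (ind P) N.+1 \o iter k S).
  by move=> w; exact: (mp_iter_measurable Smp k (mN w)).
by rewrite /(entropy _) -[RHS](cond_entropy_S Smp)//; exact: mf_tt.
Qed.

(** * Countable partitions of finite entropy *)

Section countable.
Variable xi : X -> nat.
Hypothesis mxi : forall v, measurable (xi @^-1` [set v]).

(** A countable partition is handled through its finite approximations. *)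
Definition truncated N (x : X) : 'I_N.+1 := inord (minn (xi x) N).

Lemma fac_tr N x y : truncated N x = truncated N y -> minn (xi x) N = minn (xi y) N.
Proof.
by move=> /(congr1 (@nat_of_ord _)); rewrite !inordK// ltnS geq_minr.
Qed.

Lemma fac_tr_le N N' : (N <= N')%N -> determines (truncated N') (truncated N).
Proof.
move=> NN' x y /fac_tr h; congr inord.
have E z : minn (xi z) N = minn (minn (xi z) N') N by rewrite -minnA (minn_idPr NN').
by rewrite (E x) (E y) h.
Qed.

Lemma in_level x v : (x \in xi @^-1` [set v]) = (xi x == v).
Proof. by apply/idP/eqP => [/set_mem//|?]; apply/mem_set. Qed.

Lemma fac_tr_ind N v : (v < N)%N -> determines (truncated N) (ind (xi @^-1` [set v])).
Proof.
clear mufin; move=> vN x y /fac_tr h; rewrite /ind !in_level.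
by apply/eqP/eqP => ?; lia.
Qed.

Lemma fac_inds_tr N :
  determines (inds [seq xi @^-1` [set v] | v <- iota 0 N]) (truncated N).
Proof.
clear mufin; set s := [seq _ | v <- _]; move=> x y xy; congr inord.
have h v : (v < N)%N -> (xi x == v) = (xi y == v).
  move=> vN; have vs : (v < size s)%N by rewrite size_map size_iota.
  have := @fac_inds_nth _ _ s v vs x y xy.
  by rewrite /s (nth_map 0%N) ?size_iota// nth_iota// add0n /ind !in_level => ->.
case: (ltnP (xi x) N) => xN.
  have e := h _ xN; rewrite eqxx in e. move/eqP: (esym e); lia.
case: (ltnP (xi y) N) => yN.
  by have e := h _ yN; rewrite eqxx in e; move/eqP: e; lia.
lia.
Qed.

Lemma alls_levels N : alls measurable [seq xi @^-1` [set v] | v <- iota 0 N].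
Proof.
move=> i; rewrite size_map size_iota => iN.
by rewrite (nth_map 0%N) ?size_iota.
Qed.

Lemma mf_tr N : measurable_fibers (truncated N).
Proof. exact: mf_fac (mf_inds (@alls_levels N)) (@fac_inds_tr N). Qed.

Hypothesis xi_entropy : exists K : R, forall N, entropy (truncated N) <= K.

(** The entropies of the truncations increase to a finite supremum. *)
Lemma tr_tail (e : R) : 0 < e ->
  exists N, forall N', (N <= N')%N -> cond_entropy (truncated N') (truncated N) <= e.
Proof.
move=> e0; have [K hK] := xi_entropy.
have hs : has_sup (range (fun N => entropy (truncated N))).
  by split; [exists (entropy (truncated 0)), 0%N|exists K => _ [N _ <-]; exact: hK].
have [_ [N _ <-] hN] := sup_adherent e0 hs.
exists N => N' NN'; have := ub_le_sup hs.2 (ex_intro2 _ _ N' I erefl).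
have := entropy_le_fac mufin (@mf_tr N') (_ : determines (truncated N') (fpair (truncated N') (truncated N))).
rewrite (entropy_chain mufin (@mf_tr _) (@mf_tr _)).
move=> /(_ (fac_fp (@fac_refl _ _ _ _) (fac_tr_le NN'))); lra.
Qed.

(** A partition of finite entropy that is determined by its own future and by
    events of zero entropy has zero entropy. *)
Lemma relative_predictable :
  let G := [set A | exists k v, (0 < k)%N /\ A = iter k S @^-1` (xi @^-1` [set v])]
    `|` Pi in
  (forall v, sigma0 mu G (xi @^-1` [set v])) -> forall v, Pi (xi @^-1` [set v]).
Proof.
move=> G HG v; have mfv := mf_ind (mxi v).
have Gm : G `<=` measurable.
  move=> A [[k [w [_ ->]]]|/Pi_measurable//].
  exact: (mp_iter_measurable Smp).
apply/PiP => //; apply: entropy_zent => // e e0; have e6 : 0 < e / 6 by lra.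
have e12 : 0 < e / 12 by lra.
have [N0 hN0] := tr_tail e12.
pose t := [seq xi @^-1` [set w] | w <- iota 0 N0].
have Gt : alls (sigma0 mu G) t.
  by move=> i; rewrite size_map size_iota => iN; rewrite (nth_map 0%N) ?size_iota.
have [s Gs hs] := cg_entropy_list mufin Gm Gt e12.
have [s' [K [N [Ps' NN vN hfac]]]] : exists s' K N, [/\ alls Pi s', (N0 <= N)%N, (v < N)%N &
    determines (fpair (itinerary (truncated N) K \o S) (inds s')) (inds s)].
  elim: s Gs {hs} => [_|A s IH /alls_cons[GA /IH[s' [K [N [Ps' NN vN hf]]]]]].
    exists [::], 0%N, (maxn N0 v.+1); split => //; first exact: leq_maxl.
      exact: leq_maxr.
    by move=> x y _; apply/ffunP => -[].
  case: GA => [[[|k] [w [k0 ->]]]|PA]; first by [].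
    exists s', (maxn K k.+1), (maxn N w.+1); split => //.
      exact: leq_trans (leq_maxl _ _).
      exact: leq_trans (leq_maxl _ _).
    move=> x y [xy xy']; apply: fac_inds_cons; rewrite /fpair; congr (_, _).
      have := @fac_nm_nth _ _ S _ _ _ k (leq_maxr K k.+1) _ _ xy.
      move=> /(fac_tr_ind (leq_maxr N w.+1)).
      by rewrite /= -!iterSr.
    apply: hf; rewrite /fpair xy'; congr (_, _).
    have /= := fac_nm_le (leq_maxl K k.+1) xy.
    exact: (fac_nm (fac_tr_le (leq_maxl N w.+1))).
  exists (A :: s'), K, N; split => //; first exact/alls_cons.
  move=> x y [xy xy']; apply: fac_inds_cons; rewrite /fpair; congr (_, _).
    exact: (@fac_inds_nth _ _ (A :: s') 0%N isT).
  apply: hf; rewrite /fpair; congr (_, _); first exact: xy.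
  exact: (@fac_inds_catr _ _ [:: A] s').
have mN := @mf_tr N; have mN0 := @mf_tr N0.
have ms' := alls_sub Pi_measurable Ps'.
have mg := mf_inds ms'.
have zg : zero_rate (inds s').
  by apply: zent_inds => // i si; apply/PiP; [exact: ms'|exact: Ps'].
have mp : measurable_fibers (fpair (itinerary (truncated N) K \o S) (inds s')).
  by apply: mf_fp => //; exact/(mf_S Smp)/(mf_nm Smp).
have hk : cond_entropy (truncated N) (fpair (itinerary (truncated N) K \o S) (inds s')) <= e / 6.
  have ms := mf_inds (alls_sub Gm Gs).
  have mt : measurable_fibers (inds t) by apply: mf_inds; exact: alls_levels.
  have h1 := cond_entropy_triangle mufin mN mN0 mp; have h2 := hN0 _ NN.
  have h3 : cond_entropy (truncated N0) _ <= cond_entropy (inds t) _ := cond_entropy_fac_l mufin mt mp (@fac_inds_tr N0).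
  have h4 := cond_entropy_fac_r mufin mt mp hfac.
  apply: (le_trans h1); have -> : e / 6 = e / 12 + e / 12 by field.
  by apply: lerD h2; apply: (le_trans h3); apply: (le_trans h4); exact: ltW.
have [n hn] := relative_rate mufin Smp mN mg hk zg e6.
exists n.+1; split => //.
apply: le_trans (entropy_le_fac mufin (mf_nm (n := n.+1) Smp mN) (fac_nm (fac_tr_ind vN))) _.
by apply: le_trans (hn _ (leqnSn _)) _; rewrite ler_wpM2r//; lra.
Qed.

End countable.

End pinsker_algebra.

Section gibbs.
Context (d : measure_display) (X : measurableType d) (R : realType).
Variable mu : {measure set X -> \bar R}.
Hypothesis mufin : (mu [set: X] < +oo)%E.
Variable xi : X -> nat.
Hypothesis mxi : forall v, measurable (xi @^-1` [set v]).

Lemma measurable_nat_comp (D : set X) (g : nat -> R) : measurable D ->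
  measurable_fun D (EFin \o (g \o xi)).
Proof.
move=> mD; apply/measurable_EFinP; apply: (@measurable_comp _ _ _ _ _ _ [set: nat]) => //.
apply: (@measurable_funS _ _ _ _ setT) => // _ B _; rewrite setTI.
have -> : xi @^-1` B = \bigcup_(v in B) xi @^-1` [set v].
  by apply/seteqP; split => x /=; [exists (xi x)|case=> v /= Bv ->].
exact: bigcup_measurable.
Qed.

(** Gibbs' inequality: the entropy is at most the mean of [- ln p] up to a
    constant that depends on the total weight and on the total mass only. The
    cell of the values merged by the truncation is compared with the weight [1],
    whence [C + 1]. *)
Lemma gibbs (p : nat -> R) (C : R) : (forall v, 0 < p v <= 1) ->
  (forall N, \sum_(v < N) p v <= C) ->
  (\int[mu]_x (- ln (p (xi x)))%:E < +oo)%E ->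
  exists K : R, forall N, entropy mu (truncated xi N) <= K.
Proof.
move=> p01 pC fint; set I := (\int[mu]_x _)%E in fint.
have cost0 v : 0 <= - ln (p v) by rewrite oppr_ge0 ln_le0//; case/andP: (p01 v).
have I0 : (0 <= I)%E by apply: integral_ge0 => x _; rewrite lee_fin.
pose M := fmu mu [set: X]; have M0 : 0 <= M by exact: fmu_ge0.
exists (fine I + M * (C + 1)) => N.
have sumI : \sum_(v < N) fmu mu (xi @^-1` [set (v : nat)]) * - ln (p v) <= fine I.
  rewrite -lee_fin fineK ?ge0_fin_numE// -sumEFin.
  pose F (v : 'I_N) := xi @^-1` [set (v : nat)].
  have tF : trivIset [set: 'I_N] F.
    by move=> v w _ _ [x [/= xv xw]]; apply: ord_inj; rewrite -xv -xw.
  have mF v : measurable (F v) by exact: mxi.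
  rewrite (eq_bigr (fun v : 'I_N => \int[mu]_(x in F v) (- ln (p (xi x)))%:E)%E); last first.
    move=> v _; rewrite (eq_integral (fun=> (- ln (p v))%:E)); last first.
      by move=> x /set_mem /= ->.
    by rewrite integral_cst// mulrC EFinM (fmuE mufin).
  rewrite -ge0_integral_bigsetU ?index_enum_uniq//.
  - apply: ge0_subset_integral => //; first exact: bigsetU_measurable.
      exact: (measurable_nat_comp (fun v => - ln (p v))).
    by move=> x _; rewrite lee_fin.
  - by move=> v w _ _; exact: tF.
  - by apply: (measurable_nat_comp (fun v => - ln (p v))); exact: bigsetU_measurable.
  - by move=> x _; rewrite lee_fin.
rewrite /entropy /cond_entropy (big_pred1 tt); last by case.
rewrite -sumrN big_ord_recr/=.
have fibT (i : 'I_N.+1) : truncated xi N @^-1` [set i] `&` (fun=> tt) @^-1` [set tt] =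
    truncated xi N @^-1` [set i].
  by apply/seteqP; split => x //= -[].
have tT : (fun _ : X => tt) @^-1` [set tt] = [set: X] by apply/seteqP; split.
rewrite tT -/M.
have key (a q : R) : 0 <= a -> a <= M -> 0 < q -> - (a * ln (a / M)) <= a * - ln q + M * q.
  move=> a0 aM q0; case: (ltgtP a 0) a0 => // [a1|->] _; last first.
    by rewrite !mul0r oppr0 add0r mulr_ge0// ltW.
  have M1 : 0 < M by apply: lt_le_trans aM.
  have h : 0 < q * M / a by rewrite divr_gt0// mulr_gt0.
  have : a * ln (q * M / a) <= M * q.
    apply: (@le_trans _ _ (a * (q * M / a - 1))); first by rewrite ler_pM2l// ln_le_subr1.
    by rewrite mulrBr mulrC divfK ?gt_eqF//; nra.
  by rewrite !ln_div ?lnM ?posrE ?mulr_gt0//; nra.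
have leM (i : 'I_N.+1) : fmu mu (truncated xi N @^-1` [set i]) <= M.
  by apply: le_fmu => //; exact: (mf_tr mxi (N := N) i).
have sumK : \sum_(i < N) - (fmu mu (truncated xi N @^-1` [set widen_ord (leqnSn N) i] `&` setT) *
     ln (fmu mu (truncated xi N @^-1` [set widen_ord (leqnSn N) i] `&` setT) / M)) <=
  \sum_(v < N) (fmu mu (xi @^-1` [set (v : nat)]) * - ln (p v) + M * p v).
  apply: ler_sum => i _; rewrite setIT.
  have e : truncated xi N @^-1` [set widen_ord (leqnSn N) i] = xi @^-1` [set (i : nat)].
    apply/seteqP; split => x /=.
      move=> /(congr1 (@nat_of_ord _)); rewrite inordK ?ltnS ?geq_minr//=.
      by have := ltn_ord i; lia.
    by move=> h; apply: ord_inj; rewrite /= inordK ?ltnS ?geq_minr// h; have := ltn_ord i; lia.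
  rewrite -e; apply: key; [exact: fmu_ge0|exact: leM|by case/andP: (p01 i)].
apply: (le_trans (lerD sumK _)).
  by rewrite setIT; apply: (key _ 1 (fmu_ge0 _ _) (leM _)).
rewrite big_split/= ln1 oppr0 mulr0 add0r -mulr_sumr.
by have := ler_wpM2l M0 (pC N); lra.
Qed.

End gibbs.

(** * Return times *)

Section return_times.
Context (d : measure_display) (X : measurableType d).
Implicit Types (S : X -> X) (A B E G : set X) (x : X).

Definition hits S A x := exists n, (0 < n)%N /\ A (iter n S x).

(** From a point that visits [A] infinitely often the induced maps never meet the
    default value of the return time. *)
Definition io S A x := forall N, exists n, (N <= n)%N /\ A (iter n S x).

Lemma return_time_eq S A x n : (0 < n)%N -> A (iter n S x) ->
  (forall k, (0 < k)%N -> A (iter k S x) -> (n <= k)%N) -> return_time S A x = n.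
Proof.
move=> n0 An minn; rewrite /return_time; set P := [set n | _].
have [h1 h2 h3] : P (xget 0%N P) by apply: xgetPex; exists n.
by apply/eqP; rewrite eqn_leq h3//= minn.
Qed.

Lemma return_timeP S A x : hits S A x -> let n := return_time S A x in
  [/\ (0 < n)%N, A (iter n S x) &
      forall k, (0 < k)%N -> A (iter k S x) -> (n <= k)%N].
Proof.
move=> [m [m0 Am]].
have ex : exists n, (0 < n)%N && `[< A (iter n S x) >].
  by exists m; rewrite m0; exact/asboolP.
case: (ex_minnP ex) => n /andP[n0 /asboolP An] minn.
have h k : (0 < k)%N -> A (iter k S x) -> (n <= k)%N.
  by move=> k0 Ak; apply: minn; rewrite k0; exact/asboolP.
by rewrite (return_time_eq n0 An h).
Qed.

Lemma return_time0 S A x : ~ hits S A x -> return_time S A x = 0%N.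
Proof.
move=> nh; rewrite /return_time xgetPN// => n [n0 An _].
by apply: nh; exists n.
Qed.

Lemma return_time_gt0 S A x : (0 < return_time S A x)%N -> hits S A x.
Proof.
by move=> r0; apply: contrapT => /return_time0 e; rewrite e in r0.
Qed.

Lemma io_hits S A x : io S A x -> hits S A x.
Proof. by move=> /(_ 1%N)[n [n1 An]]; exists n. Qed.

Lemma io_shift S A x k : io S A (iter k S x) <-> io S A x.
Proof.
split => h N; have [n [Nn An]] := h (N + k)%N.
  by exists (n + k)%N; split; [lia|rewrite iterD].
by exists (n - k)%N; split; [lia|rewrite -iterD subnK//; lia].
Qed.

Lemma io_sub S A B x : A `<=` B -> io S A x -> io S B x.
Proof. by move=> AB h N; have [n [Nn /AB]] := h N; exists n. Qed.

Lemma return_time_first S A x : A (S x) -> return_time S A x = 1%N.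
Proof. by move=> ASx; apply: return_time_eq. Qed.

Lemma hits_later S A x : ~ A (S x) -> hits S A x -> hits S A (S x).
Proof.
move=> nA [n [n0 An]]; case: n n0 An => [//|[|n]] _ An; first by case: nA.
by exists n.+1; split => //; rewrite -iterSr.
Qed.

Lemma return_time_later S A x : ~ A (S x) -> hits S A (S x) ->
  return_time S A x = (return_time S A (S x)).+1.
Proof.
move=> nA /return_timeP[h1 h2 h3]; apply: return_time_eq => //.
  by rewrite iterSr.
move=> [//|k] _; rewrite iterSr ltnS; case: k => [/nA []|k]; exact: h3.
Qed.

Lemma induced_hit S A x : hits S A x -> A (induced_map S A x).
Proof. by case/return_timeP. Qed.

Lemma io_induced S A B x : io S A x -> io S A (induced_map S B x).
Proof. by move=> h; apply/io_shift. Qed.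

Lemma iter_induced S A k x : iter k (induced_map S A) x =
  iter (\sum_(i < k) return_time S A (iter i (induced_map S A) x)) S x.
Proof.
elim: k => [|k IH]; first by rewrite big_ord0.
by rewrite iterS big_ord_recr/= addnC iterD -IH.
Qed.

Lemma io_iter_induced S A B x k : io S A x -> io S A (iter k (induced_map S B) x).
Proof. by move=> h; rewrite iter_induced; apply/io_shift. Qed.

Lemma visit_time S A x n : io S A x -> (0 < n)%N -> A (iter n S x) ->
  exists k, (0 < k)%N /\
    n = (\sum_(i < k) return_time S A (iter i (induced_map S A) x))%N.
Proof.
elim/ltn_ind: n x => n IH x iox n0 An.
have [r0 Ar rmin] := return_timeP (io_hits iox).
have := rmin _ n0 An; rewrite leq_eqVlt => /orP[/eqP <-|rn].
  by exists 1%N; rewrite big_ord1.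
have [||||k [k0 e]] := IH (n - return_time S A x)%N _ (induced_map S A x).
- by lia.
- exact: io_induced.
- by lia.
- by rewrite /induced_map -iterD subnK; [exact: An|exact: ltnW].
exists k.+1; split => //; rewrite big_ord_recl.
under eq_bigr do rewrite lift0 iterSr.
by rewrite -e subnKC// ltnW.
Qed.

Lemma visit_time_mono S A x k l : io S A x -> (k < l)%N ->
  (\sum_(i < k) return_time S A (iter i (induced_map S A) x) <
   \sum_(i < l) return_time S A (iter i (induced_map S A) x))%N.
Proof.
move=> iox; elim: l => [//|l IH]; rewrite ltnS leq_eqVlt big_ord_recr/=.
have [r0 _ _] := return_timeP (io_hits (io_iter_induced A l iox)).
case/orP => [/eqP ->|/IH h]; last exact: ltn_addr.
by rewrite -[X in (X < _)%N]addn0 ltn_add2l.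
Qed.

Section nested.
Variables (S : X -> X) (E G : set X).
Hypothesis EG : E `<=` G.

Lemma nested_hits x : io S E x -> hits (induced_map S G) E x.
Proof.
move=> iox; have ioG := io_sub EG iox.
have [r0 Er _] := return_timeP (io_hits iox).
have [k [k0 e]] := visit_time ioG r0 (EG Er).
by exists k; split => //; rewrite iter_induced -e.
Qed.

(** A return to the smaller set is a succession of returns to the larger one. *)
Lemma nested_return_time x : io S E x -> return_time S E x =
  (\sum_(i < return_time (induced_map S G) E x)
     return_time S G (iter i (induced_map S G) x))%N.
Proof.
move=> iox; have ioG := io_sub EG iox.
have [k0 Ek kmin] := return_timeP (nested_hits iox).
have [r0 Er rmin] := return_timeP (io_hits iox).
have [l [l0 e]] := visit_time ioG r0 (EG Er).
set k := return_time (induced_map S G) E x in k0 Ek kmin *.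
have kl : (k <= l)%N by apply: kmin => //; rewrite iter_induced -e.
apply/eqP; rewrite eqn_leq; apply/andP; split.
  apply: rmin; last by rewrite -iter_induced.
  have := visit_time_mono ioG k0; rewrite big_ord0; exact: leq_ltn_trans.
rewrite e; move: kl; rewrite leq_eqVlt => /orP[/eqP -> //|kl].
exact/ltnW/visit_time_mono.
Qed.

Lemma nested_induced x : io S E x ->
  induced_map (induced_map S G) E x = induced_map S E x.
Proof.
by move=> iox; rewrite {1}/induced_map iter_induced -nested_return_time.
Qed.

Lemma nested_iter x k : io S E x ->
  iter k (induced_map (induced_map S G) E) x = iter k (induced_map S E) x.
Proof.
move=> iox; elim: k => [//|k IH]; rewrite !iterS IH nested_induced//.
exact: io_iter_induced.
Qed.

End nested.

Section levels.
Variables (K : set (set X)) (S : X -> X) (A : set X).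
Hypothesis sK : sigma_algebra [set: X] K.

(** The levels of the return time to [A] are Boolean combinations of the strict
    preimages of [A]. *)
Lemma sa_return_time : (forall k, (0 < k)%N -> K (iter k S @^-1` A)) ->
  forall n, K (return_time S A @^-1` [set n]).
Proof.
move=> KA [|n].
  rewrite (_ : _ @^-1` _ = \bigcap_(k in [set k | (0 < k)%N]) ~` (iter k S @^-1` A)).
    by apply: (sa_bigcap_cond sK) => k /KA/(saC sK).
  apply/seteqP; split => x /=.
    move=> r0 k /= k0 Ak; have h : hits S A x by exists k.
    by case: (return_timeP h); rewrite r0.
  by move=> h; apply: return_time0 => -[k [k0 Ak]]; exact: (h k k0).
rewrite (_ : _ @^-1` _ = (iter n.+1 S @^-1` A) `&`
    \bigcap_(k in [set k | (0 < k < n.+1)%N]) ~` (iter k S @^-1` A)).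
  apply: (saI sK); first exact: KA.
  by apply: (sa_bigcap_cond sK) => k /andP[/KA/(saC sK)].
apply/seteqP; split => x /=.
  move=> r; have h : hits S A x by apply: return_time_gt0; rewrite r.
  case: (return_timeP h); rewrite r => _ An minn; split => // k /= /andP[k0 kn] Ak.
  by have := minn _ k0 Ak; lia.
case=> An h; apply: return_time_eq => // k k0 Ak; rewrite leqNgt; apply/negP => kn.
by apply: (h k) => //=; rewrite k0.
Qed.

Lemma sa_induced B : (forall n, K (return_time S A @^-1` [set n])) ->
  (forall n, K (iter n S @^-1` B)) -> K (induced_map S A @^-1` B).
Proof.
move=> Kr KB; rewrite (_ : _ @^-1` _ =
    \bigcup_n (return_time S A @^-1` [set n] `&` iter n S @^-1` B)).
  by apply: (sa_bigcup sK) => n; exact: (saI sK).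
apply/seteqP; split => x /=; last by rewrite /induced_map => -[n _ /= [<-]].
by move=> h; exists (return_time S A x).
Qed.

Lemma sa_io : (forall k, K (iter k S @^-1` A)) -> K [set x | io S A x].
Proof.
move=> KA; rewrite (_ : mkset _ = \bigcap_(N in setT)
   \bigcup_(n in [set n | (N <= n)%N]) iter n S @^-1` A).
  apply: (sa_bigcap_cond sK) => N _; exact: (sa_bigcup_cond sK).
apply/seteqP; split => x /= h N; first by move=> _; have [n [Nn An]] := h N; exists n.
by have [n /= Nn An] := h N I; exists n.
Qed.

End levels.

End return_times.

(** * Conservative ergodic systems and their induced systems *)

Section systems.
Context (d : measure_display) (X : measurableType d) (R : realType).
Implicit Types (A B W : set X).

Definition sys (mu : set X -> \bar R) (S : X -> X) : Prop :=
  [/\ measure_preserving mu S, conservative mu S & ergodic mu S].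

Lemma le_mu_null (mu : {measure set X -> \bar R}) A B N : measurable A ->
  measurable B -> measurable N -> mu N = 0%E -> A `<=` B `|` N -> (mu A <= mu B)%E.
Proof.
move=> mA mB mN N0 ABN; rewrite -[leRHS]adde0 -N0.
apply: (@le_trans _ _ (mu (B `|` N))); last exact: measureU2.
by apply: le_measure; rewrite ?inE//; exact: measurableU.
Qed.

Section one_system.
Variables (mu : {measure set X -> \bar R}) (S : X -> X).
Hypothesis sysS : sys mu S.

Let Smp : measure_preserving mu S. Proof. by case: sysS. Qed.

Let mSk k A : measurable A -> measurable (iter k S @^-1` A).
Proof. exact: (mp_iter_measurable Smp). Qed.

Lemma measurable_return_time A n : measurable A ->
  measurable (return_time S A @^-1` [set n]).
Proof.
move=> mA; apply: (sa_return_time (@sa_measurable _ X)) => k _; exact: mSk.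
Qed.

Lemma measurable_induced A B : measurable A -> measurable B ->
  measurable (induced_map S A @^-1` B).
Proof.
move=> mA mB; apply: (sa_induced (@sa_measurable _ X)) => n; last exact: mSk.
exact: measurable_return_time.
Qed.

Lemma measurable_io A : measurable A -> measurable [set x | io S A x].
Proof. by move=> mA; apply: (sa_io (@sa_measurable _ X)) => k; exact: mSk. Qed.

(** The set of points that visit [A] contains its preimage, and the difference
    wanders; so it is invariant modulo null sets, and its complement is null by
    ergodicity. *)
Lemma io_full A : measurable A -> (0 < mu A)%E -> mu (~` [set x | io S A x]) = 0%E.
Proof.
move=> mA A0; pose U := \bigcup_n iter n S @^-1` A.
have mU : measurable U by apply: bigcupT_measurable => n; exact: mSk.
have mSU : measurable (S @^-1` U) by exact: (mSk 1).
have SU : S @^-1` U `<=` U by move=> x [n _ h]; exists n.+1; rewrite // /preimage/= -iterS iterSr.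
have [_ cS eS] := sysS.
have W0 : mu (U `\` S @^-1` U) = 0%E.
  apply: cS; first exact: measurableD.
  have H x i j : (i < j)%N -> (U `\` S @^-1` U) (iter i S x) -> ~ U (iter j S x).
    move=> ij [_ nU] [n _ h]; apply: nU; exists (n + (j - i.+1))%N => //=.
    by move: h; rewrite /preimage/= -iterS -!iterD; congr (A (iter _ _ _)); lia.
  move=> i j _ _ [x [xi xj]]; case: (ltngtP i j) => // ij.
    by case: (H x i j ij xi); case: xj.
  by case: (H x j i ij xj); case: xi.
have [|U0|nU0] := eS U mU.
- by rewrite setY_def (_ : _ `\` U = set0) ?set0U//; rewrite setD_eq0.
- suff : (mu A <= mu U)%E by rewrite U0 leNgt A0.
  by apply: le_measure; rewrite ?inE// => x Ax; exists 0%N.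
have -> : ~` [set x | io S A x] = \bigcup_N iter N S @^-1` (~` U).
  apply/seteqP; split => x /=.
    move=> nio; apply: contrapT => h; apply: nio => N.
    apply: contrapT => h'; apply: h; exists N => // -[n _ Un]; apply: h'.
    by exists (n + N)%N; split; [exact: leq_addl|rewrite iterD].
  case=> N _ /= nU iox; apply: nU; have [n [Nn An]] := iox N.
  by exists (n - N)%N => //; rewrite /preimage/= -iterD subnK.
have mnU := measurableC mU.
apply: null_bigcup => n; first exact: mSk.
by rewrite (mp_iter_mu Smp).
Qed.

Lemma null_preimage k N : measurable N -> mu N = 0%E -> mu (iter k S @^-1` N) = 0%E.
Proof. by move=> mN N0; rewrite (mp_iter_mu Smp). Qed.

Section induced.
Variable A : set X.
Hypotheses (mA : measurable A) (A0 : (0 < mu A)%E) (Afin : (mu A < +oo)%E).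

(* The points that enter [A] for the first time at time [n + 1], through [B]. *)
Let V B n := return_time S A @^-1` [set n.+1] `&` iter n.+1 S @^-1` (B `&` A).

Let mV B n : measurable B -> measurable (V B n).
Proof.
move=> mB; apply: measurableI; first exact: measurable_return_time.
by apply: mSk; exact: measurableI.
Qed.

(* The set of points entering [A] at time [n + 2] through [B] is the preimage
   of the set of points outside [A] entering [A] at time [n + 1] through [B]. *)
Let VS B n : V B n.+1 = S @^-1` (V B n `\` A).
Proof.
apply/seteqP; split => x.
  move=> [/= r [Bn An]]; have h : hits S A x by exists n.+2.
  have nA : ~ A (S x) by move=> ASx; have := @return_time_first _ _ S A x ASx; rewrite r.
  split => //; split; last by split; rewrite -iterSr.
  by move: r; rewrite /= (return_time_later nA (hits_later nA h)) => -[].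
case=> -[/= r [Bn An]] nA.
have hS : hits S A (S x) by apply: return_time_gt0; rewrite r.
split; first by rewrite /= (return_time_later nA hS) r.
by split; rewrite iterSr.
Qed.

Let V0 B : V B 0 = S @^-1` (B `&` A).
Proof.
apply/seteqP; split => x; first by case.
by move=> [Bx Ax]; split => //=; exact: return_time_first.
Qed.

Let V_sum B n : measurable B ->
  (\sum_(k < n) mu (V B k `&` A) + mu (V B n) = mu (B `&` A))%E.
Proof.
move=> mB; have [_ pS] := Smp; elim: n => [|n IH].
  by rewrite big_ord0 add0e V0 pS//; exact: measurableI.
rewrite big_ord_recr/= VS pS; last by apply: measurableD => //; exact: mV.
rewrite -addeA -[RHS]IH; congr (_ + _)%E.
by rewrite addeC -measureDI//; exact: mV.
Qed.

Let V_cover B : A `&` [set x | io S A x] `&` induced_map S A @^-1` B `<=`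
  \bigcup_n (V B n `&` A).
Proof.
move=> x [[Ax iox] Bx]; have [r0 Ar _] := return_timeP (io_hits iox).
exists (return_time S A x).-1 => //; split => //; rewrite /V prednK//; split => //.
Qed.

Let induced_le B : measurable B ->
  (mu (induced_map S A @^-1` B `&` A) <= mu (B `&` A))%E.
Proof.
move=> mB; have mio := measurable_io mA; have io0 := io_full mA A0.
have mI := measurable_induced mA mB.
have mVA n : measurable (V B n `&` A) by apply: measurableI => //; exact: mV.
have mU : measurable (\bigcup_n (V B n `&` A)) by exact: bigcupT_measurable.
apply: (le_trans (le_mu_null _ mU (measurableC mio) io0 _)).
- exact: measurableI.
- move=> x [Bx Ax]; have [iox|nio] := pselect (io S A x); last by right.
  by left; apply: V_cover; split.
rewrite measure_bigcup//; last first.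
  move=> i j _ _ [x [[[/= ri _] _] [[/= rj _] _]]].
  by move: ri; rewrite rj => -[].
apply: lime_le; first by apply: is_cvg_nneseries => n _ _; exact: measure_ge0.
apply: nearW => n; rewrite -(V_sum n mB) (eq_bigl xpredT); last by move=> i; rewrite in_setT.
by rewrite big_mkord leeDl.
Qed.

(** The inequality [induced_le], which loses nothing on the total mass, is applied
    to [B] and to its complement. *)
Lemma induced_mu B : measurable B ->
  mu (induced_map S A @^-1` B `&` A) = mu (B `&` A).
Proof.
move=> mB; have mI := measurable_induced mA mB.
have mIA : measurable (induced_map S A @^-1` B `&` A) by exact: measurableI.
have mBA : measurable (B `&` A) by exact: measurableI.
apply/eqP; rewrite eq_le induced_le//=.
have h2 := induced_le (measurableC mB).
have e1 : mu A = (mu (induced_map S A @^-1` B `&` A) + mu (induced_map S A @^-1` (~` B) `&` A))%E.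
  by rewrite (measureDI mu mA mI) addeC setIC setDE [X in (_ + mu X)%E]setIC.
have e2 : mu A = (mu (B `&` A) + mu (~` B `&` A))%E.
  by rewrite (measureDI mu mA mB) addeC setIC setDE [X in (_ + mu X)%E]setIC.
have mBC := measurableC mB.
have fn C : measurable C -> mu (C `&` A) \is a fin_num.
  move=> mC; rewrite ge0_fin_numE//; apply: le_lt_trans Afin.
  by apply: le_measure; rewrite ?inE//; exact: measurableI.
have mI' := measurable_induced mA mBC.
move: h2 e1; rewrite {}e2.
rewrite -(fineK (fn _ mI)) -(fineK (fn _ mI')) -(fineK (fn _ mB)) -(fineK (fn _ mBC)).
rewrite -!EFinD !lee_fin => h [e]; lra.
Qed.

Lemma rs_fin : (mrestr mu mA [set: X] < +oo)%E.
Proof. by rewrite /mrestr setTI. Qed.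

(** A finite measure has no room for infinitely many disjoint copies of a set of
    positive measure. *)
Lemma mp_conservative (nu : {measure set X -> \bar R}) (f : X -> X) :
  (nu [set: X] < +oo)%E -> measure_preserving nu f -> conservative nu f.
Proof.
move=> nufin fmp W mW tW.
have mfW k : measurable (iter k f @^-1` W) by exact: (mp_iter_measurable fmp).
have h n : n%:R * fmu nu W <= fmu nu [set: X].
  rewrite -lee_fin EFinM -!(fmuE nufin)//.
  apply: (@le_trans _ _ (nu (\big[setU/set0]_(i < n) iter i f @^-1` W))).
    rewrite (measure_bigsetU nu (F := fun i => iter i f @^-1` W))//.
    rewrite (eq_bigr (fun=> nu W)); last by move=> i _; exact: (mp_iter_mu fmp i mW).
    by rewrite (fmuE nufin)// sumEFin sumr_const card_ord -EFinM mulr_natl.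
  apply: le_measure; rewrite ?inE//; exact: bigsetU_measurable.
rewrite (fmuE nufin)//; congr EFin; apply/eqP; rewrite eq_le fmu_ge0 andbT leNgt.
apply/negP => W0; have := h (Num.truncn (fmu nu [set: X] / fmu nu W)).+1.
by rewrite leNgt -ltr_pdivrMr// truncnS_gt.
Qed.

(** For the ergodicity: if [B] is invariant for the induced map, then the set of
    points that next enter [A] through [B] is invariant for [S]. *)
Lemma sys_induced : sys (mrestr mu mA) (induced_map S A).
Proof.
have mio := measurable_io mA; have io0 := io_full mA A0.
have mpT : measure_preserving (mrestr mu mA) (induced_map S A).
  split; last exact: induced_mu.
  by move=> _ B mB; rewrite setTI; exact: measurable_induced.
split => //; first exact: mp_conservative rs_fin mpT.
move=> B mB B0; have [_ _ eS] := sysS; rewrite /mrestr in B0 *.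
have mI := measurable_induced mA mB.
set N := (_ `+` B) `&` A in B0.
have mN : measurable N by apply: measurableI => //; exact: measurableY.
have mSN := mSk 1 mN; have mSI := mSk 1 mI.
have sub A' B' : measurable A' -> measurable B' -> mu B' = 0%E ->
    A' `<=` B' `|` N -> mu A' = 0%E.
  move=> mA' mB' B'0 AB; apply/eqP; rewrite eq_le measure_ge0 andbT -B'0.
  exact: (le_mu_null _ _ mN B0).
have [|U0|U0] := eS (induced_map S A @^-1` B) mI.
- have Z0 : null_sets mu (~` [set x | io S A x] `|` iter 1 S @^-1` N).
    split; first by apply: measurableU => //; exact: measurableC.
    apply/eqP; rewrite eq_le measure_ge0 andbT -(null_preimage 1 mN B0).
    apply: (le_mu_null _ _ (measurableC mio) io0) => //; last by rewrite setUC.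
    by apply: measurableU => //; exact: measurableC.
  have [] // : null_sets mu (S @^-1` (induced_map S A @^-1` B) `+` induced_map S A @^-1` B).
  case: Z0 => mZ Z0; apply: (null_setsP _ mZ _ Z0); first exact: measurableY.
  move=> x h; have [iox|nio] := pselect (io S A x); [right|by left].
  have [ASx|nA] := pselect (A (S x)).
    have e : induced_map S A x = S x by rewrite /induced_map return_time_first.
    by split => //; case: h => -[]; rewrite /preimage/= e => ? ?; [left|right].
  have hS := hits_later nA (io_hits iox).
  have e : induced_map S A x = induced_map S A (S x).
    by rewrite /induced_map (return_time_later nA hS) iterSr.
  by case: h => -[]; rewrite /preimage/= e.
- left; apply: (sub _ (induced_map S A @^-1` B)) => //; first exact: measurableI.
  move=> x [Bx Ax]; have [?|nx] := pselect ((induced_map S A @^-1` B) x); first by left.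
  by right; split => //; right.
- right; apply: (sub _ (~` (induced_map S A @^-1` B))) => //.
    by apply: measurableI => //; exact: measurableC.
    exact: measurableC.
  move=> x [Bx Ax]; have [?|nx] := pselect ((induced_map S A @^-1` B) x); last by left.
  by right; split => //; left.
Qed.

End induced.
End one_system.
End systems.

Section integrals.
Context (d : measure_display) (X : measurableType d) (R : realType).
Implicit Types (A B D W : set X) (mu : {measure set X -> \bar R}).

Lemma integral_mrestr mu A (mA : measurable A) D (f : X -> \bar R) :
  measurable D -> measurable_fun [set: X] f -> (forall x, (0 <= f x)%E) ->
  (\int[mrestr mu mA]_(x in D) f x = \int[mu]_(x in D `&` A) f x)%E.
Proof.
move=> mD mfX f0; have mDA : measurable (D `&` A) by exact: measurableI.
have n0 : mrestr mu mA (~` A) = 0%E by rewrite /mrestr setICl measure0.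
have e := ge0_negligible_integral (measurableC mA) mD (measurable_funTS mfX)
  (fun x _ => f0 x) n0.
apply: (eq_trans e); rewrite setDE setCK; apply: eq_measure_integral => B mB BDA.
by rewrite /= /mrestr setIidl// => x /BDA[].
Qed.

Lemma integral_preimage mu (S : X -> X) D (f : X -> \bar R) :
  measure_preserving mu S -> measurable D -> measurable_fun [set: X] f ->
  (forall x, (0 <= f x)%E) ->
  (\int[mu]_(x in S @^-1` D) f (S x) = \int[mu]_(x in D) f x)%E.
Proof.
move=> [mS pS] mD mfX f0.
rewrite -(ge0_integral_pushforward mS mu mD (measurable_funTS mfX)); last by move=> x _.
by apply: eq_measure_integral => B mB _; rewrite /= /pushforward pS.
Qed.

Lemma measurable_iter mu (S : X -> X) k (f : X -> \bar R) : measure_preserving mu S ->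
  measurable_fun [set: X] f -> measurable_fun [set: X] (f \o iter k S).
Proof.
move=> Smp mfX; apply: measurableT_comp => // _ B mB; rewrite setTI.
exact: (mp_iter_measurable Smp).
Qed.

(** Summing a function along the excursions from [B] counts every point at
    most once (Kac). In the proof [V j] is the set of points that do not visit [B]
    at the times [1, ..., j]; the integrals over the [V j `&` B] are peeled off
    the integral over the whole space. *)
Lemma excursion_integral mu (S : X -> X) B (h c : X -> \bar R) :
  measure_preserving mu S -> measurable B ->
  measurable_fun [set: X] h -> (forall x, (0 <= h x)%E) ->
  measurable_fun [set: X] c -> (forall x, (0 <= c x)%E) ->
  (forall x, B x -> (c x <= \sum_(j < return_time S B x) h (iter j S x))%E) ->
  (\int[mu]_(x in B) c x <= \int[mu]_x h x)%E.
Proof.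
move=> Smp mB mh h0 mc c0 ch.
pose V j := \bigcap_(i in [set i | (0 < i <= j)%N]) ~` (iter i S @^-1` B).
pose g j := h \o iter j S.
have mg j : measurable_fun [set: X] (g j) := measurable_iter j Smp mh.
have g0 j x : (0 <= g j x)%E by exact: h0.
have mV j : measurable (V j).
  apply: (sa_bigcap_cond (@sa_measurable _ X)) => i _.
  exact/measurableC/(mp_iter_measurable Smp).
have VS n : V n.+1 = S @^-1` (V n `\` B).
  apply/seteqP; split => x.
    move=> Vx; split; last exact: (Vx 1%N).
    move=> i /= /andP[i0 ni]; rewrite /preimage/= -iterSr.
    by apply: (Vx i.+1) => /=; rewrite ltnS.
  move=> [Vx nB] [|[|i]] //= ni; rewrite /preimage/= -iterS iterSr.
  exact: (Vx i.+1).
have key n : (\sum_(j < n) \int[mu]_(x in V j `&` B) g j x + \int[mu]_(x in V n) g n x =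
              \int[mu]_x h x)%E.
  elim: n => [|n IH].
    rewrite big_ord0 add0e; congr integral; apply/seteqP; split => // x _ i /=.
    by case: i.
  rewrite big_ord_recr/= -addeA -[RHS]IH; congr (_ + _)%E.
  have -> : (\int[mu]_(x in V n.+1) g n.+1 x = \int[mu]_(x in V n `\` B) g n x)%E.
    rewrite -(integral_preimage Smp _ (mg n))//; last exact: measurableD.
    by rewrite VS; apply: eq_integral => x _; rewrite /g /= -iterS iterSr.
  rewrite -ge0_integral_setU//.
  - by rewrite setUIDK.
  - exact: measurableI.
  - exact: measurableD.
  - exact: measurable_funTS.
  - by apply/disj_set2P/seteqP; split => // x [[_ ?] []].
have mgV j : measurable_fun B (g j \_ (V j)).
  by apply: measurable_funTS; apply/(measurable_restrictT _ (mV j)).1/measurable_funTS.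
have gV0 j x : (0 <= (g j \_ (V j)) x)%E by apply: erestrict_ge0.
apply: (@le_trans _ _ (\int[mu]_(x in B) \sum_(j <oo) (g j \_ (V j)) x)%E).
  apply: ge0_le_integral => //; first exact: measurable_funTS.
    exact: ge0_emeasurable_sum.
  move=> x Bx; apply: (le_trans (ch x Bx)).
  apply: (@le_trans _ _ (\sum_(0 <= j < return_time S B x) (g j \_ (V j)) x)%E).
    rewrite big_mkord; apply: lee_sum => j _; rewrite /patch ifT//.
    apply/mem_set => i /= /andP[i0 ij] Bi.
    have hx : hits S B x by exists i.
    have [_ _ /(_ _ i0 Bi)] := return_timeP hx.
    by have := ltn_ord j; lia.
  exact: nneseries_lim_ge.
rewrite integral_nneseries//.
apply: lime_le; first by apply: is_cvg_nneseries => n _ _; apply: integral_ge0.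
apply: nearW => n; rewrite -(key n) big_mkord.
apply: (@le_trans _ _ (\sum_(j < n) \int[mu]_(x in V j `&` B) g j x)%E).
  apply: lee_sum => j _; rewrite -integral_mkcondr setIC//.
by rewrite leeDl// integral_ge0.
Qed.

End integrals.

(** * Predictable sets and their return times *)

Section determinism.
Context (d : measure_display) (X : measurableType d) (R : realType).
Variables (mu : {measure set X -> \bar R}) (S : X -> X).
Hypothesis Smp : measure_preserving mu S.
Implicit Types (A B H : set X) (G : set (set X)).

Let mSk k A : measurable A -> measurable (iter k S @^-1` A).
Proof. exact: (mp_iter_measurable Smp). Qed.

Lemma csub_preimage k K : is_sigma0 mu K ->
  is_sigma0 mu [set B | measurable B /\ K (iter k S @^-1` B)].
Proof.
move=> [sK Km nK]; split.
- have sP := sa_preimage (iter k S) sK; split => /=.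
  + by split; [exact: measurable0|exact: (sa0 sP)].
  + move=> A [mA KA]; rewrite setTD; split; first exact: measurableC.
    exact: (saC sP KA).
  + move=> F KF; split; first by apply: bigcupT_measurable => n; case: (KF n).
    by apply: (sa_bigcup sP) => n; case: (KF n).
- by move=> A [].
- move=> A [mA A0]; split => //; apply: nK; split; first exact: mSk.
  by rewrite (mp_iter_mu Smp).
Qed.

Lemma cg_preimage_stable k G K : is_sigma0 mu K -> G `<=` measurable ->
  (forall A, G A -> K (iter k S @^-1` A)) ->
  forall A, sigma0 mu G A -> K (iter k S @^-1` A).
Proof.
move=> cK Gm GK A GA.
have [] // : [set B | measurable B /\ K (iter k S @^-1` B)] A.
by apply: (cg_sub (csub_preimage k cK)) GA => B GB; split; [exact: Gm|exact: GK].
Qed.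

Lemma cg_preimage G B : G `<=` measurable ->
  sigma0 mu [set S @^-1` A | A in G] B ->
  exists2 H, sigma0 mu G H & mu (B `+` S @^-1` H) = 0%E.
Proof.
move=> Gm; rewrite -mod_nullP; last by move=> _ [A /Gm mA <-]; exact: (mSk 1).
move=> [mB [C GC BC]].
suff [H GH e] : exists2 H, <<s G >> H & C = S @^-1` H.
  exists H; last by rewrite -e.
  by move: H GH {e}; apply: sub_sigma_algebra2 => H; left.
have sG := smallest_sigma_algebra [set: X] G.
suff : <<s [set S @^-1` A | A in G] >> `<=` [set C | exists2 H, <<s G >> H & C = S @^-1` H].
  exact.
apply: smallest_sub.
- split => /=.
  + by exists set0; [exact: (sa0 sG)|rewrite preimage_set0].
  + move=> A [H GH ->]; exists (~` H); first exact: (saC sG).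
    by rewrite setTD preimage_setC.
  + move=> F FH; have /choice[H HP] n : exists H, <<s G >> H /\ F n = S @^-1` H.
      by have [H ? ?] := FH n; exists H.
    exists (\bigcup_n H n); first by apply: (sa_bigcup sG) => n; case: (HP n).
    by rewrite preimage_bigcup; apply: eq_bigcupr => n _; case: (HP n).
- by move=> _ [A GA <-]; exists A => //; apply: sub_gen_smallest.
Qed.

Lemma setY_null_trans A B C : measurable A -> measurable B -> measurable C ->
  mu (A `+` B) = 0%E -> mu (B `+` C) = 0%E -> mu (A `+` C) = 0%E.
Proof.
move=> mA mB mC AB BC; apply/eqP; rewrite eq_le measure_ge0 andbT -AB.
apply: (le_mu_null _ _ _ BC); try exact: measurableY.
move=> x [] [h1 h2]; have [Bx|nBx] := pselect (B x).
- by right; left.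
- by left; left.
- by left; right.
- by right; right.
Qed.

(** If the generators are determined by their strict future, then so is, at any
    distance [t], every set that they generate: the past is a function of the
    future. *)
Lemma deterministic G : G `<=` measurable ->
  (forall A, G A -> sigma0 mu [set S @^-1` A | A in G] A) ->
  forall t B, sigma0 mu G B ->
    exists2 H, sigma0 mu G H & mu (B `+` iter t S @^-1` H) = 0%E.
Proof.
move=> Gm Gf; have cG := csub_cg mu Gm; have [_ mcG _] := cG.
have mG1 : [set S @^-1` A | A in G] `<=` measurable.
  by move=> _ [A /Gm mA <-]; exact: (mSk 1).
elim=> [|t IH] B GB.
  by exists B => //; rewrite (_ : iter 0 S @^-1` B = B)// setYK measure0.
have [H GH BH] := IH B GB.
have [H' GH' HH'] := cg_preimage Gm (cg_sub (csub_cg mu mG1) Gf GH).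
have mB := mcG _ GB; have mH := mcG _ GH; have mH' := mcG _ GH'.
have mSH' := mSk 1 mH'.
exists H' => //; apply: (setY_null_trans mB (mSk t mH) (mSk t.+1 mH') BH).
have -> : iter t S @^-1` H `+` iter t.+1 S @^-1` H' =
          iter t S @^-1` (H `+` S @^-1` H') by [].
by rewrite (mp_iter_mu Smp)//; exact: measurableY.
Qed.

Definition iterates A := [set iter n S @^-1` A | n in [set: nat]].

Definition future_iterates A := [set iter n S @^-1` A | n in [set n | (0 < n)%N]].

Lemma iterates_measurable A : measurable A -> iterates A `<=` measurable.
Proof. by move=> mA _ [n _ <-]; exact: mSk. Qed.

Lemma future_iteratesE A : future_iterates A = [set S @^-1` B | B in iterates A].
Proof.
apply/seteqP; split => [_ [[//|n] _ <-]|_ [_ [n _ <-] <-]].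
  by exists (iter n S @^-1` A); [exists n|rewrite -iter_preimage].
by exists n.+1 => //; rewrite iter_preimage.
Qed.

Lemma predictable_future F : measurable F -> sigma0 mu (future_iterates F) F ->
  forall t, exists2 H, sigma0 mu (iterates F) H & mu (F `+` iter t S @^-1` H) = 0%E.
Proof.
move=> mF pF t; apply: (deterministic (iterates_measurable mF)).
  move=> _ [n _ <-]; rewrite -future_iteratesE; case: n => [|n]; first exact: pF.
  by apply: sub_cg; exists n.+1.
by apply: sub_cg; exists 0%N.
Qed.

End determinism.

Section zero_entropy_sets.
Context (d : measure_display) (X : measurableType d) (R : realType).
Implicit Types (mu : set X -> \bar R) (S : X -> X) (A B : set X).

(** This is convertible to [mrestr], and needs no proof that [A] is measurable. *)
Definition restr mu A : set X -> \bar R := fun B => mu (B `&` A).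

Definition zero_entropy_set mu S A : Prop := [/\ measurable A, (0 < mu A < +oo)%E &
  forall n, Pi (restr mu A) (induced_map S A) (return_time S A @^-1` [set n])].

End zero_entropy_sets.

(** The Pinsker sigma-algebra of the system induced on [A]; its members are
    subsets of the whole space, and only their traces on [A] matter. *)
Notation Pi_on mu S A := (Pi (restr mu A) (induced_map S A)).

Section one_system.
Context (d : measure_display) (X : measurableType d) (R : realType).
Variables (mu : {measure set X -> \bar R}) (S : X -> X).
Hypothesis sysS : sys mu S.
Implicit Types (A B D E F H P Q W : set X) (G K : set (set X)).

Let Smp : measure_preserving mu S. Proof. by case: sysS. Qed.

Let mSk k A : measurable A -> measurable (iter k S @^-1` A).
Proof. exact: (mp_iter_measurable Smp). Qed.

Lemma csub_PiA A : measurable A -> (0 < mu A)%E -> (mu A < +oo)%E ->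
  is_sigma0 (restr mu A) (Pi_on mu S A).
Proof.
move=> mA A0 Af; have [mp _ _] := sys_induced sysS mA A0 Af.
exact: (csub_Pi (rs_fin mA Af) mp).
Qed.

Lemma PiA_future A P k : measurable A -> (0 < mu A)%E -> (mu A < +oo)%E ->
  Pi_on mu S A P ->
  Pi_on mu S A (iter k (induced_map S A) @^-1` P).
Proof.
move=> mA A0 Af; have [mp _ _] := sys_induced sysS mA A0 Af.
exact: (Pi_future (rs_fin mA Af) mp).
Qed.

(** Identities of sets may be checked at the points of [A] outside a null set. *)
Lemma csub_goodA A K P Q N : measurable A -> is_sigma0 (restr mu A) K -> K Q ->
  measurable P -> measurable N -> mu N = 0%E ->
  (forall x, A x -> ~ N x -> P x <-> Q x) -> K P.
Proof.
move=> mA cK KQ mP mN N0 PQ.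
apply: (@csub_good _ _ _ (mrestr mu mA) K P Q (A `&` ~` N)) => //.
- by apply: measurableI => //; exact: measurableC.
- apply/eqP; rewrite eq_le measure_ge0 andbT -N0; apply: le_measure; rewrite ?inE//.
    apply: measurableI => //; apply: measurableC; apply: measurableI => //.
    exact: measurableC.
  by move=> x [h Ax]; apply: contrapT => nN; apply: h.
- by move=> x [Ax nN]; exact: PQ.
Qed.

Lemma sa_trace D K : measurable D -> sigma_algebra [set: X] K -> K D ->
  sigma_algebra [set: X] [set B | measurable B /\ K (B `&` D)].
Proof.
move=> mD sK KD; split => /=.
- by split; [exact: measurable0|rewrite set0I; exact: (sa0 sK)].
- move=> B [mB KB]; rewrite setTD; split; first exact: measurableC.
  have -> : ~` B `&` D = D `\` (B `&` D).
    apply/seteqP; split => x; first by move=> [nB Dx]; split => // -[].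
    by move=> [Dx h]; split => // Bx; apply: h.
  exact: (saD sK).
- move=> F KF; split; first by apply: bigcupT_measurable => n; case: (KF n).
  by rewrite setI_bigcupl; apply: (sa_bigcup sK) => n; case: (KF n).
Qed.

Lemma csub_trace A K : measurable A -> is_sigma0 mu K -> K A ->
  is_sigma0 (restr mu A) [set B | measurable B /\ K (B `&` A)].
Proof.
move=> mA [sK Km nK] KA; split; [exact: sa_trace|by move=> B []|].
by move=> B [mB B0]; split => //; apply: nK; split => //; exact: measurableI.
Qed.

(** A variant of the trace in the opposite direction: a sigma-algebra for the
    restricted measure is tested on sets of the whole space. *)
Lemma csub_cotrace D A K : measurable D -> measurable A -> D `<=` A ->
  is_sigma0 (restr mu A) K -> K D -> is_sigma0 mu [set B | measurable B /\ K (B `&` D)].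
Proof.
move=> mD mA DA [sK Km nK] KD; split; [exact: sa_trace|by move=> B []|].
move=> B [mB B0]; split => //; apply: nK; split; first exact: measurableI.
have [] // : null_sets mu (B `&` D `&` A).
apply: (null_setsP _ mB _ B0); last by move=> x [[]].
by apply: measurableI => //; exact: measurableI.
Qed.

(** A set whose return-time process has zero entropy is predictable: each level
    of the return time is determined by the point of return, so the points of
    [A] that return at time [s] lie in [iter s S @^-1` (Q s `&` A)] for a set [Q s]
    generated by the iterates of [A]. The two sets have the same measure because
    [S] and the induced map preserve it, hence they agree, and [A] is the union
    over [s > 0]. *)
Lemma zero_entropy_predictable A : zero_entropy_set mu S A -> sigma0 mu (future_iterates S A) A.
Proof.
move=> [mA /andP[A0 Af] ZA].
have mio := measurable_io sysS mA; have io0 := io_full sysS mA A0.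
have [nmp _ _] := sys_induced sysS mA A0 Af.
pose L n := return_time S A @^-1` [set n].
have mL n : measurable (L n) by exact: (measurable_return_time sysS).
pose G := [set B | exists k n, B = iter k (induced_map S A) @^-1` L n].
have Gm : G `<=` measurable.
  by move=> _ [k [n ->]]; exact: (mp_iter_measurable nmp).
have cO := csub_cg mu (iterates_measurable Smp mA).
have [sO mO nO] := cO; have OA : sigma0 mu (iterates S A) A by apply: sub_cg; exists 0%N.
have OS B k : sigma0 mu (iterates S A) B -> sigma0 mu (iterates S A) (iter k S @^-1` B).
  apply: (cg_preimage_stable Smp cO (iterates_measurable Smp mA)) => _ [n _ <-].
  apply: sub_cg; exists (n + k)%N => //.
  by apply/funext => x; rewrite /preimage/= iterD.
have OL n : sigma0 mu (iterates S A) (L n).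
  by apply: (sa_return_time sO) => k _; exact: OS.
have OI B : sigma0 mu (iterates S A) B -> sigma0 mu (iterates S A) (induced_map S A @^-1` B).
  by move=> OB; apply: (sa_induced sO) => // n; exact: OS.
have GO B : sigma0 (restr mu A) G B -> sigma0 mu (iterates S A) (B `&` A).
  move=> GB; have [] // := cg_sub (csub_trace mA cO OA) _ GB.
  move=> C GC; split; first exact: Gm.
  apply: (saI sO) => //; case: GC => k [n ->].
  elim: k => [|k IH]; [exact: OL|rewrite iter_preimage; exact: OI].
have /choice[Q HQ] s : exists Q, sigma0 (restr mu A) G Q /\
    restr mu A (L s `+` induced_map S A @^-1` Q) = 0%E.
  have [|H GH h] := deterministic nmp Gm _ 1 (sub_cg (ex_intro _ 0%N (ex_intro _ s erefl)) : sigma0 (restr mu A) G (L s)).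
    move=> _ [[|k] [n ->]]; last first.
      by apply: sub_cg; exists (iter k (induced_map S A) @^-1` L n); [exists k, n|rewrite -iter_preimage].
    have [_] := ZA n; apply: cg_mono => _ [[//|k] _ <-].
    by exists (iter k (induced_map S A) @^-1` L n); [exists k, n|rewrite -iter_preimage].
  by exists H.
have OQ s : sigma0 mu (iterates S A) (Q s `&` A) by apply: GO; case: (HQ s).
have mQA s : measurable (Q s `&` A) by exact: mO.
have mQ s : measurable (Q s).
  have [_ + _] := csub_cg (restr mu A) Gm; by apply; case: (HQ s).
have mIQ s : measurable (induced_map S A @^-1` Q s) by exact: (measurable_induced sysS).
pose N1 s := (L s `+` induced_map S A @^-1` Q s) `&` A.
have mN1 s : measurable (N1 s) by apply: measurableI => //; exact: measurableY.
have N10 s : mu (N1 s) = 0%E by case: (HQ s).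
pose P s := iter s S @^-1` (Q s `&` A).
have mP s : measurable (P s) by exact: mSk.
have mLA s : measurable (L s `&` A) by exact: measurableI.
have LP s : (0 < s)%N -> L s `&` A `<=` P s `|` N1 s.
  move=> s0 x [Ls Ax]; have hx : hits S A x.
    by apply: return_time_gt0; rewrite Ls.
  have [xQ|xQ] := pselect (Q s (induced_map S A x)); last by right; split => //; left.
  left; have := induced_hit hx; move: xQ; rewrite /induced_map Ls; by split.
have muP s : mu (P s) = mu (L s `&` A).
  rewrite (mp_iter_mu Smp)// -(induced_mu sysS mA A0 Af (mQ s)).
  have h := mN1 s; apply/eqP; rewrite eq_le; apply/andP; split.
    apply: (le_mu_null _ (mLA s) h (N10 s)); first exact: measurableI.
    move=> x [xQ Ax]; have [xL|xL] := pselect (L s x); first by left.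
    by right; split => //; right.
  apply: (le_mu_null _ _ h (N10 s)) => //; first exact: measurableI.
  move=> x [xL Ax]; have [xQ|xQ] := pselect ((induced_map S A @^-1` Q s) x); first by left.
  by right; split => //; left.
pose N2 s := if s is 0%N then set0 else P s `\` (L s `&` A).
have mN2 s : measurable (N2 s) by case: s => [|s]; [exact: measurable0|exact: measurableD].
have N20 s : mu (N2 s) = 0%E.
  case: s => [|s]; first exact: measure0.
  have LPfin : (mu (L s.+1 `&` A) < +oo)%E.
    apply: le_lt_trans Af; apply: le_measure; rewrite ?inE//.
  have LPI : mu (P s.+1 `&` (L s.+1 `&` A)) = mu (L s.+1 `&` A).
    have mI : measurable (P s.+1 `&` (L s.+1 `&` A)) by exact: measurableI.
    apply/eqP; rewrite eq_le; apply/andP; split.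
      by apply: le_measure; rewrite ?inE.
    apply: (le_mu_null _ mI (mN1 s.+1) (N10 _)) => // x xLA.
    by have [|?] := LP s.+1 isT x xLA; [left|right].
  have Pfin : (mu (P s.+1) < +oo)%E by rewrite muP.
  have e : mu (N2 s.+1) = (mu (P s.+1) - mu (P s.+1 `&` (L s.+1 `&` A)))%E.
    exact: measureD.
  by rewrite e LPI muP subee// ge0_fin_numE.
have mfut : future_iterates S A `<=` measurable by move=> _ [k _ <-]; exact: mSk.
have cF := csub_cg mu mfut; have [sF _ _] := cF.
have mU1 : measurable (\bigcup_s N1 s) by exact: bigcupT_measurable.
have mU2 : measurable (\bigcup_s N2 s) by exact: bigcupT_measurable.
pose W := [set x | io S A x] `\` (\bigcup_s N1 s `|` \bigcup_s N2 s).
have mU : measurable (\bigcup_s N1 s `|` \bigcup_s N2 s) by exact: measurableU.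
have mW : measurable W by exact: measurableD.
have W0 : mu (~` W) = 0%E.
  apply/eqP; rewrite eq_le measure_ge0 andbT -io0.
  have U10 := null_bigcup mN1 N10; have U20 := null_bigcup mN2 N20.
  have mio' := measurableC mio.
  apply: (@le_trans _ _ (mu (~` [set x | io S A x] `|` \bigcup_s N1 s))).
    apply: (le_mu_null (measurableC mW) (measurableU _ _ mio' mU1) mU2 U20).
    move=> x nW; apply: contrapT => h; apply: nW; split.
      by apply: contrapT => nio; apply: h; left; left.
    by move=> [?|?]; apply: h; [left; right|right].
  exact: (le_mu_null (measurableU _ _ mio' mU1) mio' mU1 U10).
apply: (@csub_good _ _ _ mu _ A (\bigcup_(s in [set s | (0 < s)%N]) P s) W) => //.
  apply: (sa_bigcup_cond sF) => -[//|s] _.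
  apply: (cg_preimage_stable Smp cF (iterates_measurable Smp mA) _ (OQ s.+1)).
  move=> _ [n _ <-]; apply: sub_cg; exists (n + s.+1)%N; first by rewrite /= addnS.
  by apply/funext => x; exact: (congr1 A (iterD n s.+1 S x)).
move=> x [iox nU]; split=> [Ax|[s /= s0 Px]].
  have [r0 _ _] := return_timeP (io_hits iox).
  exists (return_time S A x) => //.
  have [//|h] := LP _ r0 x (conj erefl Ax).
  by case: nU; left; exists (return_time S A x).
apply: contrapT => nA; apply: nU; right; exists s => //.
by case: s s0 Px => // s _ Px; split => // -[].
Qed.

End one_system.

(** * Strings of return times *)

Section strings.
Variable R : realType.
Implicit Types (w : seq nat) (n : nat).

(** The weights telescope to a total of [1/2], and [- ln (weight n)] is of the order
    of [2 * ln n]. *)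
Definition weight n : R := (2 * n.+1%:R * n.+2%:R)^-1.

Lemma weight_gt0 n : 0 < weight n.
Proof. by rewrite invr_gt0 !mulr_gt0// ltr0n. Qed.

Lemma weight_le1 n : weight n <= 1.
Proof.
rewrite invf_le1 ?mulr_gt0 ?ltr0n//.
have : 1 <= n.+1%:R :> R by rewrite ler1n.
have : 1 <= n.+2%:R :> R by rewrite ler1n.
nra.
Qed.

Lemma sum_weight n : \sum_(k < n) weight k <= 1 / 2.
Proof.
have -> : \sum_(k < n) weight k = 1 / 2 - (2 * n.+1%:R)^-1.
  elim: n => [|n IH]; first by rewrite big_ord0; field.
  rewrite big_ord_recr/= IH /weight -[n.+2%:R]natr1 -[n.+1%:R]natr1.
  have : 0 <= n%:R :> R by [].
  by move: (n%:R : R) => x x0; field; apply/andP; split; lra.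
by rewrite gerBl invr_ge0 mulr_ge0// ler0n.
Qed.

Definition string_weight w : R := \prod_(n <- w) weight n.

Lemma wt_gt0 w : 0 < string_weight w.
Proof. by rewrite /string_weight; elim/big_ind : _ => // [x y|n _]; [exact: mulr_gt0|exact: weight_gt0]. Qed.

Lemma wt_le1 w : string_weight w <= 1.
Proof.
elim: w => [|n w IH]; first by rewrite /string_weight big_nil.
rewrite /string_weight big_cons -/(string_weight w) -[leRHS]mulr1; apply: ler_pM => //.
- exact/ltW/weight_gt0.
- exact/ltW/wt_gt0.
- exact: weight_le1.
Qed.

(** Kraft's inequality: the letters have total weight at most [1/2], so the sum
    over the strings is bounded by the series [1 + 1/2 + 1/4 + ...]. *)
Lemma kraft (L : seq (seq nat)) : uniq L -> \sum_(w <- L) string_weight w <= 2.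
Proof.
have [k hk] : exists k, all (fun w => size w < k)%N L.
  exists (\max_(w <- L) size w).+1; apply/allP => w wL; rewrite ltnS.
  exact: leq_bigmax_seq.
elim: k L hk => [|k IH] L hk uL.
  by case: L hk {uL} => [|//]; rewrite big_nil.
rewrite (bigID (pred1 [::]))/=.
have h1 : \sum_(w <- L | w == [::]) string_weight w <= 1.
  rewrite -big_filter (eq_big_seq (fun=> 1)); last first.
    by move=> w; rewrite mem_filter => /andP[/eqP -> _]; rewrite /string_weight big_nil.
  rewrite big_const_seq count_predT iter_addr_0 size_filter.
  rewrite (eq_count (a2 := pred1 [::]))// count_uniq_mem//.
  by case: (_ \in _); rewrite ?mulr0n ?ler01.
pose M := (\max_(w <- L) head 0%N w).+1.
have hM w : w \in L -> (head 0%N w < M)%N.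
  by move=> wL; rewrite ltnS; apply: (@leq_bigmax_seq _ _ _ (head 0%N)).
have h2 : \sum_(w <- L | w != [::]) string_weight w <= 1.
  rewrite (partition_big (fun w => inord (head 0%N w) : 'I_M) xpredT)//=.
  apply: (@le_trans _ _ (\sum_(n < M) weight n * 2)); last first.
    by rewrite -mulr_suml; have := sum_weight M; lra.
  apply: ler_sum => n _.
  pose Ln := [seq w <- L | (w != [::]) && (inord (head 0%N w) == n)].
  have hLn w : w \in Ln -> w = (n : nat) :: behead w.
    rewrite mem_filter => /andP[/andP[w0 /eqP wn] wL].
    case: w w0 wn wL => // a w _ <- wL; rewrite /= inordK//.
    exact: (hM _ wL).
  rewrite -big_filter -/Ln.
  rewrite (eq_big_seq (fun w => weight n * string_weight (behead w))); last first.
    by move=> w /hLn ->; rewrite /string_weight big_cons.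
  rewrite -mulr_sumr ler_pM2l ?weight_gt0//.
  rewrite -(big_map behead xpredT string_weight); apply: IH.
    apply/allP => _ /mapP[w wL ->]; have := wL.
    rewrite mem_filter => /andP[_ /(allP hk)].
    by rewrite (hLn w wL).
  rewrite map_inj_in_uniq ?filter_uniq// => w w' /hLn e /hLn e' ee.
  by rewrite e e' ee.
by apply: (le_trans (lerD h1 h2)); lra.
Qed.

Definition partial_sum w j := j \in [seq sumn (take k w) | k <- iota 0 (size w).+1].

Lemma psP w j : reflect (exists2 k, (k <= size w)%N & j = sumn (take k w)) (partial_sum w j).
Proof.
apply: (iffP mapP) => -[k]; first by rewrite mem_iota => /andP[_ h] ->; exists k.
by move=> kw ->; exists k => //; rewrite mem_iota.
Qed.

Lemma ps0 w : partial_sum w 0.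
Proof. by apply/psP; exists 0%N; rewrite ?take0. Qed.

Lemma ps_cons a w j : partial_sum (a :: w) (a + j)%N = partial_sum w j || ((a + j)%N == 0%N).
Proof.
apply/psP/orP => [[[|k] kw e]|[/psP[k kw ->]|/eqP e]].
- by right; rewrite e.
- by left; apply/psP; exists k => //; move: e => /= /addnI.
- by exists k.+1.
- by exists 0%N; rewrite // e.
Qed.

Lemma ps_small a w j : (0 < j < a)%N -> ~~ partial_sum (a :: w) j.
Proof.
move=> /andP[j0 ja]; apply/psP => -[[|k] kw e]; first by rewrite e in j0.
by move: e ja => /= ->; rewrite ltnNge leq_addr.
Qed.

(** A string of positive integers is recovered from its partial sums. *)
Lemma ps_inj w w' : all (leq 1) w -> all (leq 1) w' -> sumn w = sumn w' ->
  (forall j, (j < sumn w)%N -> partial_sum w j = partial_sum w' j) -> w = w'.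
Proof.
elim: w w' => [|a w IH] [|b w']//=.
- by move=> _ /andP[b0 _] e; exfalso; lia.
- by move=> /andP[a0 _] _ e; exfalso; lia.
move=> /andP[a0 wp] /andP[b0 wp'] e h.
have ab : a = b.
  case: (ltngtP a b) => // ab.
    have := h a; rewrite (negbTE (@ps_small b w' a _)); last by rewrite a0.
    rewrite -[a in partial_sum _ a]addn0 ps_cons ps0/= => hh.
    suff : (a < a + sumn w)%N by move=> /hh.
    by rewrite e; lia.
  have := h b; rewrite (negbTE (@ps_small a w b _)); last by rewrite b0.
  rewrite -[b in partial_sum _ b]addn0 ps_cons ps0/= => hh.
  suff : (b < a + sumn w)%N by move=> /hh.
  by lia.
rewrite -ab in e h *; congr (_ :: _); apply: IH => //; first lia.
move=> j jw; have := h (a + j)%N; rewrite ltn_add2l jw => /(_ isT).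
rewrite !ps_cons; have -> : ((a + j)%N == 0%N) = false by apply/eqP; lia.
by rewrite !orbF.
Qed.

End strings.

(** * Excursions from a predictable set *)

Section excursions.
Context (d : measure_display) (X : measurableType d) (R : realType).
Variables (mu : {measure set X -> \bar R}) (S : X -> X).
Hypothesis sysS : sys mu S.

Let Smp : measure_preserving mu S. Proof. by case: sysS. Qed.

Let mSk k (A : set X) : measurable A -> measurable (iter k S @^-1` A).
Proof. exact: (mp_iter_measurable Smp). Qed.

Variables (F A : set X).
Hypotheses (mF : measurable F) (F0 : (0 < mu F)%E) (Ffin : (mu F < +oo)%E).
Hypotheses (mA : measurable A) (A0 : (0 < mu A)%E) (Afin : (mu A < +oo)%E).

Local Notation D := (A `&` F).
Hypothesis D0 : (0 < mu D)%E.

Local Notation TF := (induced_map S F).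
Local Notation TA := (induced_map S A).
Local Notation nu := (restr mu A).

Let mD : measurable D. Proof. exact: measurableI. Qed.
Let sysF : sys (mrestr mu mF) TF. Proof. exact: sys_induced. Qed.
Let sysA : sys (mrestr mu mA) TA. Proof. exact: sys_induced. Qed.
Let mpF : measure_preserving (mrestr mu mF) TF. Proof. by case: sysF. Qed.
Let mpA : measure_preserving (mrestr mu mA) TA. Proof. by case: sysA. Qed.

Definition gaps x :=
  [seq return_time S F (iter k TF x) | k <- iota 0 (return_time TF D x)].

(** The excursion is coded by a natural number, so that it defines a countable
    partition. At almost every point of [D] the string is not empty; the empty string
    marks the complement of [D]. *)
Definition excursion x : nat := CodeSeq.code (if x \in D then gaps x else [::]).

Lemma sumn_gaps x k : (k <= return_time TF D x)%N ->
  sumn (take k (gaps x)) = (\sum_(i < k) return_time S F (iter i TF x))%N.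
Proof.
move=> kl; rewrite -map_take take_iota (minn_idPl kl) sumnE big_map.
by rewrite -[in iota 0 k](subn0 k) big_mkord.
Qed.

Lemma size_gaps x : size (gaps x) = return_time TF D x.
Proof. by rewrite size_map size_iota. Qed.

(** The visits to [F] before the next visit to [D] are the partial sums of the
    gaps. *)
Lemma gapsP x : D x -> io S D x ->
  [/\ all (leq 1) (gaps x), sumn (gaps x) = return_time S D x,
      (0 < sumn (gaps x))%N &
      forall j, (j < sumn (gaps x))%N -> F (iter j S x) <-> partial_sum (gaps x) j].
Proof.
move=> [Ax Fx] ioD; have DF : D `<=` F by move=> y [].
have ioF := io_sub DF ioD.
have esum : sumn (gaps x) = return_time S D x.
  by rewrite -[gaps x]take_size size_gaps sumn_gaps// (nested_return_time DF ioD).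
have [r0 _ _] := return_timeP (io_hits ioD).
split; rewrite ?esum//.
  apply/allP => _ /mapP[k _ ->].
  by have [] := return_timeP (io_hits (io_iter_induced F k ioF)).
move=> j jt; split => [Fj|/psP[k kw ->]].
  case: j jt Fj => [_ _|j jt Fj]; first exact: ps0.
  have [k [k0 e]] := visit_time ioF (ltn0Sn j) Fj.
  have kl : (k <= return_time TF D x)%N.
    rewrite leqNgt; apply/negP => lk; have := visit_time_mono ioF lk.
    rewrite -(nested_return_time DF ioD) -e => h.
    by move: (ltn_trans jt h); rewrite ltnn.
  by apply/psP; exists k; rewrite ?size_gaps// sumn_gaps.
rewrite size_gaps in kw; rewrite sumn_gaps// -iter_induced.
case: k kw => [//|k] _; rewrite iterS; apply: induced_hit.
by apply: io_hits; exact: io_iter_induced.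
Qed.

(** An excursion is recognised from its length and from its visits to [F]. *)
Lemma gaps_eq x w : D x -> io S D x -> all (leq 1) w ->
  return_time S D x = sumn w ->
  (forall j, (j < sumn w)%N -> F (iter j S x) <-> partial_sum w j) -> gaps x = w.
Proof.
move=> Dx ioD wp e h; have [gp eg _ hg] := gapsP Dx ioD.
apply: ps_inj => //; first by rewrite eg.
move=> j js; apply/idP/idP => [/(hg j js)/(h j)|/(h j)]; first by apply; rewrite -e -eg.
by move=> hj; apply/(hg j js)/hj; rewrite -e -eg.
Qed.

Lemma excursion_in x : D x -> excursion x = CodeSeq.code (gaps x).
Proof. by move=> Dx; rewrite /excursion mem_set. Qed.

Lemma excursion_notin x : ~ D x -> excursion x = CodeSeq.code [::].
Proof. by move=> Dx; rewrite /excursion memNset. Qed.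

Lemma code_inj : injective CodeSeq.code.
Proof. exact: can_inj CodeSeq.codeK. Qed.

Lemma measurable_excursion v : measurable (excursion @^-1` [set v]).
Proof.
pose w := CodeSeq.decode v; have vw : v = CodeSeq.code w by rewrite CodeSeq.decodeK.
pose B := (return_time TF D @^-1` [set size w]) `&`
  \bigcap_(k in [set k | (k < size w)%N])
    iter k TF @^-1` (return_time S F @^-1` [set nth 0%N w k]).
have mB : measurable B.
  apply: measurableI; first exact: (measurable_return_time sysF).
  apply: (sa_bigcap_cond (@sa_measurable _ X)) => k _.
  exact/(mp_iter_measurable mpF)/(measurable_return_time sysS).
have Bw x : B x <-> gaps x = w.
  split => [[/= e h]|e].
    apply: (@eq_from_nth _ 0%N); first by rewrite size_gaps.
    move=> i; rewrite size_gaps => il; rewrite (nth_map 0%N) ?size_iota// nth_iota//.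
    by apply: h; rewrite /= -e.
  split => /=; first by rewrite -e size_gaps.
  move=> k /=; rewrite -e size_gaps => kl.
  by rewrite (nth_map 0%N) ?size_iota// nth_iota.
rewrite vw (_ : _ @^-1` _ = (D `&` B) `|` [set x | w = [::] /\ (~` D) x]).
  apply: measurableU; first exact: measurableI.
  by apply: (sa_imply (@sa_measurable _ X)); exact: measurableC.
apply/seteqP; split => x /=.
  have [Dx|nDx] := pselect (D x).
    by rewrite excursion_in// => /code_inj/Bw; left.
  by rewrite excursion_notin// => /code_inj; right.
by case=> [[Dx /Bw <-]|[-> nDx]]; [exact: excursion_in|exact: excursion_notin].
Qed.

Definition cost n : R := - ln (weight R n).

Lemma cost_ge0 n : 0 <= cost n.
Proof. by rewrite oppr_ge0 ln_le0// weight_le1. Qed.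

(** This is what makes the cost integrable when the logarithm is. *)
Lemma cost_le n : cost n <= ln 12 + 2 * ln n%:R.
Proof.
rewrite /cost /weight -lnV ?posrE ?invr_gt0 ?mulr_gt0 ?ltr0n// invrK.
case: n => [|n]; first by rewrite (ln0 (lexx _)) mulr0 addr0 ler_ln ?posrE; lra.
have n1 : 1 <= n.+1%:R :> R by rewrite ler1n.
rewrite [X in _ + X]mulr_natl -lnXn ?ltr0n// -lnM ?posrE ?exprn_gt0 ?ltr0n//.
rewrite ler_ln ?posrE ?mulr_gt0 ?exprn_gt0 ?ltr0n// -[n.+3%:R]natr1 -[n.+2%:R]natr1.
nra.
Qed.

Lemma cost_wt w : - ln (string_weight R w) = \sum_(n <- w) cost n.
Proof.
elim: w => [|n w IH]; first by rewrite /string_weight !big_nil ln1 oppr0.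
rewrite /string_weight !big_cons lnM ?posrE ?weight_gt0//; last exact: wt_gt0.
by rewrite opprD -IH.
Qed.

Hypothesis logF : (\int[mu]_(x in F) (ln (return_time S F x)%:R)%:E < +oo)%E.

Lemma measurable_return_comp (g : nat -> R) :
  measurable_fun [set: X] (EFin \o (g \o return_time S F)).
Proof.
apply: measurable_nat_comp => // v; exact: (measurable_return_time sysS).
Qed.

Lemma integral_cost : (\int[mu]_(x in F) (cost (return_time S F x))%:E < +oo)%E.
Proof.
apply: (@le_lt_trans _ _ (\int[mu]_(x in F) ((ln 12 : R)%:E + 2%:E * (ln (return_time S F x)%:R)%:E))%E).
  apply: ge0_le_integral => //.
  - by move=> x _; rewrite lee_fin cost_ge0.
  - exact/measurable_funTS/(measurable_return_comp cost).
  - exact/measurable_funTS/(measurable_return_comp (fun n => ln 12 + 2 * ln n%:R)).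
  - by move=> x _; rewrite -EFinM -EFinD lee_fin cost_le.
have ln_ge0n (n : nat) : (0 <= (ln n%:R : R)%:E)%E.
  rewrite lee_fin; case: n => [|n]; first by rewrite ln0.
  by rewrite ln_ge0// ler1n.
have mln := measurable_funTS (measurable_return_comp (fun n => ln n%:R)) : measurable_fun F _.
rewrite ge0_integralD//.
- rewrite integral_cst// ge0_integralZl//.
  + rewrite lte_add_pinfty//; first by rewrite lte_mul_pinfty// lee_fin ln_ge0//; lra.
    by rewrite lte_mul_pinfty.
- by move=> x _; rewrite mule_ge0.
- exact/measurable_funTS/(measurable_return_comp (fun n => 2 * ln n%:R)).
Qed.

(** The code length of an excursion is the sum of the costs of its gaps; by Kac's
    argument in the system induced on [F], its integral is at most the integral
    over [F] of the cost of the return time. *)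
Lemma excursion_entropy : exists K : R, forall N, entropy (mrestr mu mA) (truncated excursion N) <= K.
Proof.
apply: (gibbs (rs_fin mA Afin) measurable_excursion (p := string_weight R \o CodeSeq.decode) (C := 2)).
- by move=> v; rewrite wt_gt0 wt_le1.
- move=> N; rewrite -(big_mkord xpredT (string_weight R \o CodeSeq.decode)) -(big_map CodeSeq.decode xpredT (string_weight R)).
  apply: kraft; rewrite map_inj_uniq ?iota_uniq//; exact: can_inj CodeSeq.decodeK.
pose c x : \bar R := (- ln ((string_weight R \o CodeSeq.decode) (excursion x)))%:E.
have mc : measurable_fun [set: X] c.
  exact: (measurable_nat_comp measurable_excursion (fun v => - ln (string_weight R (CodeSeq.decode v)))).
have c0 x : (0 <= c x)%E by rewrite lee_fin oppr_ge0 ln_le0//= wt_le1.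
have cD x : ~ D x -> c x = 0%E.
  by move=> nD; rewrite /c (excursion_notin nD) /comp CodeSeq.codeK cost_wt big_nil.
rewrite -/c integral_mrestr// setTI.
have -> : (\int[mu]_(x in A) c x = \int[mrestr mu mF]_(x in D) c x)%E.
  rewrite integral_mrestr// -setIA setIid integral_mkcondr.
  apply: eq_integral => x /set_mem Ax; rewrite /patch.
  by case: ifPn => // /negP nF; apply: cD => -[_ /mem_set].
apply: le_lt_trans integral_cost.
pose h x : \bar R := (cost (return_time S F x))%:E.
have mh : measurable_fun [set: X] h by exact: (measurable_return_comp cost).
have h0 x : (0 <= h x)%E by rewrite lee_fin cost_ge0.
have -> : (\int[mu]_(x in F) h x = \int[mrestr mu mF]_x h x)%E.
  by rewrite integral_mrestr// setTI.
apply: (excursion_integral mpF mD mh h0 mc c0) => x Dx.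
rewrite /c (excursion_in Dx) /comp CodeSeq.codeK cost_wt /gaps big_map.
by rewrite -[X in iota 0 X]subn0 big_mkord sumEFin.
Qed.

End excursions.

Section predictable_excursions.
Context (d : measure_display) (X : measurableType d) (R : realType).
Variables (mu : {measure set X -> \bar R}) (S : X -> X).
Hypothesis sysS : sys mu S.

Let Smp : measure_preserving mu S. Proof. by case: sysS. Qed.

Let mSk k (A : set X) : measurable A -> measurable (iter k S @^-1` A).
Proof. exact: (mp_iter_measurable Smp). Qed.

Lemma sa_sum (K : set (set X)) (g : nat -> X -> nat) k t :
  sigma_algebra [set: X] K -> (forall i n, K (g i @^-1` [set n])) ->
  K [set x | (\sum_(i < k) g i x)%N = t].
Proof.
move=> sK Kg; elim: k t => [|k IH] t.
  have [->|t0] := eqVneq t 0%N.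
    rewrite (_ : mkset _ = [set: X]); first exact: (saT sK).
    by apply/seteqP; split => // x _ /=; rewrite big_ord0.
  rewrite (_ : mkset _ = set0); first exact: (sa0 sK).
  by apply/seteqP; split => // x /=; rewrite big_ord0 => e; rewrite -e in t0.
rewrite (_ : mkset _ = \bigcup_(a in [set a | (a <= t)%N])
   ([set x | (\sum_(i < k) g i x)%N = a] `&` (g k @^-1` [set (t - a)%N]))).
  by apply: (sa_bigcup_cond sK) => a _; apply: (saI sK).
apply/seteqP; split => x /=.
  rewrite big_ord_recr/= => <-; exists (\sum_(i < k) g i x)%N => /=; first exact: leq_addr.
  by rewrite addKn.
by case=> a /= at_ [e1 e2]; rewrite big_ord_recr/= e1 e2 subnKC.
Qed.

(** The time of return to [D] is read off the returns to a larger set [A]. *)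
Lemma sa_nested_return A D (K : set (set X)) t : measurable A -> measurable D ->
  D `<=` A -> (0 < mu D)%E -> is_sigma0 (restr mu A) K ->
  (forall k, (0 < k)%N -> K (iter k (induced_map S A) @^-1` D)) ->
  (forall k n, K (iter k (induced_map S A) @^-1` (return_time S A @^-1` [set n]))) ->
  K (return_time S D @^-1` [set t]).
Proof.
move=> mA mD DA D0 cK KD Kr; have [sK mK _] := cK.
have mio := measurable_io sysS mD; have io0 := io_full sysS mD D0.
have KrD k : K (return_time (induced_map S A) D @^-1` [set k]) by exact: sa_return_time.
apply: (csub_goodA mA cK (Q := \bigcup_k (return_time (induced_map S A) D @^-1` [set k] `&`
    [set x | (\sum_(i < k) return_time S A (iter i (induced_map S A) x))%N = t]))
    (N := ~` [set x | io S D x])) => //.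
- apply: (sa_bigcup sK) => k; apply: (saI sK) => //.
  exact: (sa_sum _ _ sK (fun i n => Kr i n)).
- exact: (measurable_return_time sysS).
- exact: measurableC.
move=> x Ax /contrapT iox /=; rewrite (nested_return_time DA iox).
split; first by move=> e; exists (return_time (induced_map S A) D x).
by case=> k _ [/= <-].
Qed.

Variables (F A : set X).
Hypotheses (mF : measurable F) (F0 : (0 < mu F)%E) (Ffin : (mu F < +oo)%E).
Hypotheses (mA : measurable A) (A0 : (0 < mu A)%E) (Afin : (mu A < +oo)%E).

Local Notation D := (A `&` F).
Hypothesis D0 : (0 < mu D)%E.

Local Notation TA := (induced_map S A).
Local Notation nu := (restr mu A).
Local Notation Xi v := (excursion S F A @^-1` [set v]).

Let mD : measurable D. Proof. exact: measurableI. Qed.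
Let sysA : sys (mrestr mu mA) TA. Proof. exact: sys_induced. Qed.
Let mpA : measure_preserving (mrestr mu mA) TA. Proof. by case: sysA. Qed.
Let mXi v : measurable (Xi v). Proof. exact: (measurable_excursion sysS). Qed.
Let DA : D `<=` A. Proof. by move=> x []. Qed.

Definition excursion_orbit : set (set X) :=
  [set B | exists k v, B = iter k TA @^-1` (Xi v)].

Definition excursion_future : set (set X) :=
  [set B | exists k v, (0 < k)%N /\ B = iter k TA @^-1` (Xi v)] `|` Pi nu TA.

Let Wm : excursion_orbit `<=` measurable.
Proof. by move=> _ [k [v ->]]; exact: (mp_iter_measurable mpA). Qed.

Let Gm : excursion_future `<=` measurable.
Proof. by move=> _ [[k [v [_ ->]]]|[]//]; exact: (mp_iter_measurable mpA). Qed.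

Let cW : is_sigma0 nu (sigma0 nu excursion_orbit). Proof. exact: csub_cg. Qed.
Let cG : is_sigma0 nu (sigma0 nu excursion_future). Proof. exact: csub_cg. Qed.

Let W_TA k B : sigma0 nu excursion_orbit B -> sigma0 nu excursion_orbit (iter k TA @^-1` B).
Proof.
apply: (cg_preimage_stable mpA cW Wm) => _ [l [v ->]].
apply: sub_cg; exists (l + k)%N, v.
by apply/funext => x; rewrite /preimage/= iterD.
Qed.

Let W_G k B : (0 < k)%N -> sigma0 nu excursion_orbit B ->
  sigma0 nu excursion_future (iter k TA @^-1` B).
Proof.
move=> k0; apply: (cg_preimage_stable mpA cG Wm) => _ [l [v ->]].
apply: sub_cg; left; exists (l + k)%N, v; split; first by rewrite addn_gt0 k0 orbT.
by apply/funext => x; rewrite /preimage/= iterD.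
Qed.

Let W_D : sigma0 nu excursion_orbit D.
Proof.
have [sW _ _] := cW.
apply: (csub_goodA mA cW (Q := ~` (Xi (CodeSeq.code [::]))) (N := ~` [set x | io S D x])) => //.
- by apply: (saC sW); apply: sub_cg; exists 0%N, (CodeSeq.code [::]).
- exact/measurableC/(measurable_io sysS).
- exact: (io_full sysS).
move=> x Ax /contrapT iox; split => [Dx|]; last first.
  by move=> /= h; apply: contrapT => nD; apply: h; exact: excursion_notin.
rewrite /setC/mkset/preimage/set1/mkset (excursion_in S Dx) => /code_inj e.
by have [_ _] := gapsP Dx iox; rewrite e.
Qed.

(* Sets determined by the next point of [D]. *)
Let next_D (K : set (set X)) B : is_sigma0 nu K ->
  (forall k, (0 < k)%N -> K (iter k TA @^-1` D)) ->
  (forall k, (0 < k)%N -> K (iter k TA @^-1` B)) -> measurable B ->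
  K (induced_map S D @^-1` B).
Proof.
move=> cK KD KB mB; have [sK _ _] := cK.
apply: (csub_goodA mA cK (Q := \bigcup_(k in [set k | (0 < k)%N])
   (return_time TA D @^-1` [set k] `&` iter k TA @^-1` B)) (N := ~` [set x | io S D x])) => //.
- apply: (sa_bigcup_cond sK) => k k0; apply: (saI sK); last exact: KB.
  exact: sa_return_time.
- exact: (measurable_induced sysS).
- exact/measurableC/(measurable_io sysS).
- exact: (io_full sysS).
move=> x Ax /contrapT iox /=; rewrite -(nested_induced DA iox).
have [r0 _ _] := return_timeP (nested_hits DA iox).
split => [Bx|[k _ [/= <-]]//].
by exists (return_time TA D x).
Qed.

(** On [D], the visits to [F] are read off the excursions. *)
Let W_orbit n : sigma0 nu excursion_orbit (iter n S @^-1` F `&` D).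
Proof.
have [sW mW _] := cW.
elim/ltn_ind: n => n IH.
pose B w := if (n < sumn w)%N then [set x | partial_sum w n /\ Xi (CodeSeq.code w) x]
  else Xi (CodeSeq.code w) `&` induced_map S D @^-1` (iter (n - sumn w) S @^-1` F `&` D).
apply: (csub_goodA mA cW (Q := \bigcup_v ([set x | (0 < sumn (CodeSeq.decode v))%N /\
    B (CodeSeq.decode v) x] `&` D)) (N := ~` [set x | io S D x])) => //.
- apply: (sa_bigcup sW) => v; apply: (saI sW) => //.
  have [v0|v0] := posnP (sumn (CodeSeq.decode v)).
    rewrite (_ : mkset _ = set0); first exact: (sa0 sW).
    by apply/seteqP; split => x //= -[].
  apply: (sa_imply sW); rewrite /B.
  have WX : sigma0 nu excursion_orbit (Xi (CodeSeq.code (CodeSeq.decode v))).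
    by apply: sub_cg; exists 0%N, (CodeSeq.code (CodeSeq.decode v)).
  case: ltnP => nv; first exact: (sa_imply sW).
  apply: (saI sW) => //.
  have WF : sigma0 nu excursion_orbit
      (iter (n - sumn (CodeSeq.decode v)) S @^-1` F `&` D) by apply: IH; rewrite ltn_subrL v0 (leq_trans v0 nv).
  apply: next_D => //; last exact: mW.
    by move=> k _; exact: W_TA.
  by move=> k _; exact: W_TA.
- by apply: measurableI => //; exact: mSk.
- exact/measurableC/(measurable_io sysS).
- exact: (io_full sysS).
move=> x Ax /contrapT iox.
have key : D x -> B (gaps S F A x) x <-> F (iter n S x).
  move=> Dx; have [_ eg g0 hg] := gapsP Dx iox; rewrite /B.
  have Xx : Xi (CodeSeq.code (gaps S F A x)) x by exact: excursion_in.
  case: ltnP => ng; first by split => [[/(hg _ ng)]|/(hg _ ng)].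
  have e : iter (n - sumn (gaps S F A x)) S (induced_map S D x) = iter n S x.
    by rewrite /induced_map -eg -iterD subnK.
  have Dnext := induced_hit (io_hits iox).
  by split => [[_ []]|Fn]; [rewrite /preimage/= e|split => //; split => //; rewrite /preimage/= e].
split => [[Fn Dx]|[v _ [[/= v0 Bv] Dx]]].
  have [_ eg g0 hg] := gapsP Dx iox.
  exists (CodeSeq.code (gaps S F A x)) => //; split => //=; rewrite CodeSeq.codeK.
  by split => //; exact/(key Dx).
split => //; apply/(key Dx); suff -> : gaps S F A x = CodeSeq.decode v by [].
apply: code_inj; rewrite -(excursion_in S Dx); move: Bv; rewrite /B.
by case: ifP => _ [].
Qed.

(* In this section [H t] is a set of possible futures: a point lies in [F]
   exactly if the point [t] steps later lies in [H t]. *)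
Section determined.
Variable H : nat -> set X.
Hypothesis OH : forall t, sigma0 mu (iterates S F) (H t).
Hypothesis FH : forall t, mu (F `+` iter t S @^-1` H t) = 0%E.

Let mO : iterates S F `<=` measurable. Proof. exact: (iterates_measurable Smp). Qed.

Let mH t : measurable (H t).
Proof. by have [_ mcO _] := csub_cg mu mO; exact: mcO. Qed.

Let W_H t : sigma0 nu excursion_orbit (H t `&` D).
Proof.
have [] // := cg_sub (csub_cotrace mD mA DA cW W_D) _ (OH t).
by move=> _ [n _ <-]; split; [exact: mSk|exact: W_orbit].
Qed.

(** The future of the next point of [D] is coded by the later excursions. *)
Lemma determined_next t :
  sigma0 nu excursion_future (induced_map S D @^-1` (H t `&` D)).
Proof.
apply: next_D => //; last exact: measurableI.
  by move=> k k0; exact: W_G.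
by move=> k k0; exact: W_G.
Qed.

(** The null set off which the predictions made by the sets [H j] are right along
    the whole orbit. *)
Definition bad : set X := ~` [set x | io S D x] `|`
  \bigcup_i \bigcup_j (iter i S @^-1` (F `+` iter j S @^-1` H j)).

Lemma measurable_bad : measurable bad.
Proof.
apply: measurableU; first exact/measurableC/(measurable_io sysS).
do 2![apply: bigcupT_measurable => ?].
by apply: mSk; apply: measurableY => //; exact: mSk.
Qed.

Lemma bad0 : mu bad = 0%E.
Proof.
have mY j : measurable (F `+` iter j S @^-1` H j).
  by apply: measurableY => //; exact: mSk.
have mio := measurableC (measurable_io sysS mD).
apply/eqP; rewrite eq_le measure_ge0 andbT -(io_full sysS mD D0).
apply: (le_mu_null measurable_bad mio _ _ (@subset_refl _ _)).
  by do 2![apply: bigcupT_measurable => ?]; exact: mSk.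
apply: null_bigcup => i; first by apply: bigcupT_measurable => j; exact: mSk.
by apply: null_bigcup => j; [exact: mSk|rewrite (mp_iter_mu Smp)].
Qed.

Lemma badP x : ~ bad x -> io S D x /\
  forall i j, F (iter i S x) <-> H j (iter (j + i) S x).
Proof.
move=> nb; split; first by apply: contrapT => h; apply: nb; left.
move=> i j; rewrite iterD; split => h; apply: contrapT => h'; apply: nb;
  right; exists i => //; exists j => //.
  by left.
by right.
Qed.

(** Excursions end at points of [D]; from the future of the end point and the
    duration one reads whether the starting point lies in [F], and at which
    intermediate times [F] was visited. *)
Lemma excursion_future_determines :
  (forall t, sigma0 nu excursion_future (return_time S D @^-1` [set t])) ->
  forall v, sigma0 nu excursion_future (Xi v).
Proof.
move=> Kt; have [sG _ _] := cG.
pose C w (j : nat) := induced_map S D @^-1` (H (sumn w - j)%N `&` D).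
pose Q w := [set x | (all (leq 1) w && (0 < sumn w)%N) /\
  (return_time S D @^-1` [set sumn w] `&`
  \bigcap_(j in [set j | (j < sumn w)%N]) (if partial_sum w j then C w j else ~` C w j)) x].
have KQ w : sigma0 nu excursion_future (Q w).
  apply: (sa_imply sG); apply: (saI sG) => //; apply: (sa_bigcap_cond sG) => j _.
  have := determined_next (sumn w - j) : sigma0 nu excursion_future (C w j).
  by case: ifP => // _; exact: (saC sG).
have QP w x : A x -> ~ bad x -> Q w x <-> D x /\ gaps S F A x = w.
  move=> Ax /badP[iox FHx].
  have Cj j : return_time S D x = sumn w -> (j <= sumn w)%N -> C w j x <-> F (iter j S x).
    move=> e jw; rewrite (FHx j (sumn w - j)%N) subnK// -e.
    rewrite /C /preimage /setI /mkset /induced_map -e; split => [[]//|h].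
    by split => //; exact: (induced_hit (io_hits iox)).
  split => [[/andP[wp w0] [e h]]|[Dx e]].
    have hF j : (j < sumn w)%N -> F (iter j S x) <-> partial_sum w j.
      move=> jw; rewrite -(Cj j e (ltnW jw)); have := h j jw.
      by case: ifP => // _; split.
    have Dx : D x by split => //; apply/(hF 0%N w0)/ps0.
    by split => //; apply: gaps_eq.
  have [wp eg g0 hg] := gapsP Dx iox; rewrite e in wp eg g0 hg.
  split; first by rewrite wp.
  split; first by rewrite eg.
  move=> j /= jw; have := Cj j (esym eg) (ltnW jw); have := hg j jw.
  by case: ifP => psj h1 h2; [apply/h2/h1|move/h2/h1].
have KD : sigma0 nu excursion_future D.
  apply: (csub_goodA mA cG (Q := \bigcup_v Q (CodeSeq.decode v)) _ mD measurable_bad bad0).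
    exact: (sa_bigcup sG).
  move=> x Ax nb; split => [Dx|[v _ /(QP _ _ Ax nb)[]]//].
  exists (CodeSeq.code (gaps S F A x)) => //; apply/QP => //.
  by rewrite CodeSeq.codeK.
move=> v; have vw : v = CodeSeq.code (CodeSeq.decode v) by rewrite CodeSeq.decodeK.
move: (CodeSeq.decode v) vw => w ->.
have [->|w0] := eqVneq w [::].
  apply: (csub_goodA mA cG (saC sG KD) (mXi _) measurable_bad bad0) => x Ax nb.
  split => [e Dx|nD]; last exact: excursion_notin.
  have [iox _] := badP nb; have [_ _ + _] := gapsP Dx iox.
  by move: (e : _ = CodeSeq.code [::]); rewrite (excursion_in S Dx) => /code_inj ->.
apply: (csub_goodA mA cG (KQ w) (mXi _) measurable_bad bad0) => x Ax nb.
rewrite (QP w x Ax nb); split => [e|[Dx <-]]; last exact: excursion_in.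
have Dx : D x.
  apply: contrapT => nD; move: (e : _ = CodeSeq.code w); rewrite excursion_notin// => /code_inj we.
  by rewrite -we in w0.
by split => //; apply: code_inj; rewrite -(excursion_in S Dx); exact: e.
Qed.

End determined.
End predictable_excursions.

Section predictable_and_zero_entropy.
Context (d : measure_display) (X : measurableType d) (R : realType).
Variables (mu : {measure set X -> \bar R}) (S : X -> X).
Hypothesis sysS : sys mu S.
Implicit Types (A B D E F P Q W : set X).

Let Smp : measure_preserving mu S. Proof. by case: sysS. Qed.

Let mSk k (A : set X) : measurable A -> measurable (iter k S @^-1` A).
Proof. exact: (mp_iter_measurable Smp). Qed.

Definition log_return F : Prop :=
  (\int[mu]_(x in F) (ln (return_time S F x)%:R)%:E < +oo)%E.

(** The principle behind both comparisons below: as soon as the duration of an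
    excursion is determined by the future, the excursion has zero entropy. *)
Lemma excursion_Pi F A : measurable F -> (0 < mu F)%E -> (mu F < +oo)%E ->
  measurable A -> (0 < mu A)%E -> (mu A < +oo)%E -> log_return F ->
  (forall t, sigma0 (restr mu A) (excursion_future mu S F A)
     (return_time S (A `&` F) @^-1` [set t])) ->
  (exists H, (forall t, sigma0 mu (iterates S F) (H t)) /\
             (forall t, mu (F `+` iter t S @^-1` H t) = 0%E)) ->
  (0 < mu (A `&` F))%E ->
  forall v, Pi_on mu S A (excursion S F A @^-1` [set v]).
Proof.
move=> mF F0 Ff mA A0 Af logF Kt [H [OH FH]] D0.
have [mpA _ _] := sys_induced sysS mA A0 Af.
apply: (relative_predictable (rs_fin mA Af) mpA (measurable_excursion sysS mF F0 Ff mA)).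
  exact: (excursion_entropy sysS mF F0 Ff mA Af logF).
exact: (excursion_future_determines sysS mF F0 Ff mA A0 Af D0 OH FH Kt).
Qed.

Lemma predictable_history F : measurable F -> sigma0 mu (future_iterates S F) F ->
  exists H, (forall t, sigma0 mu (iterates S F) (H t)) /\
            (forall t, mu (F `+` iter t S @^-1` H t) = 0%E).
Proof.
move=> mF pF; have /choice[H HP] t : exists H, sigma0 mu (iterates S F) H /\
    mu (F `+` iter t S @^-1` H) = 0%E.
  by have [H ? ?] := predictable_future Smp mF pF t; exists H.
by exists H; split => t; case: (HP t).
Qed.

(** Every excursion from [F] to [F] is a single return time. Its duration is
    determined by the future: from the point of return, the preceding visit to
    [F] is found at the first [j > 0] steps back at which the sets [H j] predict
    one. *)
Lemma predictable_zero_entropy F : measurable F -> (0 < mu F)%E -> (mu F < +oo)%E ->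
  log_return F -> sigma0 mu (future_iterates S F) F -> zero_entropy_set mu S F.
Proof.
move=> mF F0 Ff logF pF; have hist := predictable_history mF pF.
have FF : F `&` F = F := setIid F.
have D0 : (0 < mu (F `&` F))%E by rewrite FF.
have [mpF _ _] := sys_induced sysS mF F0 Ff.
have Gm : excursion_future mu S F F `<=` measurable.
  move=> _ [[k [v [_ ->]]]|[]//].
  exact/(mp_iter_measurable mpF)/(measurable_excursion sysS mF F0 Ff mF).
have cG := csub_cg (restr mu F) Gm; have [sG _ _] := cG.
have Kt t : sigma0 (restr mu F) (excursion_future mu S F F)
    (return_time S (F `&` F) @^-1` [set t]).
  have [H [OH FH]] := hist.
  pose C j := induced_map S (F `&` F) @^-1` (H j `&` (F `&` F)).
  have GC j : sigma0 (restr mu F) (excursion_future mu S F F) (C j).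
    exact: (determined_next sysS mF F0 Ff mF F0 Ff D0 OH).
  apply: (csub_goodA mF cG (Q := [set x | (0 < t)%N /\
      (C t `&` \bigcap_(j in [set j | (0 < j < t)%N]) ~` C j) x])
      _ _ (measurable_bad sysS mF mF OH) (bad0 sysS mF mF D0 OH FH)).
  - apply: (sa_imply sG); apply: (saI sG) => //.
    by apply: (sa_bigcap_cond sG) => j _; exact: (saC sG).
  - by apply: (measurable_return_time sysS); rewrite FF.
  move=> x Fx nb; have [iox FHx] := badP nb.
  have [] := return_timeP (io_hits iox).
  set n := return_time S (F `&` F) x => n0 Fn nmin.
  have Cj j : (j <= n)%N -> C j x <-> F (iter (n - j) S x).
    move=> jn; rewrite (FHx (n - j)%N j) subnKC//.
    by split => [[]//|h]; split.
  have Cn : C n x by apply/(Cj n (leqnn n)); rewrite subnn.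
  have Cl j : (0 < j < n)%N -> ~ C j x.
    move=> /andP[j0 jn]; rewrite (Cj j (ltnW jn)) => Fj.
    by have := nmin (n - j)%N; rewrite FF subn_gt0 => /(_ jn Fj); lia.
  split => [<-|[t0 [Ct Ctj]]].
    by split => //; split => // j /=; exact: Cl.
  rewrite /preimage/= -/n; case: (ltngtP t n) => // tn.
    by case: (Cl t) => //; rewrite t0.
  by case: (Ctj n) => //=; rewrite n0.
have PX := excursion_Pi mF F0 Ff mF F0 Ff logF Kt hist D0.
split; [by []|by rewrite F0|move=> n].
have io0 := io_full sysS mF F0; have mio := measurable_io sysS mF.
apply: (csub_goodA mF (csub_PiA sysS mF F0 Ff) (PX (CodeSeq.code [:: n])) _
  (measurableC mio) io0); first exact: (measurable_return_time sysS).
move=> x Fx /contrapT iox.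
have DFx : (F `&` F) x by split.
have g : gaps S F F x = [:: return_time S F x].
  rewrite /gaps return_time_first// FF.
  exact: (induced_hit (io_hits iox)).
split => [e|].
  have := excursion_in S DFx; rewrite g => h; rewrite /preimage/set1/mkset h.
  by rewrite -[in RHS](e : _ = n).
move=> e; have := excursion_in S DFx; rewrite g (e : _ = CodeSeq.code [:: n]).
by move=> /code_inj[->].
Qed.

(** Seen from [A], the set [F] is determined by its own excursions and by the
    return times to [A], which have zero entropy. *)
Lemma predictable_Pi A F : zero_entropy_set mu S A ->
  measurable F -> (0 < mu F)%E -> (mu F < +oo)%E ->
  log_return F -> sigma0 mu (future_iterates S F) F ->
  Pi_on mu S A F.
Proof.
move=> [mA /andP[A0 Af] ZA] mF F0 Ff logF pF.
have cP := csub_PiA sysS mA A0 Af; have [sP mP nP] := cP.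
have mD : measurable (A `&` F) by exact: measurableI.
have [D0|nD0] := boolP (0 < mu (A `&` F))%E; last first.
  apply: nP; split => //; rewrite /restr setIC.
  by apply/eqP; rewrite eq_le measure_ge0 andbT leNgt.
have [mpA _ _] := sys_induced sysS mA A0 Af.
have hist := predictable_history mF pF.
have Gm : excursion_future mu S F A `<=` measurable.
  move=> _ [[k [v [_ ->]]]|[]//].
  exact/(mp_iter_measurable mpA)/(measurable_excursion sysS mF F0 Ff mA).
have cG := csub_cg (restr mu A) Gm; have [sG _ _] := cG.
have io0 := io_full sysS mD D0; have mio := measurable_io sysS mD.
have in_D K : is_sigma0 (restr mu A) K -> forall k,
    K (iter k (induced_map S A) @^-1` (excursion S F A @^-1` [set CodeSeq.code [::]])) ->
    K (iter k (induced_map S A) @^-1` (A `&` F)).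
  move=> cK k KX; have [sK _ _] := cK.
  apply: (csub_goodA mA cK (saC sK KX) _ (measurableC mio) io0).
    exact: (mp_iter_measurable mpA).
  move=> x Ax /contrapT iox.
  have iok : io S (A `&` F) (iter k (induced_map S A) x) by exact: io_iter_induced.
  change ((A `&` F) (iter k (induced_map S A) x) <->
    excursion S F A (iter k (induced_map S A) x) <> CodeSeq.code [::]).
  move: (iter k (induced_map S A) x) iok => y {}iox.
  split => [Dy|h]; last by apply: contrapT => nD; apply: h; exact: excursion_notin.
  rewrite (excursion_in S Dy) => /code_inj e.
  by have [_ _] := gapsP Dy iox; rewrite e.
have PX : forall v, Pi_on mu S A (excursion S F A @^-1` [set v]).
  apply: (excursion_Pi mF F0 Ff mA A0 Af logF _ hist D0) => t.
  apply: (sa_nested_return sysS t mA mD _ D0 cG).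
  - by move=> x [].
  - move=> k k0; apply: (in_D _ cG k); apply: sub_cg; left.
    by exists k, (CodeSeq.code [::]).
  - by move=> k n; apply: sub_cg; right; exact: PiA_future.
have PD := in_D _ cP 0%N (PX _).
apply: (csub_goodA mA cP PD mF (measurable0) (measure0 mu)) => x Ax _.
by split => [Fx|[]].
Qed.

(** * Inducing in stages *)

Lemma Pi_eq_iter E (f g : X -> X) N P : measurable E ->
  measure_preserving (restr mu E) f -> measure_preserving (restr mu E) g ->
  measurable N -> mu N = 0%E ->
  (forall x k, E x -> ~ N x -> iter k f x = iter k g x) ->
  Pi (restr mu E) f P -> Pi (restr mu E) g P.
Proof.
move=> mE mpf mpg mN N0 fg [mP fP]; split => //.
have gm : [set iter k g @^-1` P | k in [set k | (0 < k)%N]] `<=` measurable.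
  by move=> _ [k _ <-]; exact: (mp_iter_measurable (mu := mrestr mu mE) mpg).
have cg_ := csub_cg (restr mu E) gm.
apply: (cg_sub cg_) fP => _ [k k0 <-].
apply: (csub_goodA mE cg_ (Q := iter k g @^-1` P) _ _ mN N0).
- by apply: sub_cg; exists k.
- exact: (mp_iter_measurable (mu := mrestr mu mE) mpf).
- by move=> x Ex nN; rewrite /preimage/= (fg x k Ex nN).
Qed.

Lemma nested_restr E G : E `<=` G -> restr (restr mu G) E = restr mu E.
Proof.
move=> EG; apply/funext => B; rewrite /restr; congr (mu _).
by apply/seteqP; split => x; [case=> -[]|move=> [Bx Ex]; split => //; exact: EG].
Qed.

(** Inducing on [E] directly or by way of a larger set gives the same system off a
    null set. *)
Lemma nested_Pi E G P : measurable E -> measurable G -> E `<=` G ->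
  (0 < mu E)%E -> (mu G < +oo)%E ->
  Pi (restr (restr mu G) E) (induced_map (induced_map S G) E) P <->
  Pi_on mu S E P.
Proof.
move=> mE mG EG E0 Gf.
have EGI : E `&` G = E by apply/setIidPl.
have G0 : (0 < mu G)%E.
  by apply: lt_le_trans E0 _; apply: le_measure; rewrite ?inE.
have Ef : (mu E < +oo)%E.
  by apply: le_lt_trans Gf; apply: le_measure; rewrite ?inE.
have sysG := sys_induced sysS mG G0 Gf.
have E0' : (0 < mrestr mu mG E)%E by rewrite /mrestr EGI.
have Ef' : (mrestr mu mG E < +oo)%E by rewrite /mrestr EGI.
have [mpE _ _] := sys_induced sysS mE E0 Ef.
have [mpE' _ _] := sys_induced sysG mE E0' Ef'.
have e := nested_restr EG; have mpE'' : measure_preserving (restr mu E) (induced_map (induced_map S G) E).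
  by rewrite -e.
have io0 := io_full sysS mE E0; have mio := measurableC (measurable_io sysS mE).
rewrite e; split; apply: (Pi_eq_iter mE _ _ mio io0) => // x k Ex /contrapT iox.
  exact: (nested_iter EG).
by apply/esym/(nested_iter EG).
Qed.

End predictable_and_zero_entropy.

Section log_finite.
Context (d : measure_display) (X : measurableType d) (R : realType).
Variables (mu : {measure set X -> \bar R}) (S : X -> X).
Hypotheses (mufin : (mu [set: X] < +oo)%E) (sysS : sys mu S).

Lemma ln_natE_ge0 (n : nat) : (0 <= (ln n%:R : R)%:E)%E.
Proof.
by rewrite lee_fin; case: n => [|n]; [rewrite ln0|rewrite ln_ge0// ler1n].
Qed.

(** By Kac's argument the return time itself is integrable, and [ln n <= n - 1]. *)
Lemma log_return_finite B : measurable B -> log_return mu S B.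
Proof.
move=> mB; have [mp _ _] := sysS.
apply: (@le_lt_trans _ _ (\int[mu]_x (cst 1%E) x)%E); last first.
  by rewrite integral_cst// mul1e.
apply: (excursion_integral mp mB) => //.
- apply: (measurable_nat_comp _ (fun n => ln n%:R)) => // v.
  exact: (measurable_return_time sysS).
- by move=> x; exact: ln_natE_ge0.
move=> x Bx; rewrite (eq_bigr (fun=> 1%:E))// sumEFin sumr_const card_ord lee_fin.
case: (return_time S B x) => [|n]; first by rewrite ln0.
by have := @ln_le_subr1 R n.+1%:R (ltr0Sn _ _); lra.
Qed.

End log_finite.

Section stages.
Context (d : measure_display) (X : measurableType d) (R : realType).
Variables (mu : {measure set X -> \bar R}) (S : X -> X).
Hypothesis sysS : sys mu S.
Implicit Types (A B D E F G P Q W : set X).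

Let Smp : measure_preserving mu S. Proof. by case: sysS. Qed.

Let mSk k (A : set X) : measurable A -> measurable (iter k S @^-1` A).
Proof. exact: (mp_iter_measurable Smp). Qed.

(** Passing to a subset: inside the finite system induced on [A] every
    predictable set has a log-integrable return time. *)
Lemma zero_entropy_sub A P : zero_entropy_set mu S A ->
  P `<=` A -> (0 < mu P)%E -> Pi_on mu S A P ->
  zero_entropy_set mu S P /\
  forall Q, Pi_on mu S A Q ->
    Pi_on mu S P Q.
Proof.
move=> [mA /andP[A0 Af] ZA] PA P0 PP; have mP : measurable P by case: PP.
have sysA := sys_induced sysS mA A0 Af.
have Pf : (mu P < +oo)%E.
  by apply: le_lt_trans Af; apply: le_measure; rewrite ?inE.
have e B : B `<=` A -> mrestr mu mA B = mu B by move=> /setIidPl BA; rewrite /mrestr BA.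
have P0' : (0 < mrestr mu mA P)%E by rewrite e.
have Pf' : (mrestr mu mA P < +oo)%E by rewrite e.
have lg B : measurable B -> log_return (mrestr mu mA) (induced_map S A) B.
  by move=> mB; exact: (log_return_finite (rs_fin mA Af) sysA mB).
have ZP := predictable_zero_entropy sysA mP P0' Pf' (lg _ mP) PP.2.
have down Q : Pi_on mu S A Q -> Pi_on mu S P Q.
  move=> PQ; have mQ : measurable Q by case: PQ.
  have [Q0|nQ0] := boolP (0 < mrestr mu mA Q)%E; last first.
    have [_ _ nP] := csub_PiA sysS mP P0 Pf; apply: nP; split => //.
    rewrite /restr; apply/eqP; rewrite eq_le measure_ge0 andbT.
    move: nQ0; rewrite -leNgt; apply: le_trans; rewrite /mrestr.
    apply: le_measure; rewrite ?inE; [exact: measurableI|exact: measurableI|].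
    by move=> x [Qx /PA].
  have Qf : (mrestr mu mA Q < +oo)%E.
    apply: le_lt_trans Af; rewrite /mrestr.
    by apply: le_measure; rewrite ?inE//; exact: measurableI.
  apply/(nested_Pi sysS Q mP mA PA P0 Af).
  exact: (predictable_Pi sysA ZP mQ Q0 Qf (lg _ mQ) PQ.2).
split => //; split => //; first by rewrite P0.
move=> n; apply: down.
have cPi := csub_PiA sysS mA A0 Af.
apply: (sa_nested_return sysS n mA mP PA P0 cPi).
- by move=> k _; exact: PiA_future.
- by move=> k m; exact: PiA_future.
Qed.

(** Unlike membership in [Pi_on], predictability does not mention the base: this is
    how information passes from [A] to a larger base. *)
Lemma zero_entropy_up A P : zero_entropy_set mu S A -> P `<=` A ->
  Pi_on mu S A P -> sigma0 mu (future_iterates S P) P.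
Proof.
move=> ZA PA PP; have mP : measurable P by case: PP.
have [P0|nP0] := boolP (0 < mu P)%E; last first.
  apply: sub_gen_smallest; right; split => //.
  by apply/eqP; rewrite eq_le measure_ge0 andbT leNgt.
by apply: (zero_entropy_predictable sysS); have [] := zero_entropy_sub ZA PA P0 PP.
Qed.

End stages.

(** * The sets of zero entropy, seen from a base *)

Section bases.
Context (d : measure_display) (X : measurableType d) (R : realType).
Variables (mu : {measure set X -> \bar R}) (S : X -> X).
Hypothesis sysS : sys mu S.
Implicit Types (A B D E F G P Q W : set X).

Let Smp : measure_preserving mu S. Proof. by case: sysS. Qed.

Let mSk k (A : set X) : measurable A -> measurable (iter k S @^-1` A).
Proof. exact: (mp_iter_measurable Smp). Qed.

(** The sets that, together with all their preimages, have zero entropy when seen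
    from the base [E]. *)
Definition ZE E : set (set X) := [set A | measurable A /\
  forall j, Pi_on mu S E (iter j S @^-1` A)].

Section base.
Variable E : set X.
Hypothesis zE : zero_entropy_set mu S E.

Let mE : measurable E. Proof. by case: zE. Qed.
Let E0 : (0 < mu E)%E. Proof. by case: zE => _ /andP[]. Qed.
Let Ef : (mu E < +oo)%E. Proof. by case: zE => _ /andP[]. Qed.
Let cPi : is_sigma0 (restr mu E) (Pi_on mu S E).
Proof. exact: csub_PiA. Qed.

Lemma csub_ZE : is_sigma0 mu (ZE E).
Proof.
have [sP mP nP] := cPi; split.
- split => /=.
  + by split => // j; exact: (sa0 sP).
  + move=> A [mA PA]; rewrite setTD; split; first exact: measurableC.
    by move=> j; exact: (saC sP (PA j)).
  + move=> F PF; split; first by apply: bigcupT_measurable => n; case: (PF n).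
    move=> j; rewrite preimage_bigcup; apply: (sa_bigcup sP) => n.
    by case: (PF n) => _ /(_ j).
- by move=> A [].
- move=> A [mA A0]; split => // j; apply: nP; split; first exact: mSk.
  have [] // : null_sets mu (iter j S @^-1` A `&` E).
  apply: (null_setsP (N := iter j S @^-1` A)) => //.
  + by apply: measurableI => //; exact: mSk.
  + exact: mSk.
  + by rewrite (mp_iter_mu Smp).
Qed.

Lemma ZE_iter k A : ZE E A -> ZE E (iter k S @^-1` A).
Proof.
move=> [mA PA]; split; first exact: mSk.
move=> j; rewrite (_ : _ @^-1` _ = iter (k + j) S @^-1` A)//.
by apply/funext => x; exact: (congr1 A (esym (iterD k j S x))).
Qed.

Lemma ZE_Pi A : ZE E A -> Pi_on mu S E A.
Proof. by move=> [_ /(_ 0%N)]. Qed.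

(** For a subset [P] of the base, a preimage of [P] under [S] is read off the
    return times to [E] and the preimages of [P] under the induced map, which all
    have zero entropy. *)
Lemma Pi_ZE P : P `<=` E -> Pi_on mu S E P -> ZE E P.
Proof.
move=> PE PP; have mP : measurable P by case: PP.
have [sP mPi nP] := cPi; split => // j.
have ZL : forall n, Pi_on mu S E (return_time S E @^-1` [set n]).
  by case: zE.
have io0 := io_full sysS mE E0; have mio := measurableC (measurable_io sysS mE).
apply: (csub_goodA mE cPi (Q := \bigcup_k
  ([set x | (\sum_(i < k) return_time S E (iter i (induced_map S E) x))%N = j] `&`
   iter k (induced_map S E) @^-1` P)) _ (mSk j mP) mio io0).
  apply: (sa_bigcup sP) => k; apply: (saI sP); last exact: PiA_future.
  apply: (sa_sum _ _ sP (g := fun i => return_time S E \o iter i (induced_map S E))) => i n.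
  exact: (PiA_future sysS i mE E0 Ef (ZL n)).
move=> x Ex /contrapT iox; split => [Px|[k _ [/= <-]]]; last by rewrite /preimage/= iter_induced.
case: j Px => [Px|j Px]; first by exists 0%N => //; split => //=; rewrite big_ord0.
have [k [k0 e]] := visit_time iox (ltn0Sn j) (PE _ Px).
by exists k => //; split => //; rewrite /preimage/= iter_induced -e.
Qed.

Lemma ZE_base : ZE E E.
Proof.
apply: Pi_ZE => //; have [sP mPi nP] := cPi.
apply: (csub_goodA mE cPi (saT sP) mE measurable0 (measure0 mu)) => x Ex _.
by split.
Qed.

Section larger_base.
Variable G : set X.
Hypotheses (zG : ZE E G) (EG : E `<=` G) (Gf : (mu G < +oo)%E).

Let mG : measurable G. Proof. by case: zG. Qed.
Let G0 : (0 < mu G)%E.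
Proof. by apply: lt_le_trans E0 _; apply: le_measure; rewrite ?inE. Qed.
Let sysG : sys (mrestr mu mG) (induced_map S G). Proof. exact: sys_induced. Qed.

Lemma ZE_return n : ZE E (return_time S G @^-1` [set n]).
Proof.
have [sZ _ _] := csub_ZE; apply: (sa_return_time sZ) => k _; exact: ZE_iter.
Qed.

Lemma ZE_induced k B : ZE E B -> ZE E (iter k (induced_map S G) @^-1` B).
Proof.
have [sZ _ _] := csub_ZE; elim: k B => [//|k IH] B ZB.
rewrite iter_preimage; apply: (sa_induced sZ); first exact: ZE_return.
by move=> n; apply: ZE_iter; exact: IH.
Qed.

Let zEG : zero_entropy_set (mrestr mu mG) (induced_map S G) E.
Proof.
have EGI : E `&` G = E by apply/setIidPl.
split => //; first by rewrite /mrestr EGI E0.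
move=> n; apply/(nested_Pi sysS _ mE mG EG E0 Gf); apply: ZE_Pi.
have [sZ _ _] := csub_ZE; apply: (sa_return_time sZ) => k _.
exact/ZE_induced/ZE_base.
Qed.

(** The iterates of a set [Q] of [ZE E] meet [E] in sets of zero entropy for the
    system induced on [G]; since almost every orbit has visited [E] before a
    large time, late iterates of [Q] are exhausted by these sets. *)
Lemma ZE_larger Q : ZE E Q -> Q `<=` G -> Pi_on mu S G Q.
Proof.
move=> ZQ QG; have mQ : measurable Q by case: ZQ.
have [mpG _ _] := sysG.
have mT k B : measurable B -> measurable (iter k (induced_map S G) @^-1` B).
  exact: (mp_iter_measurable mpG).
have [sZ _ _] := csub_ZE.
pose P i := E `&` iter i (induced_map S G) @^-1` Q.
have mP i : measurable (P i) by apply: measurableI => //; exact: mT.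
have PP i : Pi_on mu S G (P i).
  have ZP : ZE E (P i) by apply: (saI sZ); [exact: ZE_base|exact: ZE_induced].
  split => //; have PE : P i `<=` E by move=> x [].
  apply: (zero_entropy_up sysG zEG PE).
  exact/(nested_Pi sysS _ mE mG EG E0 Gf)/ZE_Pi.
have cG := csub_PiA sysS mG G0 Gf; have [sG _ _] := cG.
have EGI : E `&` G = E by apply/setIidPl.
have E0' : (0 < mrestr mu mG E)%E by rewrite /mrestr EGI.
have io0 := io_full sysG mE E0'; have mio := measurable_io sysG mE.
pose V k := [set x | io (induced_map S G) E x] `&`
  \bigcap_(j in [set j | (j <= k)%N]) ~` (iter j (induced_map S G) @^-1` E).
have mV k : measurable (V k).
  apply: measurableI => //; apply: (sa_bigcap_cond (@sa_measurable _ X)) => j _.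
  exact/measurableC/mT.
apply: (Pi_limit_future (rs_fin mG Gf) mpG mQ) => e e0.
have [k hk] : exists k, fmu (mrestr mu mG) (V k) < e.
  apply: (fmu_small (rs_fin mG Gf) mV) => //.
    by move=> k x [iox Vx]; split => // j /= jk; apply: Vx => /=; exact: leqW.
  apply/seteqP; split => // x h; have [iox _] := h 0%N I.
  have [n [_ En]] := iox 0%N; have [_ /(_ n (leqnn n))] := h n I; exact.
pose B := \bigcup_(i in [set i | (i <= k)%N]) iter (k - i) (induced_map S G) @^-1` P i.
have PB : Pi_on mu S G B.
  by apply: (sa_bigcup_cond sG) => i _; exact: PiA_future.
have mB : measurable B by case: PB.
exists k, B; split => //; apply: le_lt_trans hk.
have mY : measurable (iter k (induced_map S G) @^-1` Q `+` B).
  by apply: measurableY => //; exact: mT.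
rewrite -lee_fin -!(fmuE (rs_fin mG Gf))//.
apply: (le_mu_null mY (mV k) (measurableC mio) io0) => x.
have step i : (i <= k)%N -> iter i (induced_map S G) (iter (k - i) (induced_map S G) x) =
    iter k (induced_map S G) x by move=> ik; rewrite -iterD subnKC.
case=> [[Qx nB]|[[i /= ik [_ Qi]] nQ]]; last by case: nQ; rewrite /preimage/= -(step i ik).
have [iox|nio] := pselect (io (induced_map S G) E x); [left; split => // j /= jk Ej|by right].
apply: nB; exists (k - j)%N; first exact: leq_subr.
by split; rewrite /preimage/= subKn// -iterD subnK.
Qed.

Lemma zero_entropy_larger : zero_entropy_set mu S G.
Proof.
split => //; first by rewrite G0.
move=> n; have cG := csub_PiA sysS mG G0 Gf.
have [sZ _ _] := csub_ZE.
have PL : Pi_on mu S G (return_time S G @^-1` [set n] `&` G).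
  by apply: ZE_larger; [apply: (saI sZ) => //; exact: ZE_return|move=> x []].
apply: (csub_goodA mG cG PL _ measurable0 (measure0 mu)).
  exact: (measurable_return_time sysS).
by move=> x Gx _; split => [Lx|[]].
Qed.

End larger_base.

(** Change of base: a set of finite measure in [ZE E] is as good a base as [E]. *)
Lemma ZE_change F : ZE E F -> (0 < mu F)%E -> (mu F < +oo)%E ->
  zero_entropy_set mu S F /\ ZE E `<=` ZE F.
Proof.
move=> ZF F0 Ff; have mF : measurable F by case: ZF.
have [sZ _ _] := csub_ZE.
have zG : ZE E (E `|` F) by apply: (saU sZ) => //; exact: ZE_base.
have EG : E `<=` E `|` F by left.
have FG : F `<=` E `|` F by right.
have Gf : (mu (E `|` F) < +oo)%E.
  apply: le_lt_trans (lte_add_pinfty Ef Ff); exact: measureU2.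
have ZG := zero_entropy_larger zG EG Gf.
have [ZF' down] := zero_entropy_sub sysS ZG FG F0 (ZE_larger zG EG Gf ZF FG).
split => // A ZA; have mA : measurable A by case: ZA.
split => // j; have mj := mSk j mA.
have PA : Pi_on mu S F (iter j S @^-1` A `&` F).
  apply: down; apply: (ZE_larger zG EG Gf); last by move=> x [_ ?]; right.
  by apply: (saI sZ) => //; exact: ZE_iter.
apply: (csub_goodA mF (csub_PiA sysS mF F0 Ff) PA mj measurable0 (measure0 mu)).
by move=> x Fx _; split => [|[]].
Qed.

End base.
End bases.

(** * Log-integrable return times *)

(** The cost of [n] is at least [ln (n + 1)], and [1 + a + b <= (1 + a) * (1 + b)]. *)
Lemma ln_sum_cost (R : realType) (n : nat -> nat) k :
  ln (\sum_(i < k) n i)%N%:R <= \sum_(i < k) cost R (n i).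
Proof.
apply: (@le_trans _ _ (ln (1 + \sum_(i < k) n i)%N%:R)).
  case: (\sum_(i < k) n i)%N => [|v]; first by rewrite ln0// ln_ge0.
  by rewrite ler_ln ?posrE ?ltr0n// ler_nat.
elim: k => [|k IH]; first by rewrite !big_ord0 addn0 ln1.
rewrite !big_ord_recr/=; set a := (\sum_(i < k) n i)%N in IH *.
apply: (@le_trans _ _ (ln (1 + a)%N%:R + ln (1 + n k)%N%:R)).
  rewrite -lnM ?posrE ?ltr0n// ler_ln ?posrE ?mulr_gt0 ?ltr0n// -natrM ler_nat.
  nia.
apply: lerD IH _; rewrite /cost /weight -lnV ?posrE ?invr_gt0 ?mulr_gt0 ?ltr0n// invrK.
rewrite ler_ln ?posrE ?mulr_gt0 ?ltr0n// -!natrM ler_nat; nia.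
Qed.

Section log_integrable.
Context (d : measure_display) (X : measurableType d) (R : realType).
Variables (mu : {measure set X -> \bar R}) (S : X -> X).
Hypothesis sysS : sys mu S.
Implicit Types (A B F G : set X).

Let Smp : measure_preserving mu S. Proof. by case: sysS. Qed.

Let ln_rt B (x : X) : \bar R := (ln (return_time S B x)%:R)%:E.

Let mln B : measurable B -> measurable_fun [set: X] (ln_rt B).
Proof.
by move=> mB; exact: (measurable_return_comp sysS mB (fun n => ln n%:R)).
Qed.

Let ln0 B x : (0 <= ln_rt B x)%E.
Proof. exact: ln_natE_ge0. Qed.

Let integral_io B G : measurable B -> measurable G -> (0 < mu B)%E ->
  (\int[mu]_(x in B) ln_rt G x = \int[mu]_(x in B `&` [set x | io S B x]) ln_rt G x)%E.
Proof.
move=> mB mG B0; have io0 := io_full sysS mB B0; have mio := measurable_io sysS mB.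
have e := ge0_negligible_integral (measurableC mio) mB (measurable_funTS (mln mG))
  (fun x _ => ln0 G x) io0.
by apply: (eq_trans e); rewrite setDE setCK.
Qed.

Lemma log_return_null B : measurable B -> mu B = 0%E -> log_return mu S B.
Proof.
move=> mB B0; have e := ge0_negligible_integral mB mB (measurable_funTS (mln mB))
  (fun x _ => ln0 B x) B0.
by rewrite /log_return -/(ln_rt B) e setDv integral_set0.
Qed.

(** The larger the set, the shorter the return time. *)
Lemma log_return_super A G : measurable A -> measurable G -> A `<=` G ->
  log_return mu S A -> (\int[mu]_(x in A) ln_rt G x < +oo)%E.
Proof.
move=> mA mG AG lA; have [A0|nA0] := boolP (0 < mu A)%E; last first.
  have A0 : mu A = 0%E by apply/eqP; rewrite eq_le measure_ge0 andbT leNgt.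
  have e := ge0_negligible_integral mA mA (measurable_funTS (mln mG)) (fun x _ => ln0 G x) A0.
  by rewrite e setDv integral_set0.
apply: le_lt_trans lA; rewrite -/(ln_rt A) (integral_io mA mG A0) (integral_io mA mA A0).
have mAio : measurable (A `&` [set x | io S A x]).
  by apply: measurableI => //; exact: (measurable_io sysS).
apply: ge0_le_integral => //; try exact: measurable_funTS (mln _).
move=> x [Ax iox]; have [r0 Ar _] := return_timeP (io_hits iox).
have [g0 _ gmin] := return_timeP (io_hits (io_sub AG iox)).
by rewrite lee_fin ler_ln ?posrE ?ltr0n// ler_nat; apply: gmin => //; exact: AG.
Qed.

(** On each of the two sets the return time to the union is at most that to the
    set itself. *)
Lemma log_returnU A B : measurable A -> measurable B ->
  log_return mu S A -> log_return mu S B -> log_return mu S (A `|` B).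
Proof.
move=> mA mB lA lB; have mAB : measurable (A `|` B) by exact: measurableU.
have mBA : measurable (B `\` A) by exact: measurableD.
have e : (\int[mu]_(x in A `|` B) ln_rt (A `|` B) x =
   \int[mu]_(x in A) ln_rt (A `|` B) x + \int[mu]_(x in B `\` A) ln_rt (A `|` B) x)%E.
  have -> : (\int[mu]_(x in A `|` B) ln_rt (A `|` B) x =
     \int[mu]_(x in A `|` (B `\` A)) ln_rt (A `|` B) x)%E.
    congr (integral _ _ _); apply/seteqP; split => x.
      by have [Ax|nA] := pselect (A x); [left|case=> // Bx; right].
    by case=> [|[]]; [left|right].
  apply: ge0_integral_setU => //; first exact/measurable_funTS/mln.
  by apply/disj_setPS => x [? []].
rewrite /log_return -/(ln_rt (A `|` B)) e; apply: lte_add_pinfty.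
  by apply: log_return_super => // x; left.
apply: (@le_lt_trans _ _ (\int[mu]_(x in B) ln_rt (A `|` B) x)%E).
  apply: ge0_subset_integral => //; first exact/measurable_funTS/mln.
by apply: log_return_super => // x; right.
Qed.

(** A return to [B] is a succession of returns to [A], the logarithm of a sum of
    times is at most the sum of their costs, and Kac's argument in the system
    induced on [A] bounds the integral of that sum. *)
Lemma log_return_sub A B : measurable A -> (mu A < +oo)%E -> measurable B ->
  B `<=` A -> log_return mu S A -> log_return mu S B.
Proof.
move=> mA Af mB BA lA; have [B0|nB0] := boolP (0 < mu B)%E; last first.
  by apply: log_return_null => //; apply/eqP; rewrite eq_le measure_ge0 andbT leNgt.
have A0 : (0 < mu A)%E by apply: lt_le_trans B0 _; apply: le_measure; rewrite ?inE.
have [mpA _ _] := sys_induced sysS mA A0 Af.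
have mio := measurable_io sysS mB.
rewrite /log_return -/(ln_rt B) (integral_io mB mB B0) integral_mkcondr.
have mc : measurable_fun [set: X] (ln_rt B \_ [set x | io S B x]).
  by apply/(measurable_restrictT _ mio).1/measurable_funTS/mln.
have c0 x : (0 <= (ln_rt B \_ [set x | io S B x]) x)%E by apply: erestrict_ge0 => *; exact: ln0.
pose h x : \bar R := (cost R (return_time S A x))%:E.
have mh : measurable_fun [set: X] h by exact: (measurable_return_comp sysS mA (cost R)).
have h0 x : (0 <= h x)%E by rewrite lee_fin cost_ge0.
apply: le_lt_trans (integral_cost sysS mA Af lA).
have -> : (\int[mu]_(x in A) h x = \int[mrestr mu mA]_x h x)%E by rewrite integral_mrestr// setTI.
have BAI : B `&` A = B by apply/setIidPl.
have -> : (\int[mu]_(x in B) (ln_rt B \_ [set x | io S B x]) x =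
   \int[mrestr mu mA]_(x in B) (ln_rt B \_ [set x | io S B x]) x)%E.
  by rewrite integral_mrestr// BAI.
apply: (excursion_integral mpA mB mh h0 mc c0) => x Bx.
rewrite /patch; case: ifPn => [/set_mem iox|_]; last by apply: sume_ge0 => *.
rewrite /ln_rt (nested_return_time BA iox) sumEFin lee_fin.
have ioA := io_sub BA iox.
exact: (ln_sum_cost R (fun i => return_time S A (iter i (induced_map S A) x))).
Qed.

Lemma log_return_preimage A : measurable A -> log_return mu S A ->
  log_return mu S (S @^-1` A).
Proof.
move=> mA; rewrite /log_return -/(ln_rt A) -/(ln_rt (S @^-1` A)).
rewrite -(integral_preimage Smp mA (mln mA) (ln0 A)); apply: le_lt_trans.
rewrite le_eqVlt; apply/orP; left; apply/eqP; apply: eq_integral => x _.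
rewrite /ln_rt /return_time; congr (ln (xget _ _)%:R)%:E.
by apply/seteqP; split => n [n0 An nmin]; split => //;
  [rewrite -iterSr|move=> k k0 Ak; apply: nmin => //; rewrite /preimage/= -iterS iterSr
  |rewrite /preimage/= -iterS iterSr|move=> k k0 Ak; apply: nmin => //; rewrite -iterSr].
Qed.

End log_integrable.

(** * Entropy of finite partitions *)

Section entropy_rate.
Context (d : measure_display) (X : measurableType d) (R : realType).
Variables (mu : {measure set X -> \bar R}) (S : X -> X).
Hypotheses (mufin : (mu [set: X] < +oo)%E) (Smp : measure_preserving mu S).
Variables (I : finType) (f : X -> I) (c : R).
Hypotheses (mff : measurable_fibers f) (c0 : 0 < c).

Let rate n : R := entropy mu (itinerary S f n) / c / n%:R.

Let rate_ge0 n : 0 <= rate n.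
Proof.
rewrite /rate divr_ge0// divr_ge0 ?(ltW c0)//; apply: (entropy_ge0 mufin).
exact: (mf_nm Smp).
Qed.

Let rate_le n e : (0 < n)%N -> (rate n <= e) = (entropy mu (itinerary S f n) <= e * c * n%:R).
Proof.
by move=> n0; rewrite /rate ler_pdivrMr ?ltr0n// ler_pdivrMr// mulrAC.
Qed.

Lemma zent_rate : zero_rate mu S f -> limn rate = 0.
Proof.
move=> zf; apply/cvg_lim => //; apply/cvgrPdist_le => e e0.
have ec : 0 < e * c by rewrite mulr_gt0.
have [N hN] := zent_entropy mufin Smp mff zf ec.
exists N.+1 => // n /= Nn; rewrite sub0r normrN ger0_norm//.
by rewrite rate_le ?(leq_trans _ Nn)//; apply: hN; exact: ltnW.
Qed.

(** The averages [entropy (itinerary f n) / n] decrease, so their limit is the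
    infimum and one of them is small. *)
Lemma rate_zent : limn rate <= 0 -> zero_rate mu S f.
Proof.
move=> l0; apply: (entropy_zent mufin Smp mff) => e e0.
have anti : {homo (fun n => rate n.+1) : n m / (n <= m)%N >-> m <= n}.
  apply: homo_leq => [x //|y x z xy yz|n]; first exact: le_trans yz xy.
  rewrite rate_le// (entropy_nmS mufin Smp n.+1 mff) /rate.
  have := entropy_nm_ge mufin Smp n.+1 mff; set h := entropy _ _; set a := entropy_step _ _ _ _ => ah.
  have n1 : 0 < n.+1%:R :> R by rewrite ltr0n.
  have -> : h / c / n.+1%:R * c * n.+2%:R = h + h / n.+1%:R.
    by rewrite -[n.+2%:R]natr1; field; rewrite ?lt0r_neq0.
  by rewrite lerD2l ler_pdivlMr// mulrC.
have cv : cvgn (fun n => rate n.+1).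
  apply: nonincreasing_is_cvgn => //; exists 0 => _ [n _ <-]; exact: rate_ge0.
have cv' : (fun n => rate n.+1) x @[x --> \oo] --> limn rate.
  have : rate x @[x --> \oo] --> lim ((fun n => rate n.+1) x @[x --> \oo]).
    by rewrite -cvg_shiftS.
  by move=> h; rewrite (cvg_lim _ h).
have ec : limn rate < e / c by apply: le_lt_trans l0 _; rewrite divr_gt0.
have [N _ /(_ N (leqnn N))/= hN] := cvgr_lt _ cv' _ ec.
exists N.+1; split => //; move/ltW: hN; rewrite rate_le// divfK ?lt0r_neq0//.
Qed.

End entropy_rate.

Section partitions.
Context (d : measure_display) (X : measurableType d) (R : realType).
Variables (mu : {measure set X -> \bar R}) (S : X -> X) (A : set X).
Hypotheses (sysS : sys mu S) (mA : measurable A).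
Hypotheses (A0 : (0 < mu A)%E) (Af : (mu A < +oo)%E).
Variables (k : nat) (P : 'I_k -> set X).
Hypotheses (mP : forall i, measurable (P i)) (tP : trivIset [set: 'I_k] P).
Hypothesis cP : \bigcup_(i in [set: 'I_k]) P i = A.

Let nu : {measure set X -> \bar R} := mrestr mu mA.
Let TA := induced_map S A.
Let nufin : (nu [set: X] < +oo)%E. Proof. exact: rs_fin. Qed.
Let sysA : sys nu TA. Proof. exact: sys_induced. Qed.
Let mpA : measure_preserving nu TA. Proof. by case: sysA. Qed.

Let c := fine (mu A).
Let c0 : 0 < c. Proof. by rewrite fine_gt0// A0. Qed.

Section label.
Variable i0 : 'I_k.

(** Off [A] the label takes the default value [i0], so that the words of labels
    and the cells of the joins have the same indices. *)
Let f (x : X) : 'I_k := odflt i0 [pick i | x \in P i].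

Let fP x i : A x -> (f x = i) <-> P i x.
Proof.
rewrite -cP => -[j _ Pj]; rewrite /f; case: pickP => [l|/(_ j)]; last by rewrite mem_set.
move=> /set_mem Pl; split => [<- //|Pi]; apply: (tP (i := l) (j := i)) => //.
by exists x.
Qed.

Let fP' x i : (f x = i) -> P i x \/ (~ A x /\ i = i0).
Proof.
move=> fx; have [Ax|nA] := pselect (A x); first by left; exact/(fP i Ax).
right; split => //; rewrite -fx /f; case: pickP => // l /set_mem Pl.
by case: nA; rewrite -cP; exists l.
Qed.

Let mff : measurable_fibers f.
Proof.
move=> i; rewrite (_ : _ @^-1` _ = P i `|` [set x | i = i0 /\ (~` A) x]).
  apply: measurableU => //; apply: (sa_imply (@sa_measurable _ X)).
  exact: measurableC.
apply/seteqP; split => x /=; first by move=> /fP'[]; [left|case; right].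
case=> [Pi|[-> nA]]; first by apply/fP => //; rewrite -cP; exists i.
rewrite /f; case: pickP => // l /set_mem Pl.
by case: nA; rewrite -cP; exists l.
Qed.

Let cell n w : mu (iterated_join TA A P (n := n) w `&` A) = nu (itinerary TA f n @^-1` [set w]).
Proof.
have io0 := io_full sysS mA A0; have mio := measurableC (measurable_io sysS mA).
have mj : measurable (iterated_join TA A P w `&` A).
  apply: measurableI => //; apply: measurableI => //.
  apply: fin_bigcap_measurable; first exact: finite_finset.
  move=> j _.
  exact: (mp_iter_measurable mpA).
have mn : measurable (itinerary TA f n @^-1` [set w] `&` A).
  by apply: measurableI => //; exact: (mf_nm mpA).
have key x : A x -> io S A x -> iterated_join TA A P w x <-> itinerary TA f n x = w.
  move=> Ax iox; have An j : A (iter j TA x).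
    elim: j => [//|j _]; rewrite iterS.
    by have [] := return_timeP (io_hits (io_iter_induced A j iox)).
  split => [[_ h]|<-].
    by apply/ffunP => j; rewrite ffunE; apply/(fP _ (An j)); exact: h.
  by split => // j _; rewrite /preimage/=; apply/(fP _ (An j)); rewrite ffunE.
apply/eqP; rewrite eq_le; apply/andP; split.
  apply: (le_mu_null mj mn mio io0) => x [jx Ax].
  by have [iox|nio] := pselect (io S A x); [left; split => //; exact/key|right].
apply: (le_mu_null mn mj mio io0) => x [jx Ax].
by have [iox|nio] := pselect (io S A x); [left; split => //; exact/key|right].
Qed.

Let HHE (I : finType) (g : X -> I) :
  - \sum_i (fmu nu (g @^-1` [set i]) / c) * ln (fmu nu (g @^-1` [set i]) / c) =
  entropy nu g / c.
Proof.
rewrite /entropy /cond_entropy mulNr (big_pred1 tt)/=; last by case.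
have e : (fun=> tt) @^-1` [set tt] = [set: X] by apply/seteqP; split.
congr (- _); rewrite mulr_suml; apply: eq_bigr => i _; rewrite e setIT mulrAC.
by rewrite /fmu /= /mrestr setTI.
Qed.

Let entropyE : entropy_wrt (induced_measure mu A) TA A P =
  limn (fun n => entropy nu (itinerary TA f n) / c / n%:R).
Proof.
congr (limn _); apply/funext => n; congr (_ / _); rewrite -HHE /partition_entropy.
congr (- _); apply: eq_bigr => w _; rewrite /induced_measure.
have e : fine (mu (iterated_join TA A P w `&` A)) = fmu nu (itinerary TA f n @^-1` [set w]).
  by congr fine; exact: cell.
by rewrite e.
Qed.

Lemma label_entropy0 : (forall i, Pi nu TA (P i)) ->
  entropy_wrt (induced_measure mu A) TA A P = 0.
Proof.
move=> PP; rewrite entropyE; apply: (zent_rate nufin mpA mff c0).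
pose s := [seq P i | i <- enum 'I_k].
have ns (i : 'I_k) : nth set0 s i = P i.
  by rewrite (nth_map i0) ?size_enum_ord// nth_ord_enum.
have ss : size s = k by rewrite size_map size_enum_ord.
have ms : alls measurable s.
  by move=> i; rewrite ss => ik; rewrite (ns (Ordinal ik)).
apply: (zent_fac nufin mpA (mf_inds ms)); last first.
  apply: (zent_inds nufin mpA ms) => i; rewrite ss => ik.
  by rewrite (ns (Ordinal ik)); apply/(PiP nufin mpA) => //; exact: PP.
move=> x y xy; rewrite /f; congr odflt; apply: eq_pick => i.
have si : (i < size s)%N by rewrite ss.
by have := fac_inds_nth si xy; rewrite /ind ns.
Qed.

Lemma label_predictable : entropy_wrt (induced_measure mu A) TA A P <= 0 ->
  forall i, Pi nu TA (P i).
Proof.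
rewrite entropyE => /(rate_zent nufin mpA mff c0) zf i.
have zi : Pi nu TA (f @^-1` [set i]).
  apply/(PiP nufin mpA); first exact: mff.
  apply: zent_fac zf => // x y; rewrite /ind => e.
  by apply/idP/idP => /set_mem /= h; apply/mem_set; rewrite /= -h e.
apply: (csub_goodA mA (csub_PiA sysS mA A0 Af) zi (mP i) measurable0 (measure0 mu)).
by move=> x Ax _; split => h; apply/fP.
Qed.

End label.

Lemma predictable_partition_entropy : (forall i, Pi nu TA (P i)) ->
  entropy_wrt (induced_measure mu A) TA A P = 0.
Proof.
have [x Ax] : A !=set0 by apply/set0P/eqP => A00; move: A0; rewrite A00 measure0 ltxx.
have [i _ _] : (\bigcup_(i in [set: 'I_k]) P i) x by rewrite cP.
exact: (label_entropy0 i).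
Qed.

Lemma entropy_partition_predictable :
  entropy_wrt (induced_measure mu A) TA A P <= 0 -> forall i, Pi nu TA (P i).
Proof. by move=> h i; exact: (label_predictable i). Qed.

End partitions.

(** * The ring of predictable sets with log-integrable return time *)

Section ring_of_predictable_sets.
Context (d : measure_display) (X : measurableType d) (R : realType).
Variables (m : {sigma_finite_measure set X -> \bar R}) (T : X -> X).
Hypothesis sysT : sys m T.
Implicit Types (A B E F P Q : set X) (C : set (set X)).

Let Tmp : measure_preserving m T. Proof. by case: sysT. Qed.

Let mTk k A : measurable A -> measurable (iter k T @^-1` A).
Proof. exact: (mp_iter_measurable Tmp). Qed.

Let future_measurable F : measurable F -> future_iterates T F `<=` measurable.
Proof. by move=> mF _ [k _ <-]; exact: mTk. Qed.

Let null_or_pos A : measurable A -> m A = 0%E \/ (0 < m A)%E.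
Proof.
move=> mA; have [?|] := boolP (0 < m A)%E; [by right|rewrite -leNgt => A0; left].
by apply/eqP; rewrite eq_le A0 measure_ge0.
Qed.

Lemma FPiP F : FPi m T F <-> zero_entropy_set m T F /\ log_return m T F.
Proof.
split.
  move=> [[mF Ff pF] [_ /andP[F0 _] lF]]; split => //.
  apply: (predictable_zero_entropy sysT mF F0 Ff lF).
  by rewrite -(mod_nullP m (future_measurable mF)).
move=> [zF lF]; have [mF F0f _] := zF; have /andP[F0 Ff] := F0f.
split; split => //; rewrite (mod_nullP m (future_measurable mF)).
exact: (zero_entropy_predictable sysT).
Qed.

Lemma FPi_future F : FPi m T F -> sigma0 m (future_iterates T F) F.
Proof. by move=> [[mF _]]; rewrite (mod_nullP m (future_measurable mF)). Qed.

Lemma FPi_preimage F : FPi m T F -> FPi m T (T @^-1` F).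
Proof.
move=> FF; have pF := FPi_future FF; have /FPiP[[mF F0f _] lF] := FF.
have mTF : measurable (T @^-1` F) by exact: (mTk 1).
have mu_TF : m (T @^-1` F) = m F by exact: (mp_iter_mu Tmp 1).
have lTF := log_return_preimage sysT mF lF.
split; split => //; rewrite ?mu_TF//; first by case/andP: F0f.
rewrite (mod_nullP m (future_measurable mTF)).
apply: (cg_preimage_stable (S := T) (k := 1) Tmp
  (csub_cg m (future_measurable mTF)) (future_measurable mF) _ pF) => _ [k /= k0 <-].
apply: sub_cg; exists k => //.
by apply/funext => x; exact: (congr1 F (iterSr k T x)).
Qed.

Lemma FPi_iter k F : FPi m T F -> FPi m T (iter k T @^-1` F).
Proof.
elim: k => [//|k IH] /IH h; rewrite (_ : _ @^-1` _ = T @^-1` (iter k T @^-1` F)).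
  exact: FPi_preimage.
by apply/funext => x; exact: (congr1 F (iterSr k T x)).
Qed.

(** All bases have the same sets of zero entropy; this is where the
    log-integrability of the return time to [F] enters, through
    [predictable_Pi]. *)
Lemma ZE_FPi A F : zero_entropy_set m T A -> FPi m T F -> ZE m T A = ZE m T F.
Proof.
move=> zA FF; have [mA /andP[A0 Af] _] := zA.
have /FPiP[[mF /andP[F0 Ff] _] _] := FF.
have ZF : ZE m T A F.
  split => // j; have Fj := FPi_iter j FF.
  have /FPiP[[mj /andP[j0 jf] _] lj] := Fj.
  exact: (predictable_Pi sysT zA mj j0 jf lj (FPi_future Fj)).
have [zF AF] := ZE_change sysT zA ZF F0 Ff.
have ZA : ZE m T F A by apply: AF; exact: (ZE_base sysT zA).
have [_ FA] := ZE_change sysT zF ZA A0 Af.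
by apply/seteqP; split.
Qed.

Lemma null_log_ZE F A : FPi m T F -> null_sets m A ->
  [/\ ZE m T F A, (m A < +oo)%E & log_return m T A].
Proof.
move=> /FPiP[zF _] [mA A0]; split; last exact: (log_return_null sysT).
  by have [_ _] := csub_ZE sysT zF; apply.
by rewrite A0.
Qed.

Lemma FPi0P F A : FPi m T F ->
  FPi0 m T A <-> [/\ ZE m T F A, (m A < +oo)%E & log_return m T A].
Proof.
move=> FF; have /FPiP[zF _] := FF; split.
  case=> [FA|nA]; last exact: null_log_ZE.
  have /FPiP[zA lA] := FA; split => //; last by case: zA => _ /andP[].
  by rewrite -(ZE_FPi zA FF); exact: (ZE_base sysT zA).
move=> [ZA Af lA]; have mA : measurable A by case: ZA.
have [A0|A0] := null_or_pos mA; [by right|left].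
by apply/FPiP; split => //; have [] := ZE_change sysT zF ZA A0 Af.
Qed.

Let common_base A B : FPi0 m T A -> FPi0 m T B ->
  (exists F, FPi m T F) \/ (null_sets m A /\ null_sets m B).
Proof.
by move=> [FA|nA]; [left; exists A|move=> [FB|nB]; [left; exists B|right]].
Qed.

Lemma FPi0_setring : setring (FPi0 m T).
Proof.
split.
- by right; split => //; exact: measure0.
- move=> A B FA FB; have [[F FF]|[[mA A0] [mB B0]]] := common_base FA FB; last first.
    right; split; first exact: measurableU.
    apply/eqP; rewrite eq_le measure_ge0 andbT; apply: (@le_trans _ _ (m A + m B)%E).
      exact: measureU2.
    by rewrite A0 B0 adde0.
  move: FA FB => /(FPi0P _ FF)[ZA Af lA] /(FPi0P _ FF)[ZB Bf lB].
  have /FPiP[zF _] := FF; have [sZ mZ _] := csub_ZE sysT zF.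
  apply/(FPi0P _ FF); split; first exact: (saU sZ).
    by apply: le_lt_trans (lte_add_pinfty Af Bf); apply: measureU2; exact: mZ.
  by apply: log_returnU => //; exact: mZ.
- move=> A B FA FB; have [[F FF]|[[mA A0] [mB B0]]] := common_base FA FB; last first.
    by right; apply: (null_setsP (N := A)) => //; exact: measurableD.
  move: FA FB => /(FPi0P _ FF)[ZA Af lA] /(FPi0P _ FF)[ZB Bf lB].
  have /FPiP[zF _] := FF; have [sZ mZ _] := csub_ZE sysT zF.
  have ZD := saD sZ ZA ZB; have mD := mZ _ ZD; have mA := mZ _ ZA.
  apply/(FPi0P _ FF); split => //.
    by apply: le_lt_trans Af; apply: le_measure; rewrite ?inE//; move=> x [].
  by apply: (log_return_sub sysT mA Af mD _ lA) => x [].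
Qed.

(** The sets predictable for the induced transformation are written with a
    sigma-algebra of subsets of [F]; it is the trace of the sigma-algebra of
    subsets of the whole space that defines [Pi]. *)
Lemma induced_predictableP F A : measurable F -> (0 < m F)%E -> (m F < +oo)%E ->
  A `<=` F ->
  induced_predictable m T F A <-> Pi_on m T F A.
Proof.
move=> mF F0 Ff AF.
pose G' := [set iter k (induced_map T F) @^-1` A | k in [set k | (0 < k)%N]].
pose G := [set F `&` (iter k (induced_map T F) @^-1` A) | k in [set k | (0 < k)%N]].
have [mpF _ _] := sys_induced sysT mF F0 Ff.
have mG' : measurable A -> G' `<=` measurable.
  by move=> mA _ [k _ <-]; exact: (mp_iter_measurable mpF).
split.
  move=> [mA _ [_ [B GB AB]]]; split => //.
  have cK := csub_cg (restr m F) (mG' mA); have [sK mK nK] := cK.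
  have KF : sigma0 (restr m F) G' F.
    rewrite -[X in sigma0 _ _ X]setCK; apply: (saC sK); apply: nK; split; first exact: measurableC.
    by rewrite /restr setICl measure0.
  have KB : sigma0 (restr m F) G' B.
    move: B GB {AB}; apply: smallest_sub.
      split; first exact: (sa0 sK).
      - by move=> B KB; apply: (saD sK).
      - by move=> D KD; exact: (sa_bigcup sK).
    move=> _ [k k0 <-]; apply: (saI sK) => //; apply: sub_cg; by exists k.
  apply: (csub_eq (mu := mrestr m mF) cK KB mA).
  have mAB : measurable (A `+` B) by apply: measurableY => //; exact: mK.
  apply/eqP; rewrite eq_le measure_ge0 andbT -AB; apply: le_measure; rewrite ?inE//.
  exact: measurableI.
move=> [mA pA]; split => //; split => //.
have : mod_null (restr m F) <<s G'>> A.
  by rewrite (mod_nullP (mrestr m mF) (mG' mA)).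
move=> [_ [B GB AB]]; exists (B `&` F); last first.
  rewrite -AB /restr; congr (m _); apply/seteqP; split => x.
    case=> [[Ax nB]|[[Bx Fx] nA]]; last by split => //; right.
    by split; [left; split => // Bx; apply: nB; split => //; exact: AF|exact: AF].
  by case=> [[[Ax nB]|[Bx nA]] Fx]; [left; split => // -[]|right].
have sS := smallest_sigma_algebra F G.
move: B GB {AB}; apply: smallest_sub.
  have [S0 SC SU] := sS; split => /=; first by rewrite set0I.
  - move=> B GB; rewrite setTD (_ : _ `&` _ = F `\` (B `&` F)); first exact: SC.
    apply/seteqP; split => x; first by move=> [nB Fx]; split => // -[].
    by move=> [Fx nBF]; split => // Bx; exact: nBF.
  - by move=> D GD; rewrite setI_bigcupl; exact: SU.
by move=> _ [k k0 <-]; apply: sub_gen_smallest; exists k => //; rewrite setIC.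
Qed.

Lemma FPi0_trace F : FPi m T F ->
  [set A | FPi0 m T A /\ A `<=` F] = induced_predictable m T F.
Proof.
move=> FF; have /FPiP[zF lF] := FF; have [mF /andP[F0 Ff] _] := zF.
apply/seteqP; split => A.
  move=> [/(FPi0P _ FF)[ZA _ _] AF]; apply/induced_predictableP => //.
  exact: ZE_Pi.
move=> pA; have [mA AF _] := pA; split => //.
have /(induced_predictableP mF F0 Ff AF) PA := pA.
apply/(FPi0P _ FF); split; first exact: (Pi_ZE sysT zF).
  by apply: le_lt_trans Ff; apply: le_measure; rewrite ?inE.
exact: (log_return_sub sysT mF Ff mA AF lF).
Qed.

(** * The maximal factor of zero entropy *)

Section base.
Variable F : set X.
Hypothesis FF : FPi m T F.

Let zF : zero_entropy_set m T F. Proof. by have /FPiP[] := FF. Qed.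
Let mF : measurable F. Proof. by case: zF. Qed.
Let F0 : (0 < m F)%E. Proof. by case: zF => _ /andP[]. Qed.
Let Ff : (m F < +oo)%E. Proof. by case: zF => _ /andP[]. Qed.
Let io0 : m (~` [set x | io T F x]) = 0%E. Proof. exact: io_full. Qed.

Let FPi_measurable : FPi m T `<=` measurable.
Proof. by move=> A [[]]. Qed.

Lemma FPi_sub_ZE : <<s FPi m T >> `<=` ZE m T F.
Proof.
have [sZ _ _] := csub_ZE sysT zF; apply: smallest_sub => // A FA.
by have [] : [/\ ZE m T F A, (m A < +oo)%E & log_return m T A] by apply/FPi0P => //; left.
Qed.

(** A set of zero entropy is exhausted by its intersections with the preimages
    of [F], which have log-integrable return times. *)
Lemma ZE_sub_FPi : ZE m T F `<=` mod_null m <<s FPi m T >>.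
Proof.
move=> P ZP; rewrite (mod_nullP m FPi_measurable).
have cK := csub_cg m FPi_measurable; have [sK _ nK] := cK.
have [sZ mZ _] := csub_ZE sysT zF; have mP := mZ _ ZP.
apply: (csub_good cK (B := \bigcup_n (P `&` iter n T @^-1` F)) _ mP
  (measurable_io sysT mF) io0); last first.
  move=> x /(_ 0%N)[n [_ Fn]]; split => [Px|[? _ []//]].
  by exists n.
apply: (sa_bigcup sK) => n.
have Fn := FPi_iter n FF; have /FPiP[[mFn /andP[_ Fnf] _] lFn] := Fn.
have ZPn : ZE m T F (P `&` iter n T @^-1` F).
  by apply: (saI sZ) => //; apply: (ZE_iter sysT); exact: (ZE_base sysT zF).
have mPn := mZ _ ZPn.
have : FPi0 m T (P `&` iter n T @^-1` F).
  apply/(FPi0P _ FF); split => //.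
    by apply: le_lt_trans Fnf; apply: le_measure; rewrite ?inE//; move=> x [].
  by apply: (log_return_sub sysT mFn Fnf mPn _ lFn) => x [].
by case=> [FP|]; [exact: sub_cg|exact: nK].
Qed.

Lemma factor_FPi : dyn_factor m T <<s FPi m T >>.
Proof.
have sS := smallest_sigma_algebra [set: X] (FPi m T).
have Sm : <<s FPi m T >> `<=` measurable.
  by apply: smallest_sub => //; exact: sa_measurable.
have ST A : <<s FPi m T >> A -> <<s FPi m T >> (T @^-1` A).
  move: A; apply: smallest_sub; first exact: sa_preimage.
  by move=> A FA; apply: sub_gen_smallest; exact: FPi_preimage.
have Sk k : <<s FPi m T >> (iter k T @^-1` F).
  by apply: sub_gen_smallest; exact: FPi_iter.
split => //.
  move=> A SA; have STA := ST _ SA; split; first exact: Sm.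
  by exists (T @^-1` A) => //; rewrite setYK measure0.
exists (fun n => if n is k.+1 then iter k T @^-1` F else ~` \bigcup_k iter k T @^-1` F).
  apply/seteqP; split => // x _; have [[k _ Fk]|nF] := pselect ((\bigcup_k iter k T @^-1` F) x).
    by exists k.+1.
  by exists 0%N.
move=> [|k]; last by split => //; rewrite (mp_iter_mu Tmp).
have SU : <<s FPi m T >> (~` \bigcup_k iter k T @^-1` F) by apply: (saC sS); exact: (sa_bigcup sS).
have [_ U0] : null_sets m (~` \bigcup_k iter k T @^-1` F).
  apply: (null_setsP (N := ~` [set x | io T F x])) => //; first exact: Sm.
    exact/measurableC/(measurable_io sysT).
  by move=> x nF /(_ 0%N)[n [_ Fn]]; apply: nF; exists n.
by split => //; rewrite U0.
Qed.

Lemma krengel_entropy_FPi : krengel_entropy m T <<s FPi m T >> = 0%E.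
Proof.
rewrite /krengel_entropy; set A := xget _ _.
have [SA /andP[A0 Af]] : <<s FPi m T >> A /\ (0 < m A < +oo)%E.
  rewrite /A; case: xgetP => [B _ //|/(_ F)[]]; split; last by rewrite F0.
  exact: sub_gen_smallest.
have mA : measurable A by have [] := FPi_sub_ZE SA.
have [zA FA] := ZE_change sysT zF (FPi_sub_ZE SA) A0 Af.
have [sZ mZ _] := csub_ZE sysT zA.
suff -> : ks_entropy (induced_measure m A) (induced_map T A) A (strace <<s FPi m T >> A) = 0%E.
  by rewrite mule0.
have zero k (P : 'I_k -> set X) : partition_of A (strace <<s FPi m T >> A) P ->
    entropy_wrt (induced_measure m A) (induced_map T A) A P = 0.
  move=> [PD tP cP]; have ZP i : ZE m T A (P i).
    have [B SB <-] := PD i; apply: (saI sZ); last exact: (ZE_base sysT zA).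
    exact/FA/FPi_sub_ZE.
  apply: (predictable_partition_entropy sysT (mA := mA) A0 Af _ tP cP) => i; first exact: mZ.
  exact: ZE_Pi.
rewrite /ks_entropy -[RHS]ereal_sup1; congr ereal_sup.
apply/seteqP; split => [h [k [P [PP ->]]]|_ ->]; first by rewrite zero.
have PP : partition_of A (strace <<s FPi m T >> A) (fun _ : 'I_1 => A).
  split; [|by move=> i j _ _ _; rewrite !ord1|].
    by move=> _; exists A => //; rewrite setIid.
  by apply/seteqP; split => [x [] //|x Ax]; exists ord0.
by exists 1%N, (fun=> A); split => //; rewrite zero.
Qed.

Section other_factor.
Variable C : set (set X).
Hypothesis fC : dyn_factor m T C.

Let sC : sigma_algebra [set: X] C. Proof. by case: fC. Qed.
Let Cm : C `<=` measurable. Proof. by case: fC. Qed.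

Let C_pos : exists A, C A /\ (0 < m A < +oo)%E.
Proof.
have [_ _ _ [E EX CE]] := fC; apply: contrapT => nE.
have E0 n : m (E n) = 0%E.
  have [CEn Enf] := CE n; have [//|En0] := null_or_pos (Cm CEn).
  by case: nE; exists (E n); rewrite En0.
have X0 : m [set: X] = 0%E.
  by rewrite -EX; apply: null_bigcup => // n; have [/Cm] := CE n.
move: F0; rewrite ltNge; apply/negP; rewrite negbK -X0.
by apply: le_measure; rewrite ?inE.
Qed.

Let C_iter j B : C B -> exists2 Y, C Y & m (iter j T @^-1` B `+` Y) = 0%E.
Proof.
have [_ _ TC _] := fC; elim: j B => [|j IH] B CB.
  by exists B => //; rewrite setYK measure0.
have [_ [Y CY BY]] := TC _ CB; have [Z CZ YZ] := IH _ CY.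
exists Z => //.
have mB := Cm CB; have mY := Cm CY; have mZ := Cm CZ.
have mTB : measurable (T @^-1` B) by exact: (mTk 1).
have BY' : m (iter j.+1 T @^-1` B `+` iter j T @^-1` Y) = 0%E.
  by apply: (null_preimage sysT j _ BY); exact: measurableY.
by apply: (setY_null_trans _ _ mZ BY' YZ); exact: mTk.
Qed.

(** In a factor of zero entropy every two-set partition of a base has zero
    entropy, so all its sets are predictable for the induced transformation. *)
Lemma factor_ZE : krengel_entropy m T C = 0%E -> C `<=` ZE m T F.
Proof.
rewrite /krengel_entropy; set A := xget _ _.
have [CA /andP[A0 Af]] : C A /\ (0 < m A < +oo)%E.
  by rewrite /A; case: xgetP => [B _ //|nA]; have [B /nA] := C_pos.
move=> /eqP; rewrite mule_eq0 gt_eqF//= => /eqP h0.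
have mA := Cm CA.
have cPi := csub_PiA sysT mA A0 Af; have [sPi _ _] := cPi.
have PC B : C B -> Pi_on m T A B.
  move=> CB; have mB := Cm CB.
  pose P (i : 'I_2) := if i == ord0 then B `&` A else (~` B) `&` A.
  have mP i : measurable (P i).
    by rewrite /P; case: ifP => _; apply: measurableI => //; exact: measurableC.
  have tP : trivIset [set: 'I_2] P.
    move=> i j _ _ [x []]; rewrite /P => Pi Pj.
    have : (i == ord0) = (j == ord0).
      by move: Pi Pj; case: ifP => _ [Bx _]; case: ifP => _ [Bx' _].
    move: i j {Pi Pj} => [[|[|//]] ?] [[|[|//]] ?] //= _; exact/val_inj.
  have cP : \bigcup_(i in [set: 'I_2]) P i = A.
    apply/seteqP; split => [x [i _]|x Ax]; first by rewrite /P; case: eqP => _ [].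
    by have [Bx|nB] := pselect (B x); [exists ord0|exists (lift ord0 ord0)].
  have hP : entropy_wrt (induced_measure m A) (induced_map T A) A P <= 0.
    rewrite -lee_fin; apply: (@le_trans _ _ (ks_entropy (induced_measure m A) (induced_map T A) A (strace C A))); last by rewrite h0.
    apply: ereal_sup_ubound; exists 2%N, P; split => //.
    split => // i; rewrite /P; case: ifP => _; first by exists B.
    by exists (~` B) => //; exact: (saC sC).
  have := entropy_partition_predictable sysT mA A0 Af mP tP cP hP ord0.
  rewrite /P eqxx => PB.
  apply: (csub_goodA mA cPi PB mB measurable0 (measure0 m)) => x Ax _.
  by split => [Bx|[]].
have PCj j B : C B -> Pi_on m T A (iter j T @^-1` B).
  move=> CB; have [Y CY BY] := C_iter j CB.
  have mjB := mTk j (Cm CB); have mY := Cm CY.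
  apply: (csub_eq (mu := mrestr m mA) cPi (PC _ CY) mjB).
  have mBY : measurable (iter j T @^-1` B `+` Y) by exact: measurableY.
  apply/eqP; rewrite eq_le measure_ge0 andbT -BY; apply: le_measure; rewrite ?inE//.
  exact: measurableI.
have zA : zero_entropy_set m T A.
  split => //; first by rewrite A0.
  by apply: (sa_return_time sPi) => k _; exact: PCj.
by rewrite -(ZE_FPi zA FF) => B CB; split; [exact: Cm|move=> j; exact: PCj].
Qed.

End other_factor.
End base.
End ring_of_predictable_sets.

Unset Implicit Arguments.
Set Strict Implicit.

Theorem theorem5p1 (d : measure_display) (X : measurableType d) (R : realType)
    (m : {sigma_finite_measure set X -> \bar R}) (T : X -> X)
    (Tmp : measure_preserving m T)
    (Tcons : conservative m T)
    (Terg : ergodic m T)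
    (Tllb : log_lower_bounded m T) :
  (setring (FPi0 m T) /\
   forall F : set X, FPi m T F ->
     [set A | FPi0 m T A /\ A `<=` F] = induced_predictable m T F)
  /\
  (FPi m T !=set0 ->
     [/\ dyn_factor m T <<s FPi m T >>,
         krengel_entropy m T <<s FPi m T >> = 0%E &
         forall C : set (set X), dyn_factor m T C -> krengel_entropy m T C = 0%E ->
           C `<=` mod_null m <<s FPi m T >>]).
Proof.
have sysT : sys m T by [].
split; first by split; [exact: FPi0_setring|exact: FPi0_trace].
move=> [F FF]; split; [exact: factor_FPi FF|exact: krengel_entropy_FPi FF|].
move=> C fC h0 B CB; apply: (ZE_sub_FPi sysT FF); exact: (factor_ZE sysT FF fC h0).
Qed.
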